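(* Let $F:\mathbb{C}\to\mathbb{C}$ be an entire function, $F\not\equiv 0$, let $a\in\mathbb{C}$ be a center of $\dot{x}=F(x)$, and let $\mathcal{V}$ be the center basin (period annulus) of $F$ in $a$. Then $\mathcal{V}$ is open and unbounded, and all orbits on $\partial\mathcal{V}$ are unbounded.
   Context: Consider the autonomous planar system $\dot{x}=F(x)$, $x\in\mathbb{C}$, $t\in\mathbb{R}$; $\Gamma(x)$ denotes the (full) orbit through $x$ on the maximal interval of existence. For a closed Jordan curve $\Gamma$, $\operatorname{Int}(\Gamma)$ denotes the bounded component of $\mathbb{C}\setminus\Gamma$. Equilibria are the zeros of $F$. A center is a simple zero $a$ of $F$ having a neighborhood in which all orbits other than $\{a\}$ are closed periodic orbits surrounding $a$. The center basin (period annulus) of $a$ is $\mathcal{V}:=\{a\}\cup\{x\in\mathbb{C}:\Gamma(x)\text{ is a (nonconstant) periodic orbit with }a\in\operatorname{Int}(\Gamma(x))\}$. $\partial\mathcal{V}$ is the topological boundary in $\mathbb{C}$. An orbit is unbounded if it is an unbounded subset of $\mathbb{C}$. *)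

(* Defs.v *)
From HB Require Import structures.
From mathcomp Require Import all_boot all_order all_algebra.
From mathcomp Require Import complex.
From mathcomp Require Import all_classical all_reals all_analysis.

Set Implicit Arguments.
Unset Strict Implicit.
Unset Printing Implicit Defensive.

Import Order.TTheory GRing.Theory Num.Theory.
Import numFieldNormedType.Exports.

Local Open Scope classical_set_scope.
Local Open Scope ring_scope.

(* The complex plane R[i], seen as a numClosedFieldType so that the topology, the
   complex derivative and boundedness are the library's generic ones. *)
Definition cplane (R : realType) : numClosedFieldType := R[i].

Section PlanarFlow.
Variable R : realType.
Local Notation C := (cplane R).
Implicit Types (F : C -> C) (x a : C) (I : set R) (phi : R -> C).

(* The base field of [derivable] is C: this is complex differentiability. *)
Definition entire F := forall z : C, derivable F z 1.

(* The time t is real, so x' = F(x) is read on real and imaginary parts. *)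
Definition ode_solution F x I phi :=
  [/\ open I, is_interval I, I 0, phi 0 = x &
    forall t, I t ->
      is_derive t (1 : R) (fun s => complex.Re (phi s)) (complex.Re (F (phi t)))
      /\
      is_derive t (1 : R) (fun s => complex.Im (phi s)) (complex.Im (F (phi t)))].

Definition maximal_solution F x I phi :=
  ode_solution F x I phi /\
  forall J psi, ode_solution F x J psi -> I `<=` J ->
    (forall t, I t -> psi t = phi t) -> J `<=` I.

Definition ode_orbit F x : set C :=
  [set y | exists I phi, maximal_solution F x I phi /\ (phi @` I) y].

Definition periodic_orbit F x :=
  exists phi T,
    [/\ maximal_solution F x setT phi, 0 < T,
        forall t, phi (t + T) = phi t & exists t, phi t != x].

(* The union of the bounded connected components of the complement of G.  When
   G is a Jordan curve there is exactly one such component. *)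
Definition jordan_int (G : set C) : set C :=
  [set z | ~ G z /\ bounded_set (connected_component (~` G) z)].

Definition surrounding_periodic_orbit F a x :=
  periodic_orbit F x /\ jordan_int (ode_orbit F x) a.

Definition simple_zero F a := F a = 0 /\ derive1 F a != 0.

Definition is_center F a :=
  simple_zero F a /\ \forall x \near a^', surrounding_periodic_orbit F a x.

Definition center_basin F a : set C :=
  [set a] `|` [set x | surrounding_periodic_orbit F a x].

Definition unbounded (A : set C) := ~ bounded_set A.

Definition boundary (A : set C) : set C := closure A `\` A^°.

End PlanarFlow.

(* Main.v *)
Require Import Defs.
From mathcomp Require Import all_boot all_order all_algebra.
From mathcomp Require Import complex ring lra.
From mathcomp Require Import all_classical all_reals all_analysis.
Set Implicit Arguments.
Unset Strict Implicit.
Unset Printing Implicit Defensive.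
Import Order.TTheory GRing.Theory Num.Theory.
Import numFieldNormedType.Exports.
Local Open Scope classical_set_scope.
Local Open Scope ring_scope.

(** The basin of a center is described through complex time.  Where [F] does not
    vanish, [1 / F] has a local primitive, and in this coordinate the field is
    constant; so solutions extend to complex time, and the flows of [F] and of [i F]
    commute ([rectifying_coordinate], [local_flow], [strip]).  A periodic orbit
    therefore has a tube filled by the orbits [Z (t + i y)], [y] fixed, which all have
    the same period ([periodic_strip]).

    Consequences.  First, having a given period [T] is an open condition at regular
    points, and it is closed among regular points with global orbits
    ([period_closed]).  Second, in a tube, either all orbits surround [a] or none does
    ([parallel_surround]): the bounded component of [a] is enlarged or diminished by
    the part of the tube between two orbits.  Third, orbits of a fixed period near an
    equilibrium [b] remain near [b] by Gronwall's lemma, so they do not surround [a]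
    unless [b = a] ([equilibrium_excluded]).  All the orbits near [a] have a common
    period [T], since a punctured disc is connected ([common_period]).

    Let [V] consist of [a] and of the points of period [T] whose orbit surrounds [a].
    It is open by the first two facts.  The main point is [T_basin_closed]: a point of
    the closure of [V] with a bounded orbit is in [V].  Indeed it is not an
    equilibrium other than [a], its orbit is global ([bounded_global]), hence of
    period [T], and it lies in a tube with orbits of [V].  It follows that [V] is the
    whole basin ([center_basin_eq]): inside any orbit surrounding [a], all orbits are
    bounded, so [V] is open and closed in the component of [a].  It follows as well
    that the orbits on the boundary of [V] are unbounded.  Finally [V] is unbounded,
    for otherwise it would have a boundary point, whose orbit stays in the closure of
    [V] ([closure_T_basin_invariant]) and would be bounded.

    The only facts of complex analysis used are Goursat's version of Cauchy's theorem
    for rectangles ([loop_eq0]) and the existence of primitives that it gives. *)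

(** * Real modulus and topology of the complex plane *)

Section ComplexModulus.
Variable R : realType.
Local Notation C := (cplane R).
Local Notation re z := (complex.Re (z : R[i])).
Local Notation im z := (complex.Im (z : R[i])).
Implicit Types z w : C.

Definition mk (x y : R) : C := (x +i* y)%C.
(** The modulus as a real number: the norm of [C] takes its values in [C], where
    linear arithmetic is not available. *)
Definition md (z : C) : R := Num.sqrt (re z ^+ 2 + im z ^+ 2).

Lemma mkE z : mk (re z) (im z) = z. Proof. by case: z. Qed.
Lemma cplane_ext z w : re z = re w -> im z = im w -> z = w.
Proof. by case: z => a b; case: w => c d /= -> ->. Qed.
Lemma reD z w : re (z + w) = re z + re w. Proof. by case: z; case: w. Qed.
Lemma imD z w : im (z + w) = im z + im w. Proof. by case: z; case: w. Qed.
Lemma reN z : re (- z) = - re z. Proof. by case: z. Qed.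
Lemma imN z : im (- z) = - im z. Proof. by case: z. Qed.
Lemma reM z w : re (z * w) = re z * re w - im z * im w.
Proof. by case: z; case: w. Qed.
Lemma imM z w : im (z * w) = re z * im w + im z * re w.
Proof. by case: z; case: w. Qed.
Lemma re0 : re 0 = 0. Proof. by []. Qed.
Lemma im0 : im 0 = 0. Proof. by []. Qed.
Lemma re1 : re 1 = 1. Proof. by []. Qed.
Lemma im1 : im 1 = 0. Proof. by []. Qed.
Definition cE := (reD, imD, reN, imN, reM, imM, re0, im0, re1, im1).

Lemma normE z : `|z| = mk (md z) 0. Proof. by case: z. Qed.
Lemma md_ge0 z : 0 <= md z. Proof. exact: sqrtr_ge0. Qed.
Lemma mdE z : md z = re `|z|. Proof. by rewrite normE. Qed.
Lemma sqr_md z : md z ^+ 2 = re z ^+ 2 + im z ^+ 2.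
Proof. by rewrite sqr_sqrtr // addr_ge0 // sqr_ge0. Qed.
Lemma mk_le (x y : R) : (mk x 0 <= mk y 0) = (x <= y).
Proof. by rewrite /Order.le /= eqxx. Qed.
Lemma mk_lt (x y : R) : (mk x 0 < mk y 0) = (x < y).
Proof. by rewrite /Order.lt /= eqxx. Qed.
Lemma mkD (x y x' y' : R) : mk x y + mk x' y' = mk (x + x') (y + y').
Proof. by []. Qed.
Lemma mkN (x y : R) : - mk x y = mk (- x) (- y).
Proof. by []. Qed.
Lemma mkM (x y x' y' : R) :
  mk x y * mk x' y' = mk (x * x' - y * y') (x * y' + y * x').
Proof. by []. Qed.
Lemma mk_normE z (e : R) : (`|z| < mk e 0) = (md z < e).
Proof. by rewrite normE mk_lt. Qed.
Lemma mdD z w : md (z + w) <= md z + md w.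
Proof.
have := ler_normD z w; rewrite !normE mkD addr0.
by rewrite mk_le.
Qed.
Lemma mdM z w : md (z * w) = md z * md w.
Proof.
have := normrM z w; rewrite !normE mkM mulr0 subr0 => h.
by have := congr1 (fun z : C => re z) h.
Qed.
Lemma mdN z : md (- z) = md z.
Proof. by have := congr1 (fun z : C => re z) (normrN z); rewrite !normE. Qed.
Lemma mdC z w : md (z - w) = md (w - z).
Proof. by rewrite -mdN opprB. Qed.
Lemma md0 : md 0 = 0.
Proof. by rewrite mdE normr0. Qed.
Lemma md1 : md 1 = 1.
Proof. by rewrite mdE normr1. Qed.
Lemma md_eq0 z : (md z == 0) = (z == 0).
Proof.
apply/eqP/eqP => [h|->]; last exact: md0.
by apply/eqP; rewrite -normr_eq0 normE h.
Qed.
Lemma md_gt0 z : (0 < md z) = (z != 0).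
Proof. by rewrite lt_def md_ge0 andbT md_eq0. Qed.
Lemma md_mk0 (x : R) : md (mk x 0) = `|x|.
Proof. by rewrite /md /= expr0n /= addr0 sqrtr_sqr. Qed.
Lemma md_mk0i (x : R) : md (mk 0 x) = `|x|.
Proof. by rewrite /md /= expr0n /= add0r sqrtr_sqr. Qed.
Lemma re_le z : `|re z| <= md z.
Proof.
rewrite -(ler_pXn2r (n := 2)) ?nnegrE ?md_ge0 //.
by rewrite sqr_md -normrX ger0_norm ?sqr_ge0 // lerDl sqr_ge0.
Qed.
Lemma im_le z : `|im z| <= md z.
Proof.
rewrite -(ler_pXn2r (n := 2)) ?nnegrE ?md_ge0 //.
by rewrite sqr_md -normrX ger0_norm ?sqr_ge0 // lerDr sqr_ge0.
Qed.
Lemma md_le z : md z <= `|re z| + `|im z|.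
Proof.
rewrite -{1}(mkE z) -[mk _ _](_ : mk (re z) 0 + mk 0 (im z) = _); last first.
  by rewrite mkD addr0 add0r.
by rewrite (le_trans (mdD _ _)) // md_mk0 md_mk0i.
Qed.
Lemma mdV z : md z^-1 = (md z)^-1.
Proof.
have [->|z0] := eqVneq z 0; first by rewrite invr0 md0 invr0.
apply: (mulfI (x := md z)); first by rewrite md_eq0.
by rewrite -mdM !mulfV ?md_eq0 // md1.
Qed.
Lemma mdB_le z u w : md (z - w) <= md (z - u) + md (u - w).
Proof. by rewrite (le_trans _ (mdD _ _)) // addrA subrK. Qed.

Lemma cnbhsP z (A : set C) :
  nbhs z A <-> exists2 e : R, 0 < e & forall w, md (w - z) < e -> A w.
Proof.
split.
  move=> /nbhs_ballP[e /= e0 h].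
  have [er ei] : re e > 0 /\ im e = 0.
    by move: e0; rewrite /= ltcE /= => /andP[/eqP].
  exists (re e) => // w wz; apply: h; rewrite -ball_normE /=.
  have -> : e = mk (re e) 0 by rewrite -ei mkE.
  by rewrite mk_normE mdC.
move=> [e e0 h]; apply/nbhs_ballP; exists (mk e 0) => /=.
  by rewrite ltcE /= eqxx.
by move=> w; rewrite -ball_normE /= mk_normE mdC => /h.
Qed.

Lemma copenP (A : set C) : open A <->
  forall z, A z -> exists2 e : R, 0 < e & forall w, md (w - z) < e -> A w.
Proof.
rewrite openE; split => h z Az; first exact/cnbhsP/h.
exact/cnbhsP/h.
Qed.

Lemma cclosureP (A : set C) z : closure A z <->
  forall e : R, 0 < e -> exists2 w, A w & md (w - z) < e.
Proof.
split => [h e e0|h B].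
  have [|w [Aw /= we]] := h [set w | md (w - z) < e]; last by exists w.
  by apply/cnbhsP; exists e.
move/cnbhsP => [e e0 eB]; have [w Aw wz] := h _ e0.
by exists w; split => //; exact: eB.
Qed.

Lemma cboundedP (A : set C) : bounded_set A <->
  exists M : R, forall z, A z -> md z <= M.
Proof.
split.
  move=> [M [Mr h]].
  exists (re M + 1) => z Az.
  have Mi : im M = 0.
    by move: Mr; rewrite realE !lecE /= => /orP[] /andP[/eqP].
  have h1 : M < mk (re M + 1) 0 by rewrite ltcE /= Mi eqxx ltrDl ltr01.
  have : `|z| <= mk (re M + 1) 0 := h _ h1 z Az.
  by rewrite normE mk_le.
move=> [M h]; exists (mk M 0); split.
  by rewrite realE !lecE /= !eqxx /= le_total.
move=> x xM z Az; change (`|z| <= x); rewrite normE.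
have xi : im x = 0 by move: xM; rewrite ltcE /= => /andP[/eqP].
have xr : M < re x by move: xM; rewrite ltcE /= => /andP[].
by rewrite -(mkE x) xi mk_le (le_trans (h _ Az)) // ltW.
Qed.

Lemma cdnbhsP z (A : set C) : (\forall w \near z^', A w) <->
  exists2 e : R, 0 < e & forall w, md (w - z) < e -> w != z -> A w.
Proof.
rewrite /dnbhs /within /= -/(nbhs _ _) -nearE.
by split => /cnbhsP.
Qed.

(** Stated with the real modulus, so that all estimates take place in the ordered
    field [R]. *)
Definition cdiff (f : C -> C) z (d : C) := forall e : R, 0 < e ->
  exists2 r : R, 0 < r & forall w, md (w - z) < r ->
    md (f w - f z - d * (w - z)) <= e * md (w - z).

Lemma derivable_cdiff (f : C -> C) z : derivable f z 1 -> exists d, cdiff f z d.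
Proof.
move=> /cvg_ex[d /cvgrPdist_lt fd]; exists (d : C) => e e0.
have e0' : 0 < mk e 0 by rewrite ltcE /= eqxx.
have /cdnbhsP[r r0 h] := fd _ e0'.
exists r => // w wr.
have [->|wz] := eqVneq w z; first by rewrite !subrr mulr0 subr0 md0 mulr0.
have := h (w - z); rewrite subr0 subr_eq0 => /(_ wr wz).
rewrite mk_normE => {h} h.
have wz0 : w - z != 0 by rewrite subr_eq0.
have -> : f w - f z - d * (w - z) =
  - ((d - (w - z)^-1 *: (f ((w - z) *: 1 + z) - f z)) * (w - z)).
  rewrite [_ *: 1]mulr1 subrK mulrBl [_ *: _]mulrC mulfVK //.
  by rewrite opprB.
rewrite mdN mdM ler_wpM2r ?md_ge0 //; exact: ltW.
Qed.

Lemma mk_dist x y q : md (mk x y - q) <= `|x - re q| + `|y - im q|.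
Proof. by rewrite (le_trans (md_le _)) // !(reD, imD, reN, imN). Qed.

End ComplexModulus.

(** * Calculus and compactness on the real line *)

Section RealCalculus.
Variable R : realType.
Implicit Types (f g : R -> R) (P : R -> Prop).

Definition rdiff f t (d : R) := forall e : R, 0 < e ->
  exists2 r : R, 0 < r & forall s, `|s - t| < r ->
    `|f s - f t - d * (s - t)| <= e * `|s - t|.

Lemma rdiffP f t d : is_derive t (1 : R) f d <-> rdiff f t d.
Proof.
split.
  move=> [fd fv] e e0; move: fd; rewrite /derivable => fd.
  have : h^-1 *: ((f \o shift t) (h *: 1) - f t) @[h --> 0^'] --> d.
    by rewrite -fv.
  move=> /cvgrPdist_le /(_ e e0) /nbhs_ballP[r /= r0 h].
  exists r => // s st.
  have [->|sneq] := eqVneq s t.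
    by rewrite !subrr mulr0 subr0 normr0 mulr0.
  have st0 : s - t != 0 by rewrite subr_eq0.
  have := h (s - t); rewrite -ball_normE /= sub0r normrN => /(_ st st0).
  have -> : (s - t) *: (1 : R) + t = s by rewrite [_ *: _]mulr1 subrK.
  move=> {}h.
  have -> : f s - f t - d * (s - t) =
      - ((d - (s - t)^-1 *: (f s - f t)) * (s - t)).
    by rewrite mulrBl [_ *: _]mulrC mulfVK // opprB.
  by rewrite normrN normrM ler_wpM2r.
move=> fd.
have cv : h^-1 *: ((f \o shift t) (h *: 1) - f t) @[h --> 0^'] --> d.
  apply/cvgrPdist_le => e e0; have [r r0 h] := fd e e0.
  apply/nbhs_ballP; exists r => //= k; rewrite -ball_normE /= sub0r normrN => kr k0.
  have := h (k + t); rewrite addrK => /(_ kr) {}h.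
  rewrite [k *: _]mulr1 distrC.
  have -> : k^-1 *: (f (k + t) - f t) - d = (f (k + t) - f t - d * k) / k.
    by rewrite [_ *: _]mulrC [in RHS]mulrBl mulfK.
  by rewrite normrM normfV ler_pdivrMr ?normr_gt0.
split; first by apply/cvg_ex; exists d.
exact: cvg_lim.
Qed.

Lemma rdiff_MVT f g (a b c e : R) : a <= b ->
  (forall u, a <= u <= b -> rdiff f u (g u)) ->
  (forall u, a <= u <= b -> `|g u - c| <= e) ->
  `|f b - f a - c * (b - a)| <= e * (b - a).
Proof.
move=> ab fd ge.
have [||x xab ->] := @MVT_segment R f g a b ab.
- move=> x /itvP xab; apply/rdiffP/fd.
  by rewrite !ltW ?xab.
- apply: derivable_within_continuous => x xab.
  have xab' : a <= x <= b by move: xab; rewrite in_itv.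
  by have [] := (rdiffP _ _ _).2 (fd x xab').
rewrite -mulrBl normrM [`|b - a|]ger0_norm ?subr_ge0 //.
by rewrite ler_wpM2r ?subr_ge0 //; apply: ge; move: xab; rewrite in_itv.
Qed.

(** Completeness of the line as an induction principle: the infimum of the
    points where [P] fails can neither be reached nor passed. *)
Lemma real_ind P (a b : R) : P a ->
  (forall t, a <= t < b -> (forall s, a <= s <= t -> P s) ->
    exists2 r : R, 0 < r & forall s, t < s < t + r -> s <= b -> P s) ->
  (forall t, a < t <= b -> (forall s, a <= s < t -> P s) -> P t) ->
  forall t, a <= t <= b -> P t.
Proof.
move=> Pa Pr Pl t0 /andP[at0 t0b]; apply: contrapT => nPt0.
pose B : set R := [set t | a <= t <= b /\ ~ P t].
have B0 : B !=set0 by exists t0; split=> //; rewrite at0.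
have lB : lbound B a by move=> t [/andP[]].
have hB : has_lbound B by exists a.
pose m := inf B.
have am : a <= m by exact: lb_le_inf.
have mb : m <= b by rewrite (le_trans _ t0b) // ge_inf //; split => //; rewrite at0.
have good s : a <= s < m -> P s.
  move=> /andP[as_ sm]; apply: contrapT => nPs.
  have : m <= s by apply: ge_inf => //; split => //; rewrite as_ /= (le_trans (ltW sm)).
  by rewrite leNgt sm.
have Pm : P m.
  move: am; rewrite le_eqVlt => /orP[/eqP <-//|am].
  by apply: Pl => //; rewrite am.
have good2 s : a <= s <= m -> P s.
  move=> /andP[as_]; rewrite le_eqVlt => /orP[/eqP ->//|sm].
  by apply: good; rewrite as_.
have mlb : m < b.
  rewrite lt_neqAle mb andbT; apply/eqP => mE.
  by apply: nPt0; apply: good2; rewrite at0 mE.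
have [|r r0 hr] := Pr m _ good2; first by rewrite am.
have [//|x [/andP[ax xb] nPx] xm] := @inf_adherent R B r r0.
apply: nPx; have [xm'|mx] := leP x m; first by apply: good2; rewrite ax.
by apply: hr => //; rewrite mx.
Qed.

(** Compactness of a segment, for a property antitone in a size: local sizes
    have a common positive lower bound. *)
Lemma heine (Q : R -> R -> Prop) (a b : R) :
  (forall s r r', 0 < r' -> r' <= r -> Q s r -> Q s r') ->
  (forall t, a <= t <= b ->
    exists2 r : R, 0 < r & forall s, `|s - t| < r -> Q s r) ->
  exists2 r : R, 0 < r & forall s, a <= s <= b -> Q s r.
Proof.
move=> Qm Ql; have [ab|ba] := leP a b; last first.
  exists 1 => // s /andP[as_ sb]; have := le_trans as_ sb; by rewrite leNgt ba.
pose P t := exists2 r : R, 0 < r & forall s, a <= s <= t -> Q s r.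
suff : P b by [].
apply: (@real_ind P a b) => //.
- have [|r r0 h] := Ql a; first by rewrite lexx.
  exists r => // s /andP[as_ sa]; have -> : s = a by apply/le_anti/andP.
  by apply: h; rewrite subrr normr0.
- move=> t /andP[at_ tb] /(_ t); rewrite at_ lexx => /(_ isT)[r r0 hr].
  have [|q q0 hq] := Ql t; first by rewrite at_ ltW.
  exists q => // s /andP[ts stq] sb; exists (Num.min r q); first by rewrite lt_min r0.
  move=> u /andP[au us]; have [ut|tu] := leP u t.
    by apply: (@Qm _ r); rewrite ?lt_min ?r0 ?ge_min ?lexx //; apply: hr; rewrite au.
  apply: (@Qm _ q); rewrite ?lt_min ?r0 ?ge_min ?lexx ?orbT //; apply: hq.
  by rewrite gtr0_norm ?subr_gt0 // ltrBlDl (le_lt_trans us).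
- move=> t /andP[at_ tb] hs.
  have [|q q0 hq] := Ql t; first by rewrite tb ltW.
  have [|r r0 hr] := hs (Num.max a (t - q / 2)).
    by rewrite le_max lexx gt_max at_ ltrBlDr ltrDl divr_gt0.
  exists (Num.min r q); first by rewrite lt_min r0.
  move=> u /andP[au ut]; have [ut'|tu] := leP u (Num.max a (t - q / 2)).
    by apply: (@Qm _ r); rewrite ?lt_min ?r0 ?ge_min ?lexx //; apply: hr; rewrite au.
  apply: (@Qm _ q); rewrite ?lt_min ?r0 ?ge_min ?lexx ?orbT //; apply: hq.
  move: tu; rewrite gt_max => /andP[_ tu].
  by rewrite ltr_norml; apply/andP; split; lra.
- by rewrite ab lexx.
Qed.

Definition rcont f t := forall e : R, 0 < e ->
  exists2 r : R, 0 < r & forall s, `|s - t| < r -> `|f s - f t| < e.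

Lemma rcontP f t : rcont f t -> {for t, continuous f}.
Proof.
move=> fc; apply/cvgrPdist_lt => e e0; have [r r0 h] := fc e e0.
apply/nbhs_ballP; exists r => //= s.
rewrite /ball /= distrC => /h; by rewrite distrC.
Qed.

Lemma rcont_antiderivative g (a b : R) : a < b ->
  (forall t, a <= t <= b -> rcont g t) ->
  exists A : R -> R, forall t, a < t < b -> rdiff A t (g t).
Proof.
move=> ab gc.
have gi : (@lebesgue_measure R).-integrable `[a, b] (EFin \o g).
  apply: continuous_compact_integrable; first exact: segment_compact.
  apply: continuous_in_subspaceT => t; rewrite inE /= in_itv /= => tab.
  exact/rcontP/gc.
eexists => t /andP[at_ tb].
have [|d1 d2] := @continuous_FTC1_closed R g a t b tb gi at_.
  by apply/rcontP/gc; rewrite !ltW.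
apply/rdiffP; split; first exact: d1.
by rewrite -derive1E.
Qed.

Lemma rdiff_nincr (f g : R -> R) (a b : R) : a <= b ->
  (forall t, a <= t <= b -> rdiff f t (g t)) ->
  (forall t, a <= t <= b -> g t <= 0) -> f b <= f a.
Proof.
move=> ab fd g0.
have [||c cab] := @MVT_segment R f g a b ab.
- by move=> t /itvP tab; apply/rdiffP/fd; rewrite !ltW ?tab.
- apply: derivable_within_continuous => t tab.
  have tab' : a <= t <= b by move: tab; rewrite in_itv.
  by have [] := (rdiffP _ _ _).2 (fd t tab').
rewrite -(subr_le0 (f a)) => ->; apply: mulr_le0_ge0; last by rewrite subr_ge0.
by apply: g0; move: cab; rewrite in_itv.
Qed.

Lemma rdiffM (f g : R -> R) t a b : rdiff f t a -> rdiff g t b ->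
  rdiff (fun s => f s * g s) t (f t * b + g t * a).
Proof.
move=> /rdiffP h1 /rdiffP h2; exact/rdiffP.
Qed.

Lemma rdiffN (f : R -> R) t a : rdiff f t a -> rdiff (fun s => - f s) t (- a).
Proof.
move=> h e /h[r r0 k]; exists r => // s /k.
by rewrite -normrN; congr (`|_| <= _); ring.
Qed.

Lemma rdiffD (f g : R -> R) t a b : rdiff f t a -> rdiff g t b ->
  rdiff (fun s => f s + g s) t (a + b).
Proof.
move=> /rdiffP h1 /rdiffP h2; exact/rdiffP.
Qed.

Lemma rdiff_subC (f : R -> R) t a (k : R) : rdiff f t a -> rdiff (fun s => f s - k) t a.
Proof.
move=> h e /h[r r0 q]; exists r => // s /q.
by congr (`|_| <= _); ring.
Qed.

(** [u * exp (- K t)] decreases and [u * exp (K t)] increases. *)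
Lemma gronwall (u v : R -> R) (a b K : R) : a <= b ->
  (forall t, a <= t <= b -> rdiff u t (v t)) ->
  (forall t, a <= t <= b -> `|v t| <= K * u t) ->
  u b <= expR (K * (b - a)) * u a /\ u a <= expR (K * (b - a)) * u b.
Proof.
move=> ab ud uv.
have expd (k t : R) : rdiff (fun s => expR (k * (s - a))) t (k * expR (k * (t - a))).
  have aff : is_derive t (1 : R) (fun s => k * (s - a)) k.
    apply/rdiffP => e e0; exists 1 => // s _.
    have -> : k * (s - a) - k * (t - a) - k * (s - t) = 0 by ring.
    by rewrite normr0 mulr_ge0 // ltW.
  by rewrite mulrC; apply/rdiffP.
split.
  have := @rdiff_nincr (fun s => expR (- K * (s - a)) * u s)
    (fun s => expR (- K * (s - a)) * v s + u s * (- K * expR (- K * (s - a)))) a b ab.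
  rewrite subrr mulr0 expR0 mul1r => h.
  have : expR (- K * (b - a)) * u b <= u a.
    apply: h => t tab.
      exact: (rdiffM (expd (- K) t) (ud t tab)).
    have -> : expR (- K * (t - a)) * v t + u t * (- K * expR (- K * (t - a))) =
      expR (- K * (t - a)) * (v t - K * u t) by ring.
    by rewrite mulr_ge0_le0 ?expR_ge0 // subr_le0 (le_trans (ler_norm _)) // uv.
  by rewrite mulNr expRN mulrC ler_pdivrMr ?expR_gt0 // mulrC.
have := @rdiff_nincr (fun s => - (expR (K * (s - a)) * u s))
  (fun s => - (expR (K * (s - a)) * v s + u s * (K * expR (K * (s - a))))) a b ab.
rewrite subrr mulr0 expR0 mul1r => h.
rewrite -lerN2; apply: h => t tab.
  exact: (rdiffN (rdiffM (expd K t) (ud t tab))).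
have -> : - (expR (K * (t - a)) * v t + u t * (K * expR (K * (t - a)))) =
  - (expR (K * (t - a)) * (v t + K * u t)) by ring.
rewrite oppr_le0 mulr_ge0 ?expR_ge0 //.
have := uv t tab; rewrite ler_norml => /andP[h1 _]; lra.
Qed.

Lemma heine2 (Q : R -> R -> R -> Prop) (a b c d : R) :
  (forall x y r r', 0 < r' -> r' <= r -> Q x y r -> Q x y r') ->
  (forall x y, a <= x <= b -> c <= y <= d -> exists2 r : R, 0 < r &
     forall x' y', `|x' - x| < r -> `|y' - y| < r -> Q x' y' r) ->
  exists2 r : R, 0 < r & forall x y, a <= x <= b -> c <= y <= d -> Q x y r.
Proof.
move=> Qm Ql.
have [||r r0 h] := @heine (fun x r => forall y, c <= y <= d -> Q x y r) a b.
- by move=> x r r' r'0 rr' h y /h; exact: Qm.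
- move=> x xab.
  have [||r r0 h] := @heine (fun y r => forall x', `|x' - x| < r -> Q x' y r) c d.
  + move=> y r r' r'0 rr' h x' xr'; apply: (Qm _ _ r) => //.
    by apply: h; exact: lt_le_trans rr'.
  + move=> y ycd; have [r r0 h] := Ql x y xab ycd; exists r => // y' yr x' xr.
    exact: h.
  exists r => // x' xr y ycd; exact: h.
by exists r => // x y xab; exact: h.
Qed.

Lemma periodic_ind (P : R -> Prop) (T : R) : 0 < T ->
  (forall t, P t -> P (t + T)) -> (forall t, P t -> P (t - T)) ->
  (forall t, 0 <= t <= T -> P t) -> forall t, P t.
Proof.
move=> T0 h1 h2 h3.
have h n : forall t, - (n%:R * T) <= t <= n%:R * T + T -> P t.
  elim: n => [|n IH] t; first by rewrite mul0r oppr0 add0r; exact: h3.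
  rewrite -natr1 mulrDl mul1r => /andP[k1 k2].
  have n0 : 0 <= n%:R * T by rewrite mulr_ge0 // ltW.
  have [t0|t0] := ltP t 0.
    by rewrite -(addrK T t); apply: h2; apply: IH; apply/andP; split; lra.
  have [tT|tT] := leP t T; first by apply: h3; rewrite t0.
  by rewrite -(subrK T t); apply: h1; apply: IH; apply/andP; split; lra.
move=> t; apply: (h (Num.bound `|t / T|)).
have := archi_boundP (normr_ge0 (t / T)).
rewrite {1}normrM normfV (gtr0_norm T0) ltr_pdivrMr // ltr_norml => /andP[k1 k2].
by apply/andP; split; lra.
Qed.

(** Completeness in the form needed for iterations: [x n - 2 c / 2 ^+ n] increases
    and is bounded by every [x n + 2 c / 2 ^+ n]. *)
Lemma geometric_limit (x : nat -> R) (c : R) :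
  (forall n, `|x n.+1 - x n| <= c / 2 ^+ n) ->
  exists l, forall n, `|l - x n| <= 2 * c / 2 ^+ n.
Proof.
move=> h.
have step n : x n - 2 * c / 2 ^+ n <= x n.+1 - 2 * c / 2 ^+ n.+1 /\
    x n.+1 + 2 * c / 2 ^+ n.+1 <= x n + 2 * c / 2 ^+ n.
  have := h n; rewrite ler_norml => /andP[h1 h2].
  have -> : 2 * c / 2 ^+ n.+1 = c / 2 ^+ n.
    by rewrite exprS; field; rewrite expf_neq0.
  by rewrite -[2 * c / _]mulrA mulr_natl; split; lra.
have mono m n : (m <= n)%N -> x m - 2 * c / 2 ^+ m <= x n - 2 * c / 2 ^+ n /\
    x n + 2 * c / 2 ^+ n <= x m + 2 * c / 2 ^+ m.
  elim: n => [|n IH]; first by rewrite leqn0 => /eqP->.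
  rewrite leq_eqVlt => /orP[/eqP->//|/IH[h1 h2]]; have [h3 h4] := step n.
  by split; [exact: le_trans h3|exact: le_trans h2].
have c0 n : 0 <= 2 * c / 2 ^+ n.
  by rewrite -[2 * c / _]mulrA mulr_ge0 // (le_trans (normr_ge0 _) (h n)).
pose A : set R := range (fun n => x n - 2 * c / 2 ^+ n).
have ub m : ubound A (x m + 2 * c / 2 ^+ m).
  move=> _ [n _ <-]; case: (leqP n m) => [/mono[k _]|/ltnW/mono[_ k]].
    by rewrite (le_trans k) // lerD2l ge0_cp.
  by rewrite (le_trans _ k) // lerD2l ge0_cp.
exists (sup A) => n; rewrite ler_distl; apply/andP; split.
  by apply: ub_le_sup; [exists (x 0%N + 2 * c / 2 ^+ 0)|exists n].
by apply: ge_sup; [exists (x 0%N - 2 * c / 2 ^+ 0), 0%N|exact: ub].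
Qed.

Lemma half_pow_lt (K e : R) : 0 < e -> exists n : nat, K / 2 ^+ n < e.
Proof.
move=> e0; have [K0|K0] := leP K 0.
  by exists 0%N; rewrite expr0 divr1 (le_lt_trans K0).
exists (Num.bound (K / e)).
rewrite ltr_pdivrMr ?exprn_gt0 // -ltr_pdivrMl // mulrC.
have ab0 : 0 <= K / e by rewrite divr_ge0 // ltW.
by rewrite (lt_trans (archi_boundP ab0)) // -natrX ltr_nat ltn_expl.
Qed.

End RealCalculus.

(** * Curves in the plane and complex differentiability *)

Section Curves.
Variable R : realType.
Local Notation C := (cplane R).
Local Notation re z := (complex.Re (z : R[i])).
Local Notation im z := (complex.Im (z : R[i])).
Implicit Types (z w c : C) (f G : C -> C) (phi : R -> C).

Definition rc (x : R) : C := mk x 0.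
Definition ci : C := mk 0 1.

Lemma rcD (x y : R) : rc (x + y) = rc x + rc y.
Proof. by rewrite /rc mkD addr0. Qed.
Lemma rcN (x : R) : rc (- x) = - rc x.
Proof. by rewrite /rc mkN oppr0. Qed.
Lemma rcB (x y : R) : rc (x - y) = rc x - rc y.
Proof. by rewrite rcD rcN. Qed.
Lemma rcM (x y : R) : rc (x * y) = rc x * rc y.
Proof. by rewrite /rc mkM !mul0r mulr0 subr0 addr0. Qed.
Lemma rc0 : rc 0 = 0. Proof. by []. Qed.
Lemma rc1 : rc 1 = 1. Proof. by []. Qed.
Lemma md_rc (x : R) : md (rc x) = `|x|. Proof. exact: md_mk0. Qed.
Lemma md_ci : md ci = 1. Proof. by rewrite md_mk0i normr1. Qed.
Lemma mk_rc (x y : R) : mk x y = rc x + ci * rc y.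
Proof. by rewrite /rc /ci mkM mkD; congr mk; ring. Qed.
Lemma re_rcM (x : R) z : re (rc x * z) = x * re z.
Proof. by rewrite reM /= mul0r subr0. Qed.
Lemma im_rcM (x : R) z : im (rc x * z) = x * im z.
Proof. by rewrite imM /= mul0r addr0. Qed.

(** The counterpart of [cdiff] for curves; [vderP] relates it to the derivatives
    of the two coordinates. *)
Definition vder phi t (v : C) := forall e : R, 0 < e ->
  exists2 r : R, 0 < r & forall s, `|s - t| < r ->
    md (phi s - phi t - rc (s - t) * v) <= e * `|s - t|.

Lemma vder_rdiff phi t v : vder phi t v <->
  rdiff (fun s => re (phi s)) t (re v) /\ rdiff (fun s => im (phi s)) t (im v).
Proof.
split.
  move=> h; split=> e e0; have [r r0 hr] := h e e0; exists r => // s /hr;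
    apply: le_trans.
    by rewrite (le_trans _ (re_le _)) // !cE /= mul0r subr0 [re v * _]mulrC.
  by rewrite (le_trans _ (im_le _)) // !cE /= mul0r addr0 [im v * _]mulrC.
move=> [h1 h2] e e0; have e20 : 0 < e / 2 by rewrite divr_gt0.
have [r1 r10 k1] := h1 _ e20; have [r2 r20 k2] := h2 _ e20.
exists (Num.min r1 r2); first by rewrite lt_min r10.
move=> s; rewrite lt_min => /andP[/k1 {}k1 /k2 {}k2].
rewrite (le_trans (md_le _)) //; move: (lerD k1 k2).
rewrite !cE /= !mul0r subr0 addr0 [re v * _]mulrC [im v * _]mulrC -mulrDl -splitr.
exact.
Qed.

Lemma vderP phi t v : vder phi t v <->
  is_derive t (1 : R) (fun s => re (phi s)) (re v) /\
  is_derive t (1 : R) (fun s => im (phi s)) (im v).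
Proof.
by rewrite vder_rdiff; split => -[h1 h2]; split; apply/rdiffP.
Qed.

(** The mean value inequality holds in each coordinate, whence the factor 2. *)
Lemma curve_MVT phi (v : R -> C) (a b e : R) c :
  (forall u, Num.min a b <= u <= Num.max a b -> vder phi u (v u)) ->
  (forall u, Num.min a b <= u <= Num.max a b -> md (v u - c) <= e) ->
  md (phi b - phi a - rc (b - a) * c) <= 2 * e * `|b - a|.
Proof.
wlog ab : a b / a <= b.
  move=> h; have [ab|] := boolP (a <= b); first exact: h.
  rewrite -ltNge => ba.
  rewrite minC maxC => h1 h2; have := h b a (ltW ba) h1 h2.
  rewrite distrC -mdN; congr (md _ <= _).
  by rewrite -[b - a]opprB rcN; ring.
rewrite (min_idPl ab) (max_idPr ab) => h1 h2.
have e0 : 0 <= e by apply: (le_trans (md_ge0 _) (h2 a _)); rewrite lexx.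
rewrite ger0_norm ?subr_ge0 // (le_trans (md_le _)) //.
rewrite -mulrA mulr_natl mulr2n !(reD, imD, reN, imN) re_rcM im_rcM ![(b - a) * _]mulrC; apply: lerD.
  apply: (@rdiff_MVT _ (fun s => re (phi s)) (fun u => re (v u))) => // u uab.
    by have /vder_rdiff[] := h1 u uab.
  by rewrite (le_trans _ (h2 u uab)) // (le_trans _ (re_le _)) // !cE.
apply: (@rdiff_MVT _ (fun s => im (phi s)) (fun u => im (v u))) => // u uab.
  by have /vder_rdiff[] := h1 u uab.
by rewrite (le_trans _ (h2 u uab)) // (le_trans _ (im_le _)) // !cE.
Qed.

Definition ccont f z := forall e : R, 0 < e ->
  exists2 r : R, 0 < r & forall w, md (w - z) < r -> md (f w - f z) < e.

Definition vcont phi t := forall e : R, 0 < e ->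
  exists2 r : R, 0 < r & forall s, `|s - t| < r -> md (phi s - phi t) < e.

Lemma cdiff_lip f z d : cdiff f z d -> exists2 r : R, 0 < r &
  forall w, md (w - z) < r -> md (f w - f z) <= (1 + md d) * md (w - z).
Proof.
move=> fd; have [r r0 h] := fd 1 ltr01; exists r => // w wr.
rewrite -[f w - f z](subrK (d * (w - z))) (le_trans (mdD _ _)) //.
by rewrite mulrDl mdM lerD // h.
Qed.

Lemma cdiff_cont f z d : cdiff f z d -> ccont f z.
Proof.
move=> /cdiff_lip[r r0 h] e e0.
have k0 : 0 < 1 + md d by rewrite ltr_wpDr ?md_ge0.
exists (Num.min r (e / (1 + md d))); first by rewrite lt_min r0 divr_gt0.
move=> w; rewrite lt_min => /andP[/h]; rewrite ltr_pdivlMr // => h1 h2.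
by rewrite (le_lt_trans h1) // mulrC.
Qed.

Lemma vder_lip phi t v : vder phi t v -> exists2 r : R, 0 < r &
  forall s, `|s - t| < r -> md (phi s - phi t) <= (1 + md v) * `|s - t|.
Proof.
move=> fd; have [r r0 h] := fd 1 ltr01; exists r => // w wr.
rewrite -[phi w - phi t](subrK (rc (w - t) * v)) (le_trans (mdD _ _)) //.
by rewrite mulrDl mdM md_rc [md v * _]mulrC lerD // h.
Qed.

Lemma vder_cont phi t v : vder phi t v -> vcont phi t.
Proof.
move=> /vder_lip[r r0 h] e e0.
have k0 : 0 < 1 + md v by rewrite ltr_wpDr ?md_ge0.
exists (Num.min r (e / (1 + md v))); first by rewrite lt_min r0 divr_gt0.
move=> w; rewrite lt_min => /andP[/h]; rewrite ltr_pdivlMr // => h1 h2.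
by rewrite (le_lt_trans h1) // mulrC.
Qed.

Lemma cdiff_vder G phi t d v : cdiff G (phi t) d -> vder phi t v ->
  vder (fun s => G (phi s)) t (d * v).
Proof.
move=> Gd pv e e0.
have [r1 r10 lip] := vder_lip pv.
pose k := 1 + md v; have k0 : 0 < k by rewrite ltr_wpDr ?md_ge0.
have d0 : 0 < 1 + md d by rewrite ltr_wpDr ?md_ge0.
have [|r2 r20 h2] := Gd (e / 2 / k); first by rewrite !divr_gt0.
have [|r3 r30 h3] := pv (e / 2 / (1 + md d)); first by rewrite !divr_gt0.
exists (Num.min r1 (Num.min (r2 / k) r3)); first by rewrite !lt_min r10 r30 divr_gt0.
move=> s; rewrite !lt_min => /and3P[/lip l1 l2 /h3 l3].
have /h2 {}h2 : md (phi s - phi t) < r2.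
  by rewrite (le_lt_trans l1) // mulrC -ltr_pdivlMr.
have -> : G (phi s) - G (phi t) - rc (s - t) * (d * v) =
  (G (phi s) - G (phi t) - d * (phi s - phi t)) +
  d * (phi s - phi t - rc (s - t) * v) by ring.
rewrite (le_trans (mdD _ _)) // [e]splitr mulrDl lerD //.
  rewrite (le_trans h2) // (le_trans (ler_wpM2l _ l1)) //.
    by rewrite !divr_ge0 // ltW.
  by rewrite mulrA -/k mulfVK // gt_eqF.
rewrite mdM (le_trans (ler_wpM2l (md_ge0 _) l3)) // mulrA ler_wpM2r //.
rewrite mulrCA ler_piMr ?divr_ge0 ?ltW //.
by rewrite ltr_pdivrMr // mul1r ltrDr.
Qed.

Lemma vder_line w c t : vder (fun s => w + rc s * c) t c.
Proof.
move=> e e0; exists 1 => // s _.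
rewrite [X in md X](_ : _ = 0); last by rewrite rcB; ring.
by rewrite md0 mulr_ge0 // ltW.
Qed.

Lemma vder_shift phi t v (a : R) : vder phi (t + a) v ->
  vder (fun s => phi (s + a)) t v.
Proof.
move=> h e /h[r r0 k]; exists r => // s st.
by have := k (s + a); rewrite [s + a - _](_ : _ = s - t); [exact|ring].
Qed.

Lemma vder_add phi psi t v w : vder phi t v -> vder psi t w ->
  vder (fun s => phi s + psi s) t (v + w).
Proof.
move=> h1 h2 e e0; have e20 : 0 < e / 2 by rewrite divr_gt0.
have [r1 r10 k1] := h1 _ e20; have [r2 r20 k2] := h2 _ e20.
exists (Num.min r1 r2); first by rewrite lt_min r10.
move=> s; rewrite lt_min => /andP[/k1 {}k1 /k2 {}k2].
rewrite [X in md X](_ : _ = (phi s - phi t - rc (s - t) * v) +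
  (psi s - psi t - rc (s - t) * w)); last by ring.
by rewrite (le_trans (mdD _ _)) // [e]splitr mulrDl lerD.
Qed.

Lemma vder_mul c phi t v : vder phi t v -> vder (fun s => c * phi s) t (c * v).
Proof.
move=> h e e0; have k0 : 0 < 1 + md c by rewrite ltr_wpDr ?md_ge0.
have [|r r0 k] := h (e / (1 + md c)); first by rewrite divr_gt0.
exists r => // s /k {}k.
rewrite [X in md X](_ : _ = c * (phi s - phi t - rc (s - t) * v)); last by ring.
rewrite mdM (le_trans (ler_wpM2l (md_ge0 _) k)) // mulrA ler_wpM2r //.
by rewrite mulrCA ler_piMr ?ltW // ltr_pdivrMr // mul1r ltrDr.
Qed.

Lemma vder_cst c t : vder (fun=> c) t 0.
Proof.
move=> e e0; exists 1 => // s _.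
by rewrite subrr mulr0 subr0 md0 mulr_ge0 // ltW.
Qed.

Lemma vder_ext phi psi t v (r : R) : 0 < r ->
  (forall s, `|s - t| < r -> phi s = psi s) -> vder phi t v -> vder psi t v.
Proof.
move=> r0 hr h e /h[q q0 k]; exists (Num.min r q); first by rewrite lt_min r0.
move=> s; rewrite lt_min => /andP[sr sq].
by rewrite -!hr ?subrr ?normr0 //; exact: k.
Qed.

Lemma cdiff_ext f G z d (r : R) : 0 < r ->
  (forall w, md (w - z) < r -> f w = G w) -> cdiff f z d -> cdiff G z d.
Proof.
move=> r0 hr h e /h[q q0 k]; exists (Num.min r q); first by rewrite lt_min r0.
move=> s; rewrite lt_min => /andP[sr sq].
by rewrite -!hr ?subrr ?md0 //; exact: k.
Qed.

Lemma cdiff_shift f z d w : cdiff f (z + w) d -> cdiff (fun u => f (u + w)) z d.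
Proof.
move=> h e /h[r r0 k]; exists r => // s st.
by have := k (s + w); rewrite [s + w - _](_ : _ = s - z); [exact|ring].
Qed.

Lemma cdiff_mul c f z d : cdiff f z d -> cdiff (fun w => c * f w) z (c * d).
Proof.
move=> h e e0; have k0 : 0 < 1 + md c by rewrite ltr_wpDr ?md_ge0.
have [|r r0 k] := h (e / (1 + md c)); first by rewrite divr_gt0.
exists r => // s /k {}k.
rewrite [X in md X](_ : _ = c * (f s - f z - d * (s - z))); last by ring.
rewrite mdM (le_trans (ler_wpM2l (md_ge0 _) k)) // mulrA ler_wpM2r ?md_ge0 //.
by rewrite mulrCA ler_piMr ?ltW // ltr_pdivrMr // mul1r ltrDr.
Qed.

(** A primitive of the first order expansion of a function at [q]. *)
Lemma cdiff_quad (c d : C) q z :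
  cdiff (fun w => c * w + d / 2 * (w - q) ^+ 2) z (c + d * (z - q)).
Proof.
move=> e e0; have k0 : 0 < 1 + md (d / 2) by rewrite ltr_wpDr ?md_ge0.
exists (e / (1 + md (d / 2))); first by rewrite divr_gt0.
move=> w; rewrite ltr_pdivlMr // => h.
rewrite [X in md X](_ : _ = (w - z) * (d / 2) * (w - z)); last by field.
rewrite mdM ler_wpM2r ?md_ge0 // mdM (le_trans _ (ltW h)) //.
by rewrite ler_wpM2l ?md_ge0 // lerDr.
Qed.

Lemma cdiff_inv f z d : f z != 0 -> cdiff f z d ->
  cdiff (fun w => (f w)^-1) z (- d / f z ^+ 2).
Proof.
move=> fz0 fd e e0.
have fc := cdiff_cont fd.
have m0 : 0 < md (f z) by rewrite md_gt0.
have [|r1 r10 h1] := fc (md (f z) / 2); first by rewrite divr_gt0.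
have [r2 r20 h2] := cdiff_lip fd.
pose m := md (f z).
have k0 : 0 < 1 + md d by rewrite ltr_wpDr ?md_ge0.
have [|r3 r30 h3] := fd (e * m ^+ 2 / 4); first by rewrite !pmulr_rgt0 ?exprn_gt0 ?invr_gt0.
pose r4 := e * m ^+ 3 / (4 * (1 + md d) ^+ 2).
have r40 : 0 < r4 by rewrite divr_gt0 ?mulr_gt0 ?exprn_gt0.
exists (Num.min (Num.min r1 r2) (Num.min r3 r4)); first by rewrite !lt_min r10 r20 r30.
move=> w; rewrite !lt_min => /andP[/andP[/h1 {}h1 /h2 {}h2] /andP[/h3 {}h3 wr4]].
have fw : m / 2 < md (f w).
  have := mdB_le (f z) (f w) 0; rewrite !subr0 mdC -/m => h.
  have h1' : md (f w - f z) < m / 2 := h1; lra.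
have fw0 : f w != 0 by rewrite -md_gt0 (lt_trans _ fw) // divr_gt0.
have -> : (f w)^-1 - (f z)^-1 - - d / f z ^+ 2 * (w - z) =
   (d * (f w - f z) * (w - z) - f z * (f w - f z - d * (w - z))) / (f w * f z ^+ 2).
  by field; rewrite fw0 fz0.
have P0 : 0 < md (f w) * m ^+ 2 by rewrite mulr_gt0 ?exprn_gt0 // md_gt0.
have -> : md ((d * (f w - f z) * (w - z) - f z * (f w - f z - d * (w - z))) / (f w * f z ^+ 2))
  = md (d * (f w - f z) * (w - z) - f z * (f w - f z - d * (w - z))) / (md (f w) * m ^+ 2).
  by rewrite mdM mdV mdM [in md (f z ^+ 2)]expr2 mdM.
rewrite ler_pdivrMr // (le_trans (mdD _ _)) // mdN !mdM -/m.
have x0 := md_ge0 (w - z).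
set x := md (w - z) in h2 h3 wr4 x0 *; set D := md d in k0 h2 r4 r40 wr4 *.
have D0 : 0 <= D := md_ge0 _.
have A1 : D * md (f w - f z) * x <= e * x * m ^+ 3 / 4.
  have : (1 + D) ^+ 2 * x <= e * m ^+ 3 / 4.
    move: (ltW wr4); rewrite ler_pdivlMr ?mulr_gt0 ?exprn_gt0 // => h.
    by rewrite ler_pdivlMr //; move: h; congr (_ <= _); ring.
  move=> A2.
  have A3 : D * md (f w - f z) <= (1 + D) ^+ 2 * x.
    rewrite expr2 -mulrA ler_pM ?md_ge0 //; lra.
  rewrite (le_trans (ler_wpM2r x0 (le_trans A3 A2))) //.
  by rewrite le_eqVlt; apply/orP; left; apply/eqP; field.
have A4 : m * md (f w - f z - d * (w - z)) <= e * x * m ^+ 3 / 4.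
  rewrite (le_trans (ler_wpM2l (ltW m0) h3)) //.
  by rewrite le_eqVlt; apply/orP; left; rewrite -/m; apply/eqP; field.
rewrite (le_trans (lerD A1 A4)) //.
have -> : e * x * (md (f w) * m ^+ 2) = (e * x * m ^+ 2) * md (f w) by ring.
have -> : e * x * m ^+ 3 / 4 + e * x * m ^+ 3 / 4 = (e * x * m ^+ 2) * (m / 2) by field.
by rewrite ler_wpM2l ?mulr_ge0 ?sqr_ge0 // ltW.
Qed.

Lemma curve_antiderivative (g : R -> C) (a b : R) : a < b ->
  (forall t, a <= t <= b -> vcont g t) ->
  exists A : R -> C, forall t, a < t < b -> vder A t (g t).
Proof.
move=> ab gc.
have [|A1 h1] := @rcont_antiderivative R (fun t => re (g t)) _ _ ab.
  move=> t /gc h e /h[r r0 k]; exists r => // s /k; apply: le_lt_trans.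
  by rewrite (le_trans _ (re_le _)) // !cE.
have [|A2 h2] := @rcont_antiderivative R (fun t => im (g t)) _ _ ab.
  move=> t /gc h e /h[r r0 k]; exists r => // s /k; apply: le_lt_trans.
  by rewrite (le_trans _ (im_le _)) // !cE.
exists (fun t => mk (A1 t) (A2 t)) => t tab; apply/vder_rdiff.
by split; [exact: h1|exact: h2].
Qed.

Lemma vcont_scale phi (t u : R) : vcont phi (u * t) -> vcont (fun s => phi (s * t)) u.
Proof.
move=> h e e0; have [r r0 k] := h e e0; have t0 : 0 < `|t| + 1 by rewrite ltr_wpDl.
exists (r / (`|t| + 1)); first by rewrite divr_gt0.
move=> s; rewrite ltr_pdivlMr // => sr; apply: k.
rewrite -mulrBl normrM (le_lt_trans _ sr) // ler_wpM2l // lerDl //.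
Qed.

Lemma ccont_bounded f (a b c d : R) :
  (forall x y, a <= x <= b -> c <= y <= d -> ccont f (mk x y)) ->
  exists M : R, forall x y, a <= x <= b -> c <= y <= d -> md (f (mk x y)) <= M.
Proof.
move=> fc.
have [||r r0 h] := @heine2 R (fun x y r => md (f (mk x y)) <= r^-1) a b c d.
- move=> x y r r' r'0 rr' h; rewrite (le_trans h) // lef_pV2 // posrE.
  exact: lt_le_trans rr'.
- move=> x y xab ycd; have [r r0 h] := fc x y xab ycd 1 ltr01.
  pose m := md (f (mk x y)) + 1.
  have m0 : 0 < m by rewrite ltr_wpDl ?md_ge0.
  have r10 : 0 < Num.min (r / 2) m^-1 by rewrite lt_min divr_gt0 // invr_gt0.
  exists (Num.min (r / 2) m^-1) => //.
  move=> x' y'; rewrite !lt_min => /andP[xr _] /andP[yr _].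
  have k : md (f (mk x' y') - f (mk x y)) < 1.
    by apply: h; rewrite (le_lt_trans (mk_dist _ _ _)) //= [r]splitr ltrD.
  have k2 : md (f (mk x' y')) <= m.
    by have := mdB_le (f (mk x' y')) (f (mk x y)) 0; rewrite !subr0 /m; lra.
  rewrite (le_trans k2) // -[leLHS]invrK lef_pV2 ?posrE ?invr_gt0 //.
  by rewrite ge_min lexx orbT.
by exists r^-1 => x y; exact: h.
Qed.

Lemma ccont_far f p (a b c d : R) :
  (forall x y, a <= x <= b -> c <= y <= d -> ccont f (mk x y) /\ f (mk x y) != p) ->
  exists2 e : R, 0 < e &
    forall x y, a <= x <= b -> c <= y <= d -> e <= md (f (mk x y) - p).
Proof.
move=> fc.
apply: (@heine2 R (fun x y r => r <= md (f (mk x y) - p)) a b c d).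
  by move=> x y r r' _ rr'; exact: le_trans.
move=> x y xab ycd; have [fcont fp] := fc x y xab ycd.
have m0 : 0 < md (f (mk x y) - p) / 2 by rewrite divr_gt0 // md_gt0 subr_eq0.
have [r r0 k] := fcont _ m0.
exists (Num.min (r / 2) (md (f (mk x y) - p) / 2)); first by rewrite lt_min divr_gt0.
move=> x' y'; rewrite !lt_min => /andP[xr _] /andP[yr _].
rewrite ge_min; apply/orP; right.
have /k : md (mk x' y' - mk x y) < r.
  by rewrite (le_lt_trans (mk_dist _ _ _)) //= [r]splitr ltrD.
have := mdB_le (f (mk x y)) (f (mk x' y')) p.
rewrite (mdC (f (mk x y)) (f (mk x' y'))); lra.
Qed.

Lemma closed_range phi (T : R) : 0 < T -> (forall t, vcont phi t) ->
  (forall t, phi (t + T) = phi t) -> open (~` range phi).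
Proof.
move=> T0 pc pT; apply/copenP => p np.
have [|r r0 h] := @ccont_far (fun z => phi (re z)) p 0 T 0 0.
  move=> x y _ _; split; last by apply/eqP => E; apply: np; exists x.
  move=> e e0; have [r r0 k] := pc x e e0; exists r => // w wr; apply: k.
  by rewrite (le_lt_trans _ wr) // (le_trans _ (re_le _)) // !(reD, reN).
have {}h : forall t, r <= md (phi t - p).
  apply: (periodic_ind T0) => [t|t|t t0]; first by rewrite pT.
    by rewrite -{1}(subrK T t) pT.
  by apply: (h t 0); rewrite ?lexx.
by exists r => // q qp [t _ E]; have := h t; rewrite E leNgt qp.
Qed.

Lemma bounded_range phi (T : R) : 0 < T -> (forall t, vcont phi t) ->
  (forall t, phi (t + T) = phi t) -> bounded_set (range phi).
Proof.
move=> T0 pc pT.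
have [|M h] := @ccont_bounded (fun z => phi (re z)) 0 T 0 0.
  move=> x y _ _ e e0; have [r r0 k] := pc x e e0; exists r => // w wr; apply: k.
  by rewrite (le_lt_trans _ wr) // (le_trans _ (re_le _)) // !(reD, reN).
apply/cboundedP; exists M => _ [t _ <-].
suff : forall t, md (phi t) <= M by [].
apply: (periodic_ind T0) => [u|u|u u0]; first by rewrite pT.
  by rewrite -{1}(subrK T u) pT.
by apply: (h u 0); rewrite ?lexx.
Qed.

End Curves.

(** * Cauchy's theorem for rectangles *)

Section Goursat.
Variable R : realType.
Local Notation C := (cplane R).
Local Notation re z := (complex.Re (z : R[i])).
Local Notation im z := (complex.Im (z : R[i])).
Implicit Types (z w c p q : C).

Definition box p (r : R) z := `|re z - re p| < r /\ `|im z - im p| < r.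
Definition cbox p (r : R) z := `|re z - re p| <= r /\ `|im z - im p| <= r.

(** A primitive of [w |-> c + d * (w - q)]: its increments along the sides of a
    rectangle add up to zero. *)
Definition quad c d q w : C := c * w + d / 2 * (w - q) ^+ 2.

Section Rectangles.
Variables (f : C -> C) (p : C) (r : R).
Hypothesis fd : forall z, cbox p r z -> exists d, cdiff f z d.
(* antiderivatives of [f] along horizontal segments and of [i f] along vertical ones *)
Variables X Y : R -> R -> C.
Hypothesis XP : forall x y, box p r (mk x y) ->
  vder (X y) x (f (mk x y)).
Hypothesis YP : forall x y, box p r (mk x y) ->
  vder (Y x) y (ci R * f (mk x y)).

(** The integral of [f] along the boundary of a rectangle, in terms of the
    antiderivatives on its sides, which makes the additivity under subdivision an
    identity. *)
Definition loop x x' y y' : C :=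
  (X y x' - X y x) + (Y x' y' - Y x' y) -
  (X y' x' - X y' x) - (Y x y' - Y x y).

Lemma horizontal_error c d q x x' y (L e : R) :
  (forall s, Num.min x x' <= s <= Num.max x x' -> box p r (mk s y) /\
    md (f (mk s y) - (c + d * (mk s y - q))) <= e) ->
  `|x' - x| <= L ->
  md (X y x' - X y x - (quad c d q (mk x' y) - quad c d q (mk x y))) <= 2 * e * L.
Proof.
move=> h xL; set P := quad c d q.
have e0 : 0 <= e.
  by apply: (le_trans (md_ge0 _) (h x _).2); rewrite ge_min le_max lexx.
pose phi s := X y s + -1 * P (mk s y).
have := @curve_MVT R phi (fun s => f (mk s y) + -1 * ((c + d * (mk s y - q)) * 1)) x x' e 0.
have -> : phi x' - phi x - rc (x' - x) * 0 =
    X y x' - X y x - (P (mk x' y) - P (mk x y)) by rewrite /phi; ring.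
move=> k; apply: (le_trans (k _ _)).
- move=> u /h[ub _]; apply: vder_add; first exact: XP.
  apply: vder_mul; apply: (@cdiff_vder R P (fun s => mk s y)).
    exact: cdiff_quad.
  have := @vder_line R (ci R * rc y) 1 u.
  by apply: (@vder_ext R _ _ _ _ 1) => // s _; rewrite mulr1 addrC -mk_rc.
- by move=> u /h[_]; rewrite mulr1 subr0 mulN1r.
- by rewrite ler_wpM2l // mulr_ge0.
Qed.

Lemma vertical_error c d q x y y' (L e : R) :
  (forall s, Num.min y y' <= s <= Num.max y y' -> box p r (mk x s) /\
    md (f (mk x s) - (c + d * (mk x s - q))) <= e) ->
  `|y' - y| <= L ->
  md (Y x y' - Y x y - (quad c d q (mk x y') - quad c d q (mk x y))) <= 2 * e * L.
Proof.
move=> h yL; set P := quad c d q.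
have e0 : 0 <= e.
  by apply: (le_trans (md_ge0 _) (h y _).2); rewrite ge_min le_max lexx.
pose phi s := Y x s + -1 * P (mk x s).
have := @curve_MVT R phi (fun s => ci R * f (mk x s) +
  -1 * ((c + d * (mk x s - q)) * ci R)) y y' e 0.
have -> : phi y' - phi y - rc (y' - y) * 0 =
    Y x y' - Y x y - (P (mk x y') - P (mk x y)) by rewrite /phi; ring.
move=> k; apply: (le_trans (k _ _)).
- move=> u /h[ub _]; apply: vder_add; first exact: YP.
  apply: vder_mul; apply: (@cdiff_vder R P (fun s => mk x s)).
    exact: cdiff_quad.
  have := @vder_line R (rc x) (ci R) u.
  by apply: (@vder_ext R _ _ _ _ 1) => // s _; rewrite [rc s * _]mulrC -mk_rc.
- move=> u /h[_]; apply: le_trans.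
  rewrite [X in md X](_ : _ = ci R * (f (mk x u) - (c + d * (mk x u - q)))); last by ring.
  by rewrite mdM md_ci mul1r.
- by rewrite ler_wpM2l // mulr_ge0.
Qed.

Lemma box_mk x x' y y' s t :
  box p r (mk x y) -> box p r (mk x' y') ->
  x <= s <= x' -> y <= t <= y' -> box p r (mk s t).
Proof.
move=> [/= h1 h2] [/= h3 h4] /andP[k1 k2] /andP[k3 k4].
move: h1 h2 h3 h4; rewrite !ltr_norml => /andP[h1 g1] /andP[h2 g2] /andP[h3 g3] /andP[h4 g4].
by split => /=; rewrite ltr_norml; apply/andP; split; lra.
Qed.

(** [f] differs from its first order expansion at [q] by [o(|z - q|)], and the
    expansion has a primitive, so it does not contribute. *)
Lemma loop_small q (e : R) : box p r q -> 0 < e ->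
  exists2 rho : R, 0 < rho & forall x x' y y',
    x <= re q <= x' -> y <= im q <= y' ->
    box p r (mk x y) -> box p r (mk x' y') -> (x' - x) + (y' - y) < rho ->
    md (loop x x' y y') <= 8 * e * ((x' - x) + (y' - y)) ^+ 2.
Proof.
move=> bq e0.
have [|d fdq] := fd (z := q); first by case: bq => ? ?; split; exact: ltW.
have [rho rho0 h] := fdq e e0; exists rho => // x x' y y' /andP[xq qx] /andP[yq qy] b1 b2.
set L := (x' - x) + (y' - y) => Lr.
have xx : x <= x' by exact: le_trans qx.
have yy : y <= y' by exact: le_trans qy.
have dist s t : x <= s <= x' -> y <= t <= y' -> md (mk s t - q) <= L.
  move=> /andP[? ?] /andP[? ?]; rewrite (le_trans (mk_dist _ _ _)) // /L lerD // ler_norml;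
    by apply/andP; split; lra.
have est s t : x <= s <= x' -> y <= t <= y' -> box p r (mk s t) /\
    md (f (mk s t) - (f q + d * (mk s t - q))) <= e * L.
  move=> hs ht; split; first exact: box_mk b1 b2 hs ht.
  rewrite opprD addrA (le_trans (h _ _)) //; first by rewrite (le_lt_trans (dist _ _ hs ht)).
  by rewrite ler_wpM2l ?(ltW e0) // dist.
have xL : `|x' - x| <= L by rewrite ger0_norm ?subr_ge0 // lerDl subr_ge0.
have yL : `|y' - y| <= L by rewrite ger0_norm ?subr_ge0 // lerDr subr_ge0.
have H1 := @horizontal_error (f q) d q x x' y L (e * L).
have H2 := @horizontal_error (f q) d q x x' y' L (e * L).
have V1 := @vertical_error (f q) d q x y y' L (e * L).
have V2 := @vertical_error (f q) d q x' y y' L (e * L).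
move: H1 H2 V1 V2; rewrite !(min_idPl xx) !(max_idPr xx) !(min_idPl yy) !(max_idPr yy) /=.
move=> /(_ _ xL) H1 /(_ _ xL) H2 /(_ _ yL) V1 /(_ _ yL) V2.
have {}H1 := H1 (fun s hs => est s y hs _).
have {}H2 := H2 (fun s hs => est s y' hs _).
have {}V1 := V1 (fun s hs => est x s _ hs).
have {}V2 := V2 (fun s hs => est x' s _ hs).
move: H1 H2 V1 V2; rewrite !lexx xx yy => /(_ isT) H1 /(_ isT) H2 /(_ isT) V1 /(_ isT) V2.
set P := quad (f q) d q.
have -> : loop x x' y y' =
  (X y x' - X y x - (P (mk x' y) - P (mk x y))) +
  (Y x' y' - Y x' y - (P (mk x' y') - P (mk x' y))) -
  (X y' x' - X y' x - (P (mk x' y') - P (mk x y'))) -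
  (Y x y' - Y x y - (P (mk x y') - P (mk x y))) by rewrite /loop; ring.
rewrite (le_trans (mdD _ _)) // mdN.
rewrite (le_trans (lerD (mdD _ _) (lexx _))) // mdN.
rewrite (le_trans (lerD (lerD (mdD _ _) (lexx _)) (lexx _))) //.
rewrite (le_trans (lerD (lerD (lerD H1 V2) H2) V1)) //.
by rewrite le_eqVlt; apply/orP; left; apply/eqP; ring.
Qed.

(** Indexing a rectangle by its lower left corner and its sides makes the sides of
    iterated quarters explicit. *)
Definition rloop (Q : R * R * R * R) : C :=
  let: (x, y, a, b) := Q in loop x (x + a) y (y + b).

(** The integral along a rectangle is the sum of those along its four quarters,
    so one of them carries at least a quarter of it. *)
Lemma loop_quarter (Q : R * R * R * R) : exists Q' : R * R * R * R,
  let: (x, y, a, b) := Q in let: (x', y', a', b') := Q' in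
  [/\ a' = a / 2, b' = b / 2, x' = x \/ x' = x + a / 2,
      y' = y \/ y' = y + b / 2 & md (rloop Q) <= 4 * md (rloop Q')].
Proof.
case: Q => [[[x y] a] b]; apply: contrapT => /forallNP h.
set Q := (x, y, a, b).
have h' (x' y' : R) : x' = x \/ x' = x + a / 2 -> y' = y \/ y' = y + b / 2 ->
    4 * md (rloop (x', y', a / 2, b / 2)) < md (rloop Q).
  move=> hx hy; rewrite ltNge; apply/negP => le.
  by apply: (h (x', y', a / 2, b / 2)); split.
have k1 := h' x y (or_introl erefl) (or_introl erefl).
have k2 := h' x (y + b / 2) (or_introl erefl) (or_intror erefl).
have k3 := h' (x + a / 2) y (or_intror erefl) (or_introl erefl).
have k4 := h' (x + a / 2) (y + b / 2) (or_intror erefl) (or_intror erefl).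
have E : rloop Q = rloop (x, y, a / 2, b / 2) + rloop (x, y + b / 2, a / 2, b / 2)
   + rloop (x + a / 2, y, a / 2, b / 2) + rloop (x + a / 2, y + b / 2, a / 2, b / 2).
  by rewrite /rloop /Q /loop -!addrA -!splitr !addrA; ring.
have : md (rloop Q) <= md (rloop (x, y, a / 2, b / 2)) + md (rloop (x, y + b / 2, a / 2, b / 2))
   + md (rloop (x + a / 2, y, a / 2, b / 2)) + md (rloop (x + a / 2, y + b / 2, a / 2, b / 2)).
  rewrite E (le_trans (mdD _ _)) // lerD2r (le_trans (mdD _ _)) // lerD2r.
  exact: mdD.
by lra.
Qed.

(** Goursat's argument: bisection selects nested rectangles whose integrals decay
    at most like [4 ^- n], and [loop_small] at their common point shows that they
    decay faster. *)
Lemma loop_eq0 x x' y y' : x <= x' -> y <= y' ->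
  box p r (mk x y) -> box p r (mk x' y') -> loop x x' y y' = 0.
Proof.
move=> xx yy bl bh.
have [next nextP] := choice loop_quarter.
pose a := x' - x; pose b := y' - y.
pose Q n := iter n next (x, y, a, b).
pose xn n := (Q n).1.1.1; pose yn n := (Q n).1.1.2.
have a0 : 0 <= a by rewrite subr_ge0.
have b0 : 0 <= b by rewrite subr_ge0.
have QE n : Q n = (xn n, yn n, a / 2 ^+ n, b / 2 ^+ n).
  rewrite /xn /yn; elim: n => [|n IH]; first by rewrite !expr0 !divr1.
  have := nextP (Q n); rewrite -[next (Q n)]/(Q n.+1).
  rewrite IH; case: (Q n.+1) => [[[u v] s] t] /= [-> -> _ _ _].
  by rewrite exprSr !invfM !mulrA.
have step n : [/\ xn n <= xn n.+1, xn n.+1 + a / 2 ^+ n.+1 <= xn n + a / 2 ^+ n,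
    yn n <= yn n.+1 & yn n.+1 + b / 2 ^+ n.+1 <= yn n + b / 2 ^+ n] /\
    md (rloop (Q n)) <= 4 * md (rloop (Q n.+1)).
  have := nextP (Q n); rewrite -[next (Q n)]/(Q n.+1) (QE n) (QE n.+1).
  have ha : 0 <= a / 2 ^+ n by rewrite divr_ge0.
  have hb : 0 <= b / 2 ^+ n by rewrite divr_ge0.
  by move=> [-> -> [->|->] [->|->] ->]; split => //; split; lra.
have xmono m n : (m <= n)%N -> xn m <= xn n /\ xn n + a / 2 ^+ n <= xn m + a / 2 ^+ m.
  elim: n => [|n IH]; first by rewrite leqn0 => /eqP->.
  rewrite leq_eqVlt => /orP[/eqP->//|/IH[h1 h2]]; have [[h3 h4 _ _] _] := step n.
  by split; [exact: le_trans h3|exact: le_trans h2].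
have ymono m n : (m <= n)%N -> yn m <= yn n /\ yn n + b / 2 ^+ n <= yn m + b / 2 ^+ m.
  elim: n => [|n IH]; first by rewrite leqn0 => /eqP->.
  rewrite leq_eqVlt => /orP[/eqP->//|/IH[h1 h2]]; have [[_ _ h3 h4] _] := step n.
  by split; [exact: le_trans h3|exact: le_trans h2].
have ha n : 0 <= a / 2 ^+ n by rewrite divr_ge0.
have hb n : 0 <= b / 2 ^+ n by rewrite divr_ge0.
have xub m : ubound (range xn) (xn m + a / 2 ^+ m).
  move=> _ [n _ <-]; case: (leqP n m) => [/xmono[h _]|/ltnW/xmono[_ h]].
    by rewrite (le_trans h) // lerDl.
  by rewrite (le_trans _ h) // lerDl.
have yub m : ubound (range yn) (yn m + b / 2 ^+ m).
  move=> _ [n _ <-]; case: (leqP n m) => [/ymono[h _]|/ltnW/ymono[_ h]].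
    by rewrite (le_trans h) // lerDl.
  by rewrite (le_trans _ h) // lerDl.
pose q := mk (sup (range xn)) (sup (range yn)).
have qx n : xn n <= re q <= xn n + a / 2 ^+ n.
  apply/andP; split; first by apply: ub_le_sup; [exists (xn 0%N + a / 2 ^+ 0)|exists n].
  by apply: ge_sup; [exists (xn 0%N), 0%N|exact: xub].
have qy n : yn n <= im q <= yn n + b / 2 ^+ n.
  apply/andP; split; first by apply: ub_le_sup; [exists (yn 0%N + b / 2 ^+ 0)|exists n].
  by apply: ge_sup; [exists (yn 0%N), 0%N|exact: yub].
have lx n : xn n + a / 2 ^+ n <= x'.
  by have [_] := xmono 0%N n isT; rewrite expr0 divr1 {2}/xn /= {2}/a [x + _]addrC subrK.
have ly n : yn n + b / 2 ^+ n <= y'.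
  by have [_] := ymono 0%N n isT; rewrite expr0 divr1 {2}/yn /= {2}/b [y + _]addrC subrK.
have gx n : x <= xn n by have [] := xmono 0%N n isT.
have gy n : y <= yn n by have [] := ymono 0%N n isT.
have inb s t : x <= s <= x' -> y <= t <= y' -> box p r (mk s t) by exact: box_mk.
have bq : box p r q.
  apply: inb; apply/andP; split.
  - by have /andP[h _] := qx 0%N; exact: le_trans h.
  - by have /andP[_ h] := qx 0%N; exact: le_trans h _.
  - by have /andP[h _] := qy 0%N; exact: le_trans h.
  - by have /andP[_ h] := qy 0%N; exact: le_trans h _.
have grow n : md (loop x x' y y') <= 4 ^+ n * md (rloop (Q n)).
  elim: n => [|n IH].
    have -> : md (rloop (Q 0%N)) = md (loop x x' y y'); last by rewrite expr0 mul1r.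
    rewrite -[Q 0%N]/(x, y, a, b) /rloop.
    have -> : x + a = x' by rewrite /a addrC subrK.
    by have -> : y + b = y' by rewrite /b addrC subrK.
  apply: (le_trans IH); rewrite exprSr -mulrA ler_wpM2l ?exprn_ge0 //.
  by have [] := step n.
(* at scale 2 ^- n the integral is at most e * (size) ^+ 2, and grow multiplies it
   by 4 ^+ n only, so the scale cancels *)
have bound (e : R) : 0 < e -> md (loop x x' y y') <= 8 * (a + b) ^+ 2 * e.
  move=> e0; have [rho rho0 h] := loop_small bq e0.
  have [n nP] := half_pow_lt (a + b) rho0.
  rewrite (le_trans (grow n)) // (QE n).
  have := h (xn n) (xn n + a / 2 ^+ n) (yn n) (yn n + b / 2 ^+ n) (qx n) (qy n).
  have -> : xn n + a / 2 ^+ n - xn n + (yn n + b / 2 ^+ n - yn n) = (a + b) / 2 ^+ n by ring.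
  move=> /(_ _ _ nP) k.
  have {}k := k (inb _ _ _ _) (inb _ _ _ _).
  rewrite (le_trans (ler_wpM2l _ (k _ _ _ _))) ?exprn_ge0 //.
  - rewrite gx; have /andP[_ h1] := qx n; by rewrite (le_trans _ (lx n)) // lerDl.
  - rewrite gy; by rewrite (le_trans _ (ly n)) // lerDl.
  - by rewrite lx (le_trans (gx n)) // lerDl.
  - by rewrite ly (le_trans (gy n)) // lerDl.
  rewrite le_eqVlt; apply/orP; left; apply/eqP.
  have -> : (4 : R) ^+ n = 2 ^+ n * 2 ^+ n by rewrite -exprMn -natrM.
  by field; rewrite expf_neq0.
apply/eqP; rewrite -md_eq0 eq_le md_ge0 andbT.
apply/ler_addgt0Pr => e e0; rewrite add0r.
pose K := 8 * (a + b) ^+ 2.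
have K0 : 0 <= K by rewrite mulr_ge0 ?sqr_ge0.
have [k0|k0] := ltrP 0 K; last first.
  by apply: (le_trans (bound 1 ltr01)); rewrite mulr1 (le_trans k0) ?ltW.
apply: (le_trans (bound (e / K) _)); first exact: divr_gt0.
by rewrite -/K mulrC mulfVK // gt_eqF.
Qed.

End Rectangles.

End Goursat.

(** * Primitives and the local complex-time flow *)

Section FlowBox.
Variable R : realType.
Local Notation C := (cplane R).
Local Notation re z := (complex.Re (z : R[i])).
Local Notation im z := (complex.Im (z : R[i])).
Implicit Types (z w c p q : C) (f F : C -> C).

Lemma loop_eq0_oriented f p (r : R) (X Y : R -> R -> C) :
  (forall z, cbox p r z -> exists d, cdiff f z d) ->
  (forall x y, box p r (mk x y) -> vder (X y) x (f (mk x y))) ->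
  (forall x y, box p r (mk x y) -> vder (Y x) y (ci R * f (mk x y))) ->
  forall x x' y y', box p r (mk x y) -> box p r (mk x' y') ->
  loop X Y x x' y y' = 0.
Proof.
move=> fd hX hY x x' y y' [/= h1 h2] [/= h3 h4].
have H := @loop_eq0 R f p r fd X Y hX hY.
have [xx|xx] := leP x x'; have [yy|yy] := leP y y'.
- by apply: H.
- have := H x x' y' y xx (ltW yy) (conj h1 h4) (conj h3 h2).
  by move/(congr1 (fun z => - z)); rewrite oppr0 => <-; rewrite /loop; ring.
- have := H x' x y y' (ltW xx) yy (conj h3 h2) (conj h1 h4).
  by move/(congr1 (fun z => - z)); rewrite oppr0 => <-; rewrite /loop; ring.
- have := H x' x y' y (ltW xx) (ltW yy) (conj h3 h4) (conj h1 h2).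
  by move=> <-; rewrite /loop; ring.
Qed.

(** The primitive is the integral along a horizontal and then a vertical segment.
    By [loop_eq0] its increment between two points is the integral along the two
    segments that join them, so bounds on [f - c] pass to it. *)
Lemma primitive_box f p (r : R) : 0 < r ->
  (forall z, cbox p r z -> exists d, cdiff f z d) ->
  exists G : C -> C, forall z w, box p r z -> box p r w -> forall c (e : R),
    (forall u, `|re u - re z| <= `|re w - re z| ->
      `|im u - im z| <= `|im w - im z| -> box p r u -> md (f u - c) <= e) ->
    md (G w - G z - c * (w - z)) <= 4 * e * md (w - z).
Proof.
move=> r0 fd.
have cb x y : `|x - re p| <= r -> `|y - im p| <= r -> ccont f (mk x y).
  by move=> hx hy; have [|d /cdiff_cont] := fd (mk x y).
have near1 (x s : R) : x - r <= s <= x + r -> `|s - x| <= r.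
  by move=> /andP[? ?]; rewrite ler_norml; apply/andP; split; lra.
have near2 (x s : R) : `|s - x| < r -> x - r < s < x + r.
  by rewrite ltr_norml => /andP[? ?]; apply/andP; split; lra.
have ab (x : R) : x - r < x + r by lra.
have exX y : exists A : R -> C, `|y - im p| < r -> forall s, `|s - re p| < r ->
    vder A s (f (mk s y)).
  have [yb|nyb] := pselect (`|y - im p| < r); last by exists (fun=> 0).
  have [|A hA] := @curve_antiderivative R (fun s => f (mk s y)) _ _ (ab (re p)).
    move=> s /near1 hs e e0; have [q q0 h] := cb s y hs (ltW yb) e e0.
    exists q => // t ts; apply: h; rewrite (le_lt_trans (mk_dist _ _ _)) //=.
    by rewrite subrr normr0 addr0.
  by exists A => _ s /near2; exact: hA.
have exY x : exists A : R -> C, `|x - re p| < r -> forall s, `|s - im p| < r ->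
    vder A s (ci R * f (mk x s)).
  have [xb|nxb] := pselect (`|x - re p| < r); last by exists (fun=> 0).
  have [|A hA] := @curve_antiderivative R (fun s => f (mk x s)) _ _ (ab (im p)).
    move=> s /near1 hs e e0; have [q q0 h] := cb x s (ltW xb) hs e e0.
    exists q => // t ts; apply: h; rewrite (le_lt_trans (mk_dist _ _ _)) //=.
    by rewrite subrr normr0 add0r.
  by exists (fun s => ci R * A s) => _ s /near2 hs; apply: vder_mul; exact: hA.
have [X hX'] := choice exX; have [Y hY'] := choice exY.
have hX x y : box p r (mk x y) -> vder (X y) x (f (mk x y)).
  by move=> [/= h1 h2]; exact: hX'.
have hY x y : box p r (mk x y) -> vder (Y x) y (ci R * f (mk x y)).
  by move=> [/= h1 h2]; exact: hY'.
have L := loop_eq0_oriented fd hX hY.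
exists (fun z => X (im p) (re z) + (Y (re z) (im z) - Y (re z) (im p))).
move=> z w bz bw c e he.
set x := re z; set y := im z; set x' := re w; set y' := im w.
have bp1 : box p r (mk x (im p)) by case: bz => ? ?; split; rewrite //= subrr normr0.
have bwy : box p r (mk x' y) by case: bz; case: bw.
have L1 := L x x' (im p) y bp1 bwy.
have -> : X (im p) x' + (Y x' y' - Y x' (im p)) -
    (X (im p) x + (Y x y - Y x (im p))) - c * (w - z) =
  (X y x' - X y x - rc (x' - x) * c) + (Y x' y' - Y x' y - rc (y' - y) * (ci R * c)).
  have -> : w - z = rc (x' - x) + ci R * rc (y' - y).
    by rewrite -mk_rc; apply: cplane_ext; rewrite !(reD, imD, reN, imN).
  apply/eqP; rewrite -subr_eq0 -L1 /loop; apply/eqP; ring.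
have between (u s t : R) : Num.min s t <= u <= Num.max s t -> `|u - s| <= `|t - s|.
  have [st|ts] := leP s t => /andP[h1 h2].
    by rewrite !ger0_norm ?subr_ge0 ?lerD2r.
  rewrite distrC [`|t - s|]distrC !ger0_norm ?subr_ge0 ?(ltW ts) // lerD2l lerN2.
  exact: h1.
have bmix (u s t o : R) : `|s - o| < r -> `|t - o| < r ->
    Num.min s t <= u <= Num.max s t -> `|u - o| < r.
  rewrite !ltr_norml => /andP[? ?] /andP[? ?].
  have [st|ts] := leP s t => /andP[h1 h2]; apply/andP; split; lra.
have e0 : 0 <= e.
  by apply: (le_trans (md_ge0 _) (he z _ _ bz)); rewrite subrr normr0.
rewrite (le_trans (mdD _ _)) //.
have H1 : md (X y x' - X y x - rc (x' - x) * c) <= 2 * e * `|x' - x|.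
  apply: (@curve_MVT R _ (fun s => f (mk s y))) => u hu.
    by apply: hX; case: bz bw => ? ? [? ?]; split => //; exact: bmix hu.
  apply: he => /=; first exact: between.
    by rewrite subrr normr0.
  by case: bz bw => ? ? [? ?]; split => //; exact: bmix hu.
have H2 : md (Y x' y' - Y x' y - rc (y' - y) * (ci R * c)) <= 2 * e * `|y' - y|.
  apply: (@curve_MVT R _ (fun s => ci R * f (mk x' s))) => u hu.
    by apply: hY; case: bz bw => ? ? [? ?]; split => //; exact: bmix hu.
  rewrite -mulrBr mdM md_ci mul1r.
  apply: he => /=; first by [].
    exact: between.
  by case: bz bw => ? ? [? ?]; split => //; exact: bmix hu.
rewrite (le_trans (lerD H1 H2)) //.
have := re_le (w - z); have := im_le (w - z); rewrite !(reD, imD, reN, imN).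
rewrite -/x -/y -/x' -/y' => k1 k2.
have := ler_wpM2l e0 k1; have := ler_wpM2l e0 k2; lra.
Qed.

Definition holomorphic F := forall z, exists d, cdiff F z d.

Lemma box_md p (r : R) z : md (z - p) < r -> box p r z.
Proof.
move=> h; split; rewrite (le_lt_trans _ h) //.
  by rewrite (le_trans _ (re_le _)) // !(reD, reN).
by rewrite (le_trans _ (im_le _)) // !(imD, imN).
Qed.

Lemma box_open p (r : R) z : box p r z -> exists2 e : R, 0 < e &
  forall w, md (w - z) < e -> box p r w.
Proof.
move=> [h1 h2].
exists (Num.min (r - `|re z - re p|) (r - `|im z - im p|)).
  by rewrite lt_min !subr_gt0 h1.
move=> w; rewrite lt_min !ltrBrDr => /andP[k1 k2].
split; [rewrite (le_lt_trans _ k1) //|rewrite (le_lt_trans _ k2) //].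
  have -> : re w - re p = re (w - z) + (re z - re p) by rewrite !(reD, reN) subrKA.
  by rewrite (le_trans (ler_normD _ _)) // lerD2r re_le.
have -> : im w - im p = im (w - z) + (im z - im p) by rewrite !(imD, imN) subrKA.
by rewrite (le_trans (ler_normD _ _)) // lerD2r im_le.
Qed.

(** [H] is a primitive of [F p / F].  In the coordinate [H] the field is the
    constant [F p]; as [F p / F] is close to [1] near [p], the map [H] is close to a
    translation, hence injective. *)
Lemma rectifying_coordinate F p : holomorphic F -> F p != 0 ->
  exists H : C -> C, exists2 r : R, 0 < r &
    [/\ forall z, box p r z -> F z != 0,
        forall z, box p r z -> cdiff H z (F p / F z) &
        forall z w, box p r z -> box p r w ->
          md (H w - H z - (w - z)) <= 2^-1 * md (w - z)].
Proof.
move=> hF Fp0.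
have m0 : 0 < md (F p) by rewrite md_gt0.
have [d /cdiff_cont Fc] := hF p.
(* |F z - F p| < |F p| / 9 gives |F p / F z - 1| <= 1 / 8, which [primitive_box]
   turns into the constant 1 / 2 *)
have [|r1 r10 h1] := Fc (md (F p) / 9); first by rewrite divr_gt0.
pose r := r1 / 4; have r0 : 0 < r by rewrite divr_gt0.
have cbz z : cbox p r z -> md (F z - F p) < md (F p) / 9.
  move=> [k1 k2]; apply: h1; rewrite (le_lt_trans (md_le _)) //.
  rewrite !(reD, imD, reN, imN) (le_lt_trans (lerD k1 k2)) // /r; lra.
have Fz z : cbox p r z -> 8 / 9 * md (F p) < md (F z).
  move=> /cbz h; have := mdB_le (F p) (F z) 0; rewrite !subr0 mdC.
  move: h; lra.
have Fz0 z : cbox p r z -> F z != 0.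
  by move=> /Fz h; rewrite -md_gt0 (lt_trans _ h) // mulr_gt0.
have bc z : box p r z -> cbox p r z by case=> ? ?; split; exact: ltW.
have [|G hG] := @primitive_box (fun z => F p * (F z)^-1) p r r0.
  move=> z /Fz0 z0; have [d' hd'] := hF z.
  by exists (F p * (- d' / F z ^+ 2)); apply: cdiff_mul; exact: cdiff_inv.
exists G, r => //; split.
- by move=> z /bc; exact: Fz0.
- move=> z bz e e0; have [d' hd'] := hF z.
  have fd' : cdiff (fun z => F p * (F z)^-1) z (F p * (- d' / F z ^+ 2)).
    by apply: cdiff_mul; apply: cdiff_inv => //; apply/Fz0/bc.
  have [|r2 r20 h2] := cdiff_cont fd' (e := e / 4); first by rewrite divr_gt0.
  have [r3 r30 h3] := box_open bz.
  exists (Num.min (r2 / 2) r3); first by rewrite lt_min divr_gt0.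
  move=> w; rewrite lt_min => /andP[wr2 /h3 bw].
  have -> : e = 4 * (e / 4) by field.
  apply: hG => // u hu1 hu2 _; apply/ltW/h2.
  rewrite (le_lt_trans (md_le _)) // !(reD, imD, reN, imN).
  rewrite (le_lt_trans (lerD hu1 hu2)) //.
  have := re_le (w - z); have := im_le (w - z); rewrite !(reD, imD, reN, imN).
  move: wr2; lra.
- move=> z w bz bw.
  have -> : (2^-1 : R) = 4 * (1 / 8) by field.
  rewrite -[w - z in X in md X <= _]mul1r.
  apply: hG => // u _ _ /bc bu.
  have u0 := Fz0 u bu.
  have -> : F p * (F u)^-1 - 1 = - (F u - F p) / F u by field.
  rewrite mdM mdN mdV ler_pdivrMr ?md_gt0 //.
  have := cbz u bu; have := Fz u bu; lra.
Qed.

(** The iteration [u |-> u - (H u - w)] at least halves the error [H u - w]. *)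
Lemma near_identity_onto (H : C -> C) p (r : R) :
  (forall z w, box p r z -> box p r w ->
     md (H w - H z - (w - z)) <= 2^-1 * md (w - z)) ->
  forall z0 w, box p (r / 2) z0 -> md (w - H z0) < r / 8 ->
  exists2 z, box p r z & H z = w.
Proof.
move=> hH z0 w [b1 b2] hw.
set c := md (w - H z0) in hw.
have c0 : 0 <= c := md_ge0 _.
pose z n := iter n (fun u => u - (H u - w)) z0.
have zS n : z n.+1 = z n - (H (z n) - w) by [].
have near0 u : md (u - z0) <= r / 2 -> box p r u.
  move=> h; have h1 := re_le (u - z0); have h2 := im_le (u - z0).
  move: h1 h2; rewrite !(reD, imD, reN, imN) => h1 h2.
  split.
    have -> : re u - re p = (re u - re z0) + (re z0 - re p) by ring.
    by rewrite (le_lt_trans (ler_normD _ _)) //; lra.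
  have -> : im u - im p = (im u - im z0) + (im z0 - im p) by ring.
  by rewrite (le_lt_trans (ler_normD _ _)) //; lra.
have P n : md (H (z n) - w) <= c / 2 ^+ n /\ md (z n - z0) <= 2 * c - 2 * c / 2 ^+ n.
  elim: n => [|n [IH1 IH2]].
    by rewrite expr0 !divr1 /= !subrr md0 mdC.
  have cn0 : 0 <= c / 2 ^+ n by rewrite divr_ge0.
  have E : 2 * c / 2 ^+ n.+1 = c / 2 ^+ n by rewrite exprS; field; rewrite expf_neq0.
  have E2 : 2 * c / 2 ^+ n = 2 * (c / 2 ^+ n) by rewrite mulrA.
  have d : md (z n.+1 - z n) <= c / 2 ^+ n.
    by rewrite zS [X in md X](_ : _ = - (H (z n) - w)) ?mdN //; ring.
  have dz : md (z n.+1 - z0) <= 2 * c - 2 * c / 2 ^+ n.+1.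
    have := mdB_le (z n.+1) (z n) z0; rewrite E; lra.
  split => //.
  have := hH (z n) (z n.+1) _ _; rewrite {2}zS.
  rewrite [X in md X <= _](_ : _ = H (z n.+1) - w); last by rewrite zS; ring.
  move=> k; rewrite (le_trans (k _ _)) //.
  - by apply: near0; lra.
  - by apply: near0; rewrite (le_trans dz) // E; lra.
  by rewrite -[c / 2 ^+ n.+1](_ : 2^-1 * (c / 2 ^+ n) = _) ?ler_wpM2l // -E exprS; field; rewrite expf_neq0.
have dz n : md (z n.+1 - z n) <= c / 2 ^+ n.
  by rewrite zS [X in md X](_ : _ = - (H (z n) - w)) ?mdN; [case: (P n)|ring].
have [|l1 hl1] := @geometric_limit R (fun n => re (z n)) c.
  by move=> n; rewrite (le_trans _ (dz n)) // (le_trans _ (re_le _)) // !(reD, reN).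
have [|l2 hl2] := @geometric_limit R (fun n => im (z n)) c.
  by move=> n; rewrite (le_trans _ (dz n)) // (le_trans _ (im_le _)) // !(imD, imN).
pose l := mk l1 l2.
have hl n : md (l - z n) <= 4 * c / 2 ^+ n.
  rewrite (le_trans (md_le _)) // !(reD, reN, imD, imN) (le_trans (lerD (hl1 n) (hl2 n))) //.
  by rewrite le_eqVlt; apply/orP; left; apply/eqP; ring.
have bl : box p r l.
  by apply: near0; have := hl 0%N; rewrite expr0 divr1 /=; lra.
exists l => //; apply/eqP; rewrite -subr_eq0 -md_eq0 eq_le md_ge0 andbT.
apply/ler_addgt0Pr => e e0; rewrite add0r.
have [n hn] := @half_pow_lt R (7 * c) e e0.
have [P1 P2] := P n.
have cn0 : 0 <= c / 2 ^+ n by rewrite divr_ge0.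
have bn : box p r (z n).
  by apply: near0; move: P2; rewrite -[2 * c / _]mulrA; lra.
have k := hH (z n) l bn bl.
have : md (H l - w) <= md (H l - H (z n) - (l - z n)) + md (l - z n) + md (H (z n) - w).
  rewrite [X in md X <= _](_ : _ = (H l - H (z n) - (l - z n)) + (l - z n) + (H (z n) - w)); last by ring.
  by rewrite (le_trans (mdD _ _)) // lerD2r mdD.
move: hn (hl n); rewrite -[4 * c / _]mulrA -[7 * c / _]mulrA; lra.
Qed.

(** In the rectifying coordinate the flow is the translation [H |-> H + F p * t],
    which makes sense for complex [t] and joins any two points near [p]. *)
Lemma local_flow F p : holomorphic F -> F p != 0 ->
  exists Phi : C -> C -> C, exists2 rho : R, 0 < rho & exists2 delta : R, 0 < delta &
  exists2 K : R, 0 < K &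
  [/\ forall q, md (q - p) < rho -> Phi q 0 = q,
      forall q t, md (q - p) < rho -> md t < delta ->
        cdiff (Phi q) t (F (Phi q t)) &
      forall q q', md (q - p) < rho -> md (q' - p) < rho ->
        exists2 t, md t <= K * md (q' - q) & md t < delta -> Phi q t = q'].
Proof.
move=> hF Fp0; have [H [r r0 [Fz Hd Hid]]] := rectifying_coordinate hF Fp0.
have m0 : 0 < md (F p) by rewrite md_gt0.
have onto := near_identity_onto Hid.
have expand z w : box p r z -> box p r w -> md (w - z) <= 2 * md (H w - H z).
  move=> bz bw; have := Hid z w bz bw.
  have : md (w - z) <= md (H w - H z) + md (H w - H z - (w - z)).
    rewrite [X in md X <= _](_ : _ = (H w - H z) - (H w - H z - (w - z))); last by ring.
    by rewrite (le_trans (mdD _ _)) // mdN.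
  lra.
have inj z w : box p r z -> box p r w -> H z = H w -> z = w.
  move=> bz bw e; have := expand z w bz bw; rewrite e subrr md0 mulr0 => h.
  by apply/eqP; rewrite eq_sym -subr_eq0 -md_eq0 eq_le h md_ge0.
pose delta := r / 8 / md (F p).
have d0 : 0 < delta by rewrite !divr_gt0.
have ex q t : exists z, md (q - p) < r / 2 -> md t < delta ->
    box p r z /\ H z = H q + F p * t.
  have [qp|] := pselect (md (q - p) < r / 2); last by exists 0.
  have [td|] := pselect (md t < delta); last by exists 0.
  have [|z bz e] := onto q (H q + F p * t) (box_md qp).
    rewrite [X in md X](_ : _ = F p * t); last by ring.
    by rewrite mdM mulrC -ltr_pdivlMr.
  by exists z.
have ex2 q : exists f : C -> C, forall t, md (q - p) < r / 2 -> md t < delta ->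
    box p r (f t) /\ H (f t) = H q + F p * t.
  by have [f hf] := choice (ex q); exists f.
have [Phi hPhi] := choice ex2.
have half z : md (z - p) < r / 2 -> box p r z.
  by move=> h; apply: box_md; rewrite (lt_trans h) // ltr_pdivrMr // mulr_natr mulr2n ltrDl.
exists Phi, (r / 2); first by rewrite divr_gt0.
exists delta => //; exists (3 / 2 / md (F p)); first by rewrite !divr_gt0.
split.
- move=> q qp; have [|b e] := hPhi q 0 qp; first by rewrite md0.
  by apply: inj => //; [exact: half|rewrite e mulr0 addr0].
- move=> q t qp td e e0; have [bz ez] := hPhi q t qp td.
  set z := Phi q t in bz ez *.
  have z0 := Fz z bz.
  have mz : 0 < md (F z) by rewrite md_gt0.
  pose e' := e / (2 * md (F z)).
  have [|r1 r10 h1] := Hd z bz e'; first by rewrite divr_gt0 ?mulr_gt0.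
  pose r2 := r1 / (2 * md (F p)).
  exists (Num.min r2 (delta - md t)); first by rewrite lt_min subr_gt0 td divr_gt0 ?mulr_gt0.
  move=> s; rewrite lt_min => /andP[sr2 sd].
  have sd' : md s < delta.
    by have := mdB_le s t 0; rewrite !subr0; move: sd; lra.
  have [bs es] := hPhi q s qp sd'.
  set y := Phi q s in bs es *.
  have yz : md (y - z) <= 2 * md (F p) * md (s - t).
    rewrite (le_trans (expand _ _ bz bs)) // es ez -mulrA -mdM.
    by rewrite [X in 2 * md X <= _](_ : _ = F p * (s - t)) //; ring.
  have /h1 k : md (y - z) < r1.
    by rewrite (le_lt_trans yz) // mulrC -ltr_pdivlMr ?mulr_gt0.
  have -> : y - z - F z * (s - t) = - (F z / F p) * (H y - H z - F p / F z * (y - z)).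
    by rewrite es ez; field; rewrite z0 Fp0.
  rewrite mdM mdN mdM mdV.
  have fp : 0 <= md (F z) / md (F p) by rewrite divr_ge0 ?md_ge0.
  rewrite (le_trans (ler_wpM2l fp k)) //.
  have e'0 : 0 <= e' by rewrite ltW // divr_gt0 ?mulr_gt0.
  rewrite (le_trans (ler_wpM2l fp (ler_wpM2l e'0 yz))) //.
  rewrite le_eqVlt; apply/orP; left; apply/eqP; rewrite /e'.
  by field; rewrite !gt_eqF.
- move=> q q' /[dup] qp /half bq /half bq'.
  exists ((H q' - H q) / F p).
    rewrite mdM mdV ler_pdivrMr // [X in _ <= X](_ : _ = 3 / 2 * md (q' - q)); last first.
      by field; rewrite gt_eqF.
    have := Hid q q' bq bq'.
    have : md (H q' - H q) <= md (H q' - H q - (q' - q)) + md (q' - q).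
      by rewrite -{1}[H q' - H q](subrK (q' - q)) mdD.
    lra.
  move=> td; have [b e] := hPhi q _ qp td.
  by apply: inj => //; rewrite e; field.
Qed.

End FlowBox.

(** * Uniqueness of solutions in real and complex time *)

Section Uniqueness.
Variable R : realType.
Local Notation C := (cplane R).
Local Notation re z := (complex.Re (z : R[i])).
Local Notation im z := (complex.Im (z : R[i])).
Implicit Types (z w c p q : C) (F : C -> C) (phi psi : R -> C).

Lemma cauchy_schwarz z w : `|re z * re w + im z * im w| <= md z * md w.
Proof.
have -> : md z = md (mk (re z) (- im z)) by rewrite /md /= sqrrN.
rewrite -mdM (le_trans _ (re_le _)) // reM /= mulNr opprK.
exact: lexx.
Qed.

(** [md (phi u - b) ^+ 2] has derivative at most [2 L] times itself, so Gronwall's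
    lemma applies in both time directions. *)
Lemma exponential_growth phi (v : R -> C) b (L s t : R) : s <= t ->
  (forall u, s <= u <= t -> vder phi u (v u)) ->
  (forall u, s <= u <= t -> md (v u) <= L * md (phi u - b)) ->
  md (phi t - b) ^+ 2 <= expR (2 * L * (t - s)) * md (phi s - b) ^+ 2 /\
  md (phi s - b) ^+ 2 <= expR (2 * L * (t - s)) * md (phi t - b) ^+ 2.
Proof.
move=> st hd hv.
apply: (@gronwall R (fun u => md (phi u - b) ^+ 2)
  (fun u => 2 * (re (phi u - b) * re (v u) + im (phi u - b) * im (v u))) s t (2 * L)) => //.
  move=> u /hd /vder_rdiff[h1 h2].
  have E : (fun u => md (phi u - b) ^+ 2) = (fun u =>
      (re (phi u) - re b) * (re (phi u) - re b) + (im (phi u) - im b) * (im (phi u) - im b)).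
    by apply/funext => w; rewrite sqr_md !(reD, imD, reN, imN) !expr2.
  rewrite E.
  have k1 := rdiff_subC (re b) h1; have k2 := rdiff_subC (im b) h2.
  have := rdiffD (rdiffM k1 k1) (rdiffM k2 k2).
  by congr (rdiff _ _ _); rewrite !(reD, imD, reN, imN); ring.
move=> u uab; rewrite normrM ger0_norm //.
have := cauchy_schwarz (phi u - b) (v u); have := hv u uab.
have := md_ge0 (phi u - b); set m := md (phi u - b) => m0 h k.
have := ler_wpM2l m0 h; lra.
Qed.

Definition sol F phi t := vder phi t (F (phi t)).

Lemma vder_opp phi t v : vder phi (- t) v -> vder (fun s => phi (- s)) t (- v).
Proof.
move=> h e /h[r r0 k]; exists r => // s st.
have E : - s - - t = - (s - t) by ring.
have := k (- s); rewrite E normrN => /(_ st).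
by rewrite rcN mulNr mulrN.
Qed.

Lemma holomorphic_mul c F : holomorphic F -> holomorphic (fun z => c * F z).
Proof. by move=> h z; have [d hd] := h z; exists (c * d); exact: cdiff_mul. Qed.

Lemma sol_opp F phi t : sol F phi (- t) -> sol (fun z => -1 * F z) (fun s => phi (- s)) t.
Proof. by rewrite /sol mulN1r; exact: vder_opp. Qed.

Lemma sol_coordinate F p (H : C -> C) phi (e u : R) :
  (forall s, Num.min e u <= s <= Num.max e u -> [/\ F (phi s) != 0,
     sol F phi s & cdiff H (phi s) (F p / F (phi s))]) ->
  H (phi u) = H (phi e) + rc (u - e) * F p.
Proof.
move=> h; apply/eqP; rewrite -subr_eq0 -md_eq0 eq_le md_ge0 andbT.
rewrite opprD addrA.
have := @curve_MVT R (fun s => H (phi s)) (fun=> F p) e u 0 (F p).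
rewrite mulr0 mul0r; apply => s /h[h1 h2 h3].
  have := cdiff_vder h3 h2; rewrite mulfVK //; exact.
by rewrite subrr md0.
Qed.

Lemma between_seg (a b e u s : R) : a <= e <= b -> a <= u <= b ->
  Num.min e u <= s <= Num.max e u -> a <= s <= b.
Proof. by move=> /andP[? ?] /andP[? ?]; case: (leP e u) => ? /andP[? ?]; apply/andP; split; lra. Qed.

Lemma between_dist (e u s r : R) : `|u - e| < r ->
  Num.min e u <= s <= Num.max e u -> `|s - e| < r.
Proof.
rewrite !ltr_norml => /andP[? ?]; case: (leP e u) => ? /andP[? ?];
  apply/andP; split; lra.
Qed.

(** Where [F] does not vanish, the rectifying coordinate of a solution is an affine
    function of time.  At a zero of [F] the field grows at most linearly, so a
    solution neither reaches nor leaves it in finite time. *)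
Lemma sol_unique_local F phi psi (a b e : R) : holomorphic F ->
  (forall t, a <= t <= b -> sol F phi t) ->
  (forall t, a <= t <= b -> sol F psi t) ->
  a <= e <= b -> phi e = psi e ->
  exists2 r : R, 0 < r & forall u, a <= u <= b -> `|u - e| < r -> phi u = psi u.
Proof.
move=> hF h1 h2 eab E.
have c1 := vder_cont (h1 e eab); have c2 := vder_cont (h2 e eab).
set p := phi e in E c1 *.
have [Fp0|Fp0] := eqVneq (F p) 0; last first.
  have [H [r r0 [Fz Hd Hid]]] := rectifying_coordinate hF Fp0.
  have [r1 r10 k1] := c1 r r0; have [r2 r20 k2] := c2 r r0; rewrite -E in k2.
  exists (Num.min r1 r2); first by rewrite lt_min r10.
  move=> u uab; rewrite lt_min => /andP[ur1 ur2].
  have b1 := box_md (k1 u ur1); have b2 := box_md (k2 u ur2).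
  have H1 : H (phi u) = H (phi e) + rc (u - e) * F p.
    apply: (@sol_coordinate F p H phi e u) => s hs.
    have bs : box p r (phi s) by apply: box_md; apply: k1; exact: between_dist ur1 hs.
    by split; [exact: Fz|apply: h1; exact: between_seg eab uab hs|exact: Hd].
  have H2 : H (psi u) = H (psi e) + rc (u - e) * F p.
    apply: (@sol_coordinate F p H psi e u) => s hs.
    have bs : box p r (psi s) by apply: box_md; apply: k2; exact: between_dist ur2 hs.
    by split; [exact: Fz|apply: h2; exact: between_seg eab uab hs|exact: Hd].
  have := Hid _ _ b1 b2; rewrite H1 H2 -E -/p subrr sub0r mdN => k.
  apply/eqP; rewrite eq_sym -subr_eq0 -md_eq0 eq_le md_ge0 andbT.
  have := md_ge0 (psi u - phi u); lra.
have [d hd] := hF p; have [r r0 lip] := cdiff_lip hd.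
(* the zero [p] of [F] is not left *)
have stuck chi : (forall t, a <= t <= b -> sol F chi t) -> chi e = p ->
    exists2 r' : R, 0 < r' & forall u, a <= u <= b -> `|u - e| < r' -> chi u = p.
  move=> hc ce; have [r1 r10 k1] := vder_cont (hc e eab) r0; rewrite ce in k1.
  exists r1 => // u uab ur.
  have sp s : Num.min e u <= s <= Num.max e u ->
      md (F (chi s)) <= (1 + md d) * md (chi s - p).
    by move=> hs; have := lip (chi s); rewrite Fp0 subr0; apply; apply/k1; exact: between_dist ur hs.
  have sv s : Num.min e u <= s <= Num.max e u -> vder chi s (F (chi s)).
    by move=> hs; apply/hc; exact: between_seg eab uab hs.
  apply/eqP; rewrite -subr_eq0 -md_eq0 -sqrf_eq0 eq_le sqr_ge0 andbT.
  have [eu|] := boolP (e <= u).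
    move: sp sv; rewrite (min_idPl eu) (max_idPr eu) => sp sv.
    have [+ _] := exponential_growth eu sv sp.
    by rewrite ce subrr md0 expr0n mulr0.
  rewrite -ltNge => /ltW ue.
  move: sp sv; rewrite (min_idPr ue) (max_idPl ue) => sp sv.
  have [_ +] := exponential_growth ue sv sp.
  by rewrite ce subrr md0 expr0n mulr0.
have [r1 r10 k1] := stuck phi h1 erefl.
have [r2 r20 k2] := stuck psi h2 (esym E).
exists (Num.min r1 r2); first by rewrite lt_min r10.
by move=> u uab; rewrite lt_min => /andP[? ?]; rewrite k1 // k2.
Qed.

Lemma sol_unique_forward F phi psi (a b : R) : holomorphic F ->
  (forall t, a <= t <= b -> sol F phi t) ->
  (forall t, a <= t <= b -> sol F psi t) ->
  phi a = psi a -> forall t, a <= t <= b -> phi t = psi t.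
Proof.
move=> hF h1 h2 E; apply: (@real_ind R (fun t => phi t = psi t)) => //.
  move=> t /andP[at_ tb] /(_ t); rewrite at_ lexx => /(_ isT) Et.
  have [|r r0 k] := sol_unique_local hF h1 h2 _ Et; first by rewrite at_ ltW.
  exists r => // s /andP[ts st] sb; apply: k; first by rewrite sb (le_trans at_) // ltW.
  by rewrite gtr0_norm ?subr_gt0 // ltrBlDl.
move=> t /andP[at_ tb] hs.
have tab : a <= t <= b by rewrite tb ltW.
apply/eqP; rewrite -subr_eq0 -md_eq0 eq_le md_ge0 andbT.
apply/ler_addgt0Pr => e e0; rewrite add0r.
have e20 : 0 < e / 2 by rewrite divr_gt0.
have [r1 r10 k1] := vder_cont (h1 t tab) e20.
have [r2 r20 k2] := vder_cont (h2 t tab) e20.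
pose m := Num.max a (t - Num.min r1 r2 / 2).
have r12 : 0 < Num.min r1 r2 by rewrite lt_min r10.
have mt : m < t by rewrite gt_max at_ /=; lra.
have am : a <= m by rewrite le_max lexx.
have tm : `|m - t| < Num.min r1 r2.
  rewrite ltr0_norm ?subr_lt0 // opprB.
  have : t - Num.min r1 r2 / 2 <= m by rewrite le_max lexx orbT.
  lra.
move: tm; rewrite lt_min => /andP[/k1 l1 /k2 l2].
have Em : phi m = psi m by apply: hs; rewrite am.
rewrite Em in l1; have := mdB_le (phi t) (psi m) (psi t).
rewrite mdC in l1; lra.
Qed.

Lemma sol_unique F phi psi (a b e : R) : holomorphic F ->
  (forall t, a <= t <= b -> sol F phi t) ->
  (forall t, a <= t <= b -> sol F psi t) ->
  a <= e <= b -> phi e = psi e -> forall t, a <= t <= b -> phi t = psi t.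
Proof.
move=> hF h1 h2 /andP[ae eb] E t /andP[at_ tb].
have [et|/ltW te] := leP e t.
  apply: (@sol_unique_forward F phi psi e b) => //; last by rewrite et.
    by move=> s /andP[es sb]; apply: h1; rewrite sb (le_trans ae).
  by move=> s /andP[es sb]; apply: h2; rewrite sb (le_trans ae).
rewrite -(opprK t).
have inv s : - e <= s <= - a -> a <= - s <= b.
  move=> /andP[? ?]; apply/andP; split; lra.
apply: (@sol_unique_forward (fun z => -1 * F z) (fun s => phi (- s)) (fun s => psi (- s)) (- e) (- a)).
- exact: holomorphic_mul.
- by move=> s /inv hs; apply/sol_opp/h1.
- by move=> s /inv hs; apply/sol_opp/h2.
- by rewrite opprK.
- by rewrite lerN2 te lerN2.
Qed.

Lemma sol_cst F p t : F p = 0 -> sol F (fun=> p) t.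
Proof. by move=> Fp; rewrite /sol Fp; exact: vder_cst. Qed.

Lemma sol_regular F phi (a b e : R) : holomorphic F ->
  (forall t, a <= t <= b -> sol F phi t) ->
  a <= e <= b -> F (phi e) != 0 -> forall t, a <= t <= b -> F (phi t) != 0.
Proof.
move=> hF h1 eab Fe t tab; apply/eqP => Ft.
have := @sol_unique F phi (fun=> phi t) a b t hF h1 (fun s _ => sol_cst s Ft) tab erefl e eab.
by move=> E; move: Fe; rewrite E Ft eqxx.
Qed.

Definition csol F (Z : C -> C) t := cdiff Z t (F (Z t)).

Lemma csol_line F (Z : C -> C) w c (t : R) : csol F Z (w + rc t * c) ->
  sol (fun z => c * F z) (fun s => Z (w + rc s * c)) t.
Proof.
move=> h; have := cdiff_vder h (vder_line w c t).
by rewrite /sol mulrC.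
Qed.

(** On the segment of direction [c], a complex-time solution is a real-time
    solution for the field [c F]. *)
Lemma complex_uniq F (Z1 Z2 : C -> C) w c : holomorphic F ->
  (forall s : R, 0 <= s <= 1 -> csol F Z1 (w + rc s * c)) ->
  (forall s : R, 0 <= s <= 1 -> csol F Z2 (w + rc s * c)) ->
  Z1 w = Z2 w -> Z1 (w + c) = Z2 (w + c).
Proof.
move=> hF h1 h2 E.
have := @sol_unique_forward (fun z => c * F z) (fun s => Z1 (w + rc s * c))
  (fun s => Z2 (w + rc s * c)) 0 1 (holomorphic_mul c hF).
move=> k; have := k _ _ _ 1; rewrite !rc1 !mul1r; apply.
- by move=> t /h1; exact: csol_line.
- by move=> t /h2; exact: csol_line.
- by rewrite rc0 mul0r addr0.
- by rewrite ler01 lexx.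
Qed.

End Uniqueness.

(** * Complex time along an orbit *)

Section Strips.
Variable R : realType.
Local Notation C := (cplane R).
Local Notation re z := (complex.Re (z : R[i])).
Local Notation im z := (complex.Im (z : R[i])).
Implicit Types (z w p q : C) (f F : C -> C) (phi psi : R -> C).

Lemma holomorphic_bounded F (M : R) : holomorphic F ->
  exists B : R, forall z, md z <= M -> md (F z) <= B.
Proof.
move=> hF; have [|B hB] := @ccont_bounded R F (- M) M (- M) M.
  by move=> x y _ _; have [d /cdiff_cont] := hF (mk x y).
exists B => z zM; rewrite -(mkE z); apply: hB.
  by rewrite -ler_norml (le_trans (re_le z)).
by rewrite -ler_norml (le_trans (im_le z)).
Qed.

Lemma csol_shift F (Z : C -> C) z w : csol F Z (z + w) -> csol F (fun u => Z (u + w)) z.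
Proof. exact: cdiff_shift. Qed.

Lemma csol_sol F (Z : C -> C) (t : R) w : csol F Z (rc t + w) ->
  sol F (fun s => Z (rc s + w)) t.
Proof.
move=> h; have := @csol_line R F Z w 1 t.
rewrite !mulr1 addrC => /(_ h).
rewrite /sol /= mul1r mulr1 addrC.
by apply: (@vder_ext _ _ _ _ _ 1) => // s _; rewrite mulr1 addrC.
Qed.

Definition flow_germ F q (delta : R) (Psi : C -> C) :=
  Psi 0 = q /\ forall t, md t < delta -> csol F Psi t.

(** [local_flow] gives a time of existence that is uniform near each point of a
    compact piece of a regular orbit. *)
Lemma uniform_germs F phi (a b : R) : holomorphic F ->
  (forall t, a <= t <= b -> vcont phi t /\ F (phi t) != 0) ->
  exists2 delta : R, 0 < delta &
    forall t, a <= t <= b -> exists Psi, flow_germ F (phi t) delta Psi.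
Proof.
move=> hF h; apply: (@heine R (fun t delta => exists Psi, flow_germ F (phi t) delta Psi)).
  move=> t r r' r'0 rr' [Psi [h1 h2]]; exists Psi; split=> // s sr.
  by apply: h2; exact: lt_le_trans rr'.
move=> t tab; have [pc Fp] := h t tab.
have [Phi [rho rho0 [delta delta0 [K _ [h1 h2 _]]]]] := local_flow hF Fp.
have [r r0 k] := pc rho rho0.
exists (Num.min r delta); first by rewrite lt_min r0.
move=> s; rewrite lt_min => /andP[/k sr _].
exists (Phi (phi s)); split; first exact: h1.
by move=> u; rewrite lt_min => /andP[_ ud]; exact: h2.
Qed.

(** [Z (t + i y)] follows [phi] for the real time [t] and then the field [i F] for
    the time [y].  Near any point it agrees, by uniqueness first in the real and then
    in the imaginary direction, with a single local flow, hence it is holomorphic. *)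
Lemma strip F phi (I : set R) (delta : R) : holomorphic F -> 0 < delta ->
  (forall t, I t -> sol F phi t) ->
  (forall t, I t -> exists Psi, flow_germ F (phi t) delta Psi) ->
  exists Z : C -> C, (forall t, I t -> Z (rc t) = phi t) /\
    forall z, (exists2 e : R, 0 < e & forall s, `|s - re z| < e -> I s) ->
      `|im z| < delta / 2 -> csol F Z z.
Proof.
move=> hF d0 hs hg.
have hg' t : exists Psi, I t -> flow_germ F (phi t) delta Psi.
  have [It|nIt] := pselect (I t); last by exists (fun=> 0).
  by have [Psi] := hg t It; exists Psi.
have [Psi hPsi] := choice hg'.
exists (fun z => Psi (re z) (ci R * rc (im z))); split.
  by move=> t It; rewrite /= rc0 mulr0; have [] := hPsi t It.
move=> z0 [e e0 hI] z0d.
set t0 := re z0.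
have It0 : I t0 by apply: hI; rewrite subrr normr0.
have [P0 P1] := hPsi t0 It0.
pose eta := Num.min (e / 2) (delta / 4).
have eta0 : 0 < eta by rewrite lt_min !divr_gt0.
have real t : `|t - t0| <= eta -> Psi t0 (rc (t - t0)) = phi t.
  rewrite ler_distl => tt.
  apply: (@sol_unique R F (fun s => Psi t0 (rc (s - t0))) phi (t0 - eta) (t0 + eta) t0) => //.
  - move=> s; rewrite -ler_distl le_min => /andP[se sd].
    have k : csol F (Psi t0) (rc s + - rc t0).
      by apply: P1; rewrite -rcB md_rc; lra.
    rewrite /sol /= rcB.
    apply: (@vder_ext R (fun u => Psi t0 (rc u + - rc t0)) _ s _ 1 ltr01 _ (csol_sol k)) => u _.
    by rewrite rcB.
  - move=> s; rewrite -ler_distl le_min => /andP[se sd].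
    by apply/hs/hI; lra.
  - by rewrite lerBlDr lerDl ltW.
  - by rewrite subrr rc0.
(* near [z0] the function agrees with the one flow that starts from [phi t0] *)
have near z : md (z - z0) < Num.min eta (delta / 2 - `|im z0|) ->
    Psi t0 (z + - rc t0) = Psi (re z) (ci R * rc (im z)).
  rewrite lt_min => /andP[ze zd].
  have imz : `|im z| < delta / 2.
    have := im_le (z - z0); rewrite imD imN => k.
    have -> : im z = (im z - im z0) + im z0 by ring.
    by rewrite (le_lt_trans (ler_normD _ _)) //; lra.
  have rez : `|re z - t0| < eta.
    by have := re_le (z - z0); rewrite reD reN -/t0; lra.
  have Irez : I (re z).
    by apply: hI; move: rez; rewrite lt_min => /andP[+ _]; lra.
  have [Q0 Q1] := hPsi _ Irez.
  have := @complex_uniq R F (fun u => Psi t0 (u + rc (re z - t0))) (Psi (re z))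
    0 (ci R * rc (im z)) hF.
  rewrite !add0r Q0 => k.
  have -> : z + - rc t0 = ci R * rc (im z) + rc (re z - t0).
    by rewrite rcB -{1}(mkE z) mk_rc; ring.
  have ms (s : R) : 0 <= s <= 1 -> md (rc s * (ci R * rc (im z))) <= `|im z|.
    move=> /andP[s0 s1]; rewrite !mdM md_ci !md_rc mul1r ger0_norm // ler_piMl //.
  apply: k.
  - move=> s s01; rewrite add0r; apply: csol_shift; apply: P1.
    rewrite (le_lt_trans (mdD _ _)) // md_rc.
    have := ms s s01; move: rez; rewrite lt_min => /andP[_]; lra.
  - move=> s s01; rewrite add0r; apply: Q1.
    by rewrite (le_lt_trans (ms s s01)) // (lt_trans imz) // ltr_pdivrMr // mulr_natr mulr2n ltrDl.
  - by apply: real; exact: ltW.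
have r0 : 0 < Num.min eta (delta / 2 - `|im z0|) by rewrite lt_min eta0 subr_gt0.
apply: (cdiff_ext r0 near).
rewrite -near; last by rewrite subrr md0.
apply: csol_shift; apply: P1.
rewrite -{1}(mkE z0) mk_rc -/t0.
rewrite [X in md X](_ : _ = ci R * rc (im z0)); last by ring.
rewrite mdM md_ci mul1r md_rc (lt_trans z0d) // ltr_pdivrMr // mulr_natr mulr2n ltrDl //.
Qed.

Lemma strip_window F phi (a b eta : R) : holomorphic F -> a <= b -> 0 < eta ->
  (forall t, a - eta <= t <= b + eta -> sol F phi t) -> F (phi a) != 0 ->
  exists Z : C -> C, exists2 delta : R, 0 < delta &
    (forall t, a <= t <= b -> Z (rc t) = phi t) /\
    (forall z, a - delta < re z < b + delta -> `|im z| < delta -> csol F Z z).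
Proof.
move=> hF ab e0 hs Fa.
have reg : forall t, a - eta <= t <= b + eta -> F (phi t) != 0.
  by apply: (@sol_regular R F phi _ _ a hF hs _ Fa); apply/andP; split; lra.
have [|d0 d00 hd] := @uniform_germs F phi (a - eta) (b + eta) hF.
  by move=> t tab; split; [exact: vder_cont (hs t tab)|exact: reg].
have [Z [Z1 Z2]] := @strip F phi [set t | a - eta <= t <= b + eta] d0 hF d00 hs hd.
exists Z, (Num.min eta (d0 / 2)); first by rewrite lt_min e0 divr_gt0.
split.
  by move=> t /andP[at_ tb]; apply: Z1; apply/andP; split; lra.
have mle : Num.min eta (d0 / 2) <= eta by rewrite ge_min lexx.
move=> z /andP[z1 z2] z3; apply: Z2; last by move: z3; rewrite lt_min => /andP[].
exists (Num.min (re z - (a - eta)) (b + eta - re z)).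
  by rewrite lt_min; apply/andP; split; lra.
move=> s; rewrite lt_min !ltr_norml => /andP[/andP[? ?] /andP[? ?]].
by apply/andP; split; lra.
Qed.

Lemma csol_regular F (Z : C -> C) w z : holomorphic F ->
  (forall s : R, 0 <= s <= 1 -> csol F Z (z + rc s * (w - z))) ->
  F (Z w) != 0 -> F (Z z) != 0.
Proof.
move=> hF h; apply: contra_neq => Fz.
have := @complex_uniq R F Z (fun=> Z z) z (w - z) hF h.
rewrite addrCA subrr addr0 => -> //.
move=> s _; rewrite /csol Fz => e e0; exists 1 => // u _.
by rewrite subrr mul0r subr0 md0 mulr_ge0 ?md_ge0 // ltW.
Qed.

(** [local_flow] reaches every point near [Z z], and [Z] agrees with it. *)
Lemma csol_open F (Z : C -> C) z (r : R) : holomorphic F -> 0 < r ->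
  (forall w, md (w - z) < r -> csol F Z w) -> F (Z z) != 0 ->
  forall e : R, 0 < e -> exists2 rho : R, 0 < rho &
    forall q, md (q - Z z) < rho -> exists2 w, md (w - z) < e & Z w = q.
Proof.
move=> hF r0 h Fz e e0.
have [Phi [rho rho0 [delta d0 [K K0 [h1 h2 h3]]]]] := local_flow hF Fz.
pose m := Num.min e (Num.min r delta).
have m0 : 0 < m by rewrite !lt_min e0 r0.
exists (Num.min rho (m / K)); first by rewrite lt_min rho0 divr_gt0.
move=> q; rewrite lt_min => /andP[qr]; rewrite ltr_pdivlMr // => qm.
have cz : md (Z z - Z z) < rho by rewrite subrr md0.
have [t tK Pt] := h3 (Z z) q cz qr.
have : md t < m by rewrite (le_lt_trans tK) // mulrC.
rewrite !lt_min => /and3P[te tr td].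
exists (z + t); first by rewrite addrC addKr.
rewrite -(Pt td).
have := @complex_uniq R F (fun u => Z (u + z)) (Phi (Z z)) 0 t hF.
rewrite !add0r [t + z]addrC; apply.
- move=> s /andP[s0 s1]; rewrite add0r; apply: csol_shift; apply: h.
  by rewrite addrK mdM md_rc ger0_norm // (le_lt_trans _ tr) // ler_piMl ?md_ge0.
- move=> s /andP[s0 s1]; rewrite add0r; apply: h2 => //.
  by rewrite mdM md_rc ger0_norm // (le_lt_trans _ td) // ler_piMl ?md_ge0.
- by rewrite h1.
Qed.

End Strips.

(** * Tubes around periodic orbits, and maximal solutions *)

Section Solutions.
Variable R : realType.
Local Notation C := (cplane R).
Local Notation re z := (complex.Re (z : R[i])).
Local Notation im z := (complex.Im (z : R[i])).
Implicit Types (x z w c p q : C) (F : C -> C) (phi psi : R -> C) (I J : set R).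

(** [Z] has a nonzero derivative at [t], so it takes the value [Z (rc t)] only once
    near [t]: a period close to a real one is that real one. *)
Lemma regular_period_isolated F (Z : C -> C) (delta : R) t : holomorphic F -> 0 < delta ->
  (forall z, `|im z| < delta -> csol F Z z) -> F (Z (rc t)) != 0 ->
  exists2 r : R, 0 < r & forall w, md (w - rc t) < r -> Z w = Z 0 -> im w = 0.
Proof.
move=> hF d0 hZ Ft.
have ct : csol F Z (rc t) by apply: hZ; rewrite /= normr0.
have [E|nE] := eqVneq (Z (rc t)) (Z 0).
  have v0 : 0 < md (F (Z (rc t))) by rewrite md_gt0.
  have [|r r0 h] := ct (md (F (Z (rc t))) / 2); first by rewrite divr_gt0.
  exists r => // w wr Ew; have := h w wr.
  rewrite Ew -E subrr sub0r mdN mdM => k.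
  have : md (w - rc t) <= 0.
    by rewrite -(ler_pM2l v0) mulr0; lra.
  rewrite le_eqVlt ltNge md_ge0 orbF md_eq0 subr_eq0 => /eqP ->.
  by [].
have n0 : 0 < md (Z (rc t) - Z 0) by rewrite md_gt0 subr_eq0.
have [r r0 h] := cdiff_cont ct n0; exists r => // w /h k Ew.
by move: k; rewrite Ew mdC ltxx.
Qed.

(** The tube around a periodic orbit: each horizontal line of the strip is mapped
    onto a periodic orbit.  If two nearby lines had a common image, then their
    difference would give a small nonreal period, which [regular_period_isolated] and
    compactness exclude. *)
Lemma periodic_strip F phi (T : R) : holomorphic F -> 0 < T ->
  (forall t, sol F phi t) -> (forall t, phi (t + T) = phi t) -> F (phi 0) != 0 ->
  exists Z : C -> C, exists2 delta : R, 0 < delta &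
   [/\ forall t, Z (rc t) = phi t,
       forall z, `|im z| < delta -> csol F Z z,
       forall z, `|im z| < delta -> F (Z z) != 0,
       forall z, `|im z| < delta -> Z (z + rc T) = Z z &
       exists2 e : R, 0 < e & forall z w, `|im z| < delta -> `|im w| < delta ->
         0 < `|im z - im w| < e -> Z z != Z w].
Proof.
move=> hF T0 hs hT F0.
have reg t : F (phi t) != 0.
  have m1 : - `|t| <= 0 <= `|t| by rewrite oppr_le0 normr_ge0.
  have m2 : - `|t| <= t <= `|t| by rewrite -ler_norml.
  exact: (sol_regular hF (fun s _ => hs s) m1 F0 m2).
have [|d d0 hd] := @uniform_germs R F phi 0 T hF.
  by move=> t _; split => //; exact: vder_cont (hs t).
have hd' : forall t, exists Psi, flow_germ F (phi t) d Psi.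
  apply: (periodic_ind T0) => //.
    by move=> t; rewrite hT.
  by move=> t; rewrite -{1}(subrK T t) hT.
have [Z [Z1 Z2]] := @strip R F phi setT d hF d0 (fun t _ => hs t) (fun t _ => hd' t).
pose delta := d / 2; have delta0 : 0 < delta by rewrite divr_gt0.
have Zc z : `|im z| < delta -> csol F Z z.
  by move=> zd; apply: Z2 => //; exists 1.
have Zt t : Z (rc t) = phi t by exact: Z1.
have imseg z (s : R) : 0 <= s <= 1 -> `|im z| < delta ->
    `|im (rc (re z) + rc s * (z - rc (re z)))| < delta.
  move=> /andP[s0 s1] zd; rewrite imD im_rcM imD imN /= oppr0 addr0 add0r.
  by rewrite normrM ger0_norm // (le_lt_trans _ zd) // ler_piMl.
have imseg' z (s : R) : 0 <= s <= 1 -> `|im z| < delta ->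
    `|im (z + rc s * (rc (re z) - z))| < delta.
  move=> /andP[s0 s1] zd; rewrite imD im_rcM imD imN /= add0r.
  have -> : im z + s * - im z = (1 - s) * im z by ring.
  by rewrite normrM ger0_norm ?subr_ge0 // (le_lt_trans _ zd) // ler_piMl // lerBlDr lerDl.
have Zr z : `|im z| < delta -> F (Z z) != 0.
  move=> zd; apply: (@csol_regular R F Z (rc (re z)) z hF); last by rewrite Zt.
  by move=> s s01; apply: Zc; exact: imseg'.
have ZT z : `|im z| < delta -> Z (z + rc T) = Z z.
  move=> zd.
  have := @complex_uniq R F (fun u => Z (u + rc T)) Z (rc (re z)) (z - rc (re z)) hF.
  have -> : rc (re z) + (z - rc (re z)) = z by ring.
  apply.
  - move=> s s01; apply: csol_shift; apply: Zc.
    by rewrite imD /= addr0; exact: imseg.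
  - by move=> s s01; apply: Zc; exact: imseg.
  - by rewrite -rcD !Zt hT.
exists Z, delta => //; split => //.
have [||r r0 hr] := @heine R (fun s r => forall y, `|y| < r -> Z (mk s y) = Z 0 -> y = 0) 0 T.
- by move=> s r r' r'0 rr' h y yr; apply: h; exact: lt_le_trans rr'.
- move=> t _; have [|r r0 h] := @regular_period_isolated F Z delta t hF delta0 Zc; first by rewrite Zt.
  exists (r / 2); first by rewrite divr_gt0.
  move=> s sr y yr E; apply: (h (mk s y)) => //.
  rewrite (le_lt_trans (md_le _)) // !(reD, imD, reN, imN) /= subr0 [r]splitr ltrD //.
pose e := Num.min r delta.
have e0 : 0 < e by rewrite lt_min r0.
have he : forall s y, `|y| < e -> Z (mk s y) = Z 0 -> y = 0.
  have mkT s y : mk s y + rc T = mk (s + T) y by rewrite /rc mkD addr0.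
  apply: (periodic_ind T0).
  - move=> s h y ye E; apply: (h y ye).
    have yd : `|y| < delta by move: ye; rewrite lt_min => /andP[].
    by rewrite -ZT // mkT.
  - move=> s h y ye E; apply: (h y ye).
    have yd : `|y| < delta by move: ye; rewrite lt_min => /andP[].
    by rewrite -E -(@ZT (mk (s - T) y)) // mkT subrK.
  - by move=> s sT y; rewrite lt_min => /andP[yr _]; exact: hr.
exists e => // z w zd wd /andP[zw0 zwe]; apply/eqP => E.
have : im z - im w = 0; last by move/eqP; rewrite -normr_eq0 gt_eqF.
apply: (he (re z - re w)) => //.
have -> : mk (re z - re w) (im z - im w) = - w + z.
  by apply: cplane_ext; rewrite /= ?(reD, imD, reN, imN) addrC.
have := @complex_uniq R F (fun u => Z (u + z)) (fun u => Z (u + w)) 0 (- w) hF.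
rewrite !add0r addNr; apply => //.
- move=> s /andP[s0 s1]; rewrite add0r; apply: csol_shift; apply: Zc.
  rewrite imD im_rcM imN.
  have zwd : `|im z - im w| < delta by move: zwe; rewrite lt_min => /andP[].
  have -> : s * - im w + im z = (1 - s) * im z + s * (im z - im w) by ring.
  pose m := Num.max `|im z| `|im z - im w|.
  have md' : m < delta by rewrite gt_max zd.
  rewrite (le_lt_trans _ md') // (le_trans (ler_normD _ _)) // !normrM.
  rewrite (ger0_norm s0) ger0_norm ?subr_ge0 //.
  have m1 : `|im z| <= m by rewrite le_max lexx.
  have m2 : `|im z - im w| <= m by rewrite le_max lexx orbT.
  have := ler_wpM2l s0 m2; have s1' : 0 <= 1 - s by rewrite subr_ge0.
  by have := ler_wpM2l s1' m1; lra.
- move=> s /andP[s0 s1]; rewrite add0r; apply: csol_shift; apply: Zc.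
  rewrite imD im_rcM imN.
  have -> : s * - im w + im w = (1 - s) * im w by ring.
  by rewrite normrM ger0_norm ?subr_ge0 // (le_lt_trans _ wd) // ler_piMl // lerBlDr lerDl.
Qed.

Lemma ode_solutionP F x I phi : ode_solution F x I phi <->
  [/\ open I, is_interval I, I 0, phi 0 = x & forall t, I t -> sol F phi t].
Proof.
by split=> -[h1 h2 h3 h4 h5]; split => // t /h5 k; apply/vderP.
Qed.

Lemma Rball_open I t : open I -> I t -> exists2 r : R, 0 < r & forall s, `|s - t| < r -> I s.
Proof.
rewrite openE => h /h /nbhs_ballP[r /= r0 k]; exists r => // s st; apply: k.
by rewrite /ball /= distrC.
Qed.

Lemma open_Rball I : (forall t, I t -> exists2 r : R, 0 < r & forall s, `|s - t| < r -> I s) ->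
  open I.
Proof.
move=> h; rewrite openE => t /h[r r0 k]; apply/nbhs_ballP; exists r => // s.
by rewrite /ball /= distrC; exact: k.
Qed.

Lemma interval_seg I (a b t : R) : is_interval I -> I a -> I b -> a <= t <= b -> I t.
Proof. by move=> h Ia Ib; exact: h Ia Ib _. Qed.

Lemma ode_agree F x I J phi psi t : holomorphic F ->
  ode_solution F x I phi -> ode_solution F x J psi -> I t -> J t -> phi t = psi t.
Proof.
move=> hF /ode_solutionP[_ iI I0 p0 hI] /ode_solutionP[_ iJ J0 q0 hJ] It Jt.
have E : phi 0 = psi 0 by rewrite p0 q0.
have [t0|/ltW t0] := leP 0 t.
  apply: (@sol_unique R F phi psi 0 t 0 hF) => //.
  - by move=> s st; apply: hI; exact: interval_seg I0 It st.
  - by move=> s st; apply: hJ; exact: interval_seg J0 Jt st.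
  - by rewrite lexx.
  - by rewrite t0 lexx.
apply: (@sol_unique R F phi psi t 0 0 hF) => //.
- by move=> s st; apply: hI; exact: interval_seg It I0 st.
- by move=> s st; apply: hJ; exact: interval_seg Jt J0 st.
- by rewrite t0 lexx.
- by rewrite t0 lexx.
Qed.

Lemma ode_exists F x : holomorphic F -> exists I phi, ode_solution F x I phi.
Proof.
move=> hF; have [Fx|Fx] := eqVneq (F x) 0.
  exists setT, (fun=> x); apply/ode_solutionP; split => //; first exact: openT.
  by move=> t _; exact: sol_cst.
have [Phi [rho rho0 [d d0 [K _ [h1 h2 _]]]]] := local_flow hF Fx.
have xx : md (x - x) < rho by rewrite subrr md0.
exists [set t | `|t| < d], (fun t => Phi x (rc t)); apply/ode_solutionP; split.
- apply: open_Rball => t /= td; exists (d - `|t|); first by rewrite subr_gt0.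
  move=> s st; rewrite -(subrK t s) (le_lt_trans (ler_normD _ _)) //; lra.
- move=> a b /=; rewrite !ltr_norml => /andP[? ?] /andP[? ?] c /andP[? ?].
  by rewrite /= ltr_norml; apply/andP; split; lra.
- by rewrite /= normr0.
- exact: h1.
- move=> t /= td; have k : csol F (Phi x) (rc t + 0).
    by rewrite addr0; apply: h2; rewrite ?md_rc.
  have := csol_sol k; rewrite /sol addr0.
  by apply: (@vder_ext R _ _ t _ 1 ltr01) => s _; rewrite addr0.
Qed.

(** By [ode_agree] the union of all solutions is a solution. *)
Lemma largest_solution F x : holomorphic F -> exists I phi,
  ode_solution F x I phi /\ forall J psi, ode_solution F x J psi -> J `<=` I.
Proof.
move=> hF.
pose I : set R := [set t | exists J psi, ode_solution F x J psi /\ J t].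
have ex t : exists y, I t -> forall J psi, ode_solution F x J psi -> J t -> psi t = y.
  have [[J [psi [h Jt]]]|nI] := pselect (I t); last by exists 0.
  by exists (psi t) => _ J' psi' h' J't; exact: ode_agree h' h J't Jt.
have [phi hphi] := choice ex.
have agree J psi t : ode_solution F x J psi -> J t -> psi t = phi t.
  by move=> h Jt; have It : I t by [exists J, psi]; exact: hphi It J psi h Jt.
exists I, phi; split; last first.
  by move=> J psi h t Jt; exists J, psi.
apply/ode_solutionP; have [J0 [psi0 h0]] := ode_exists x hF.
have /ode_solutionP[ o0 i0 z0 p0 s0] := h0.
split.
- apply: open_Rball => t [J [psi [h Jt]]].
  have /ode_solutionP[ oJ _ _ _ _] := h.
  have [r r0 k] := Rball_open oJ Jt; exists r => // s /k Js; by exists J, psi.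
- move=> a b [Ja [pa [ha Jaa]]] [Jb [pb [hb Jbb]]] c /andP[ac cb].
  have [c0|/ltW c0] := leP 0 c.
    exists Jb, pb; split=> //; have /ode_solutionP[_ i z _ _] := hb.
    by apply: (interval_seg i z Jbb); rewrite c0.
  exists Ja, pa; split=> //; have /ode_solutionP[_ i z _ _] := ha.
  by apply: (interval_seg i Jaa z); rewrite c0 ac.
- by exists J0, psi0.
- by rewrite -(agree J0 psi0).
- move=> t [J [psi [h Jt]]].
  have /ode_solutionP[ oJ _ _ _ sJ] := h.
  have [r r0 k] := Rball_open oJ Jt.
  have := sJ t Jt; rewrite /sol (agree J psi) //.
  by apply: (@vder_ext R _ _ t _ r r0) => s /k Js; exact: agree h Js.
Qed.

Lemma maximal_exists F x : holomorphic F -> exists I phi, maximal_solution F x I phi.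
Proof.
move=> /(largest_solution x)[I [phi [h k]]]; exists I, phi; split => //.
by move=> J psi hJ _ _; exact: k hJ.
Qed.

Lemma maximal_domain F x I phi J psi : holomorphic F ->
  maximal_solution F x I phi -> ode_solution F x J psi -> J `<=` I.
Proof.
move=> hF [h hmax] hJ.
have [K [chi [hK sub]]] := largest_solution x hF.
have KI : K `<=` I.
  have IK := sub I phi h.
  by apply: (hmax K chi) => // t It; exact: (ode_agree hF hK h (IK t It) It).
by move=> t /(sub J psi hJ) /KI.
Qed.

Lemma orbitE F x I phi : holomorphic F -> maximal_solution F x I phi ->
  ode_orbit F x = phi @` I.
Proof.
move=> hF h; apply/seteqP; split => y; last by exists I, phi.
move=> [J [psi [h' [t Jt <-]]]].
have It : I t by apply: (maximal_domain hF h h'.1).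
by exists t => //; exact: ode_agree h.1 h'.1 It Jt.
Qed.

Lemma global_maximal F x phi : (forall t, sol F phi t) -> phi 0 = x ->
  maximal_solution F x setT phi.
Proof.
move=> hs p0; split; last by [].
by apply/ode_solutionP; split => //; exact: openT.
Qed.

Lemma vder_unique phi t v w : vder phi t v -> vder phi t w -> v = w.
Proof.
move=> h1 h2; apply/eqP; rewrite -subr_eq0 -md_eq0 eq_le md_ge0 andbT.
apply/ler_addgt0Pr => e e0; rewrite add0r.
have e20 : 0 < e / 2 by rewrite divr_gt0.
have [r1 r10 k1] := h1 _ e20; have [r2 r20 k2] := h2 _ e20.
pose r := Num.min r1 r2 / 2.
have r0 : 0 < r by rewrite divr_gt0 // lt_min r10.
have rr : `|t + r - t| < Num.min r1 r2.
  rewrite addrAC subrr add0r gtr0_norm // ltr_pdivrMr // mulr_natr mulr2n ltrDl lt_min r10 //.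
move: rr; rewrite lt_min => /andP[/k1 l1 /k2 l2].
have E : t + r - t = r by ring.
have : md (rc r * (v - w)) <= e * r.
  rewrite [X in md X](_ : _ = (phi (t + r) - phi t - rc r * w) - (phi (t + r) - phi t - rc r * v)); last by ring.
  rewrite (le_trans (mdD _ _)) // mdN.
  move: l1 l2; rewrite E gtr0_norm //; lra.
by rewrite mdM md_rc gtr0_norm // mulrC ler_pM2r.
Qed.

(** By uniqueness, a solution is nonconstant if and only if the field does not
    vanish at its initial point; global solutions are maximal. *)
Lemma periodic_orbitP F x : holomorphic F -> periodic_orbit F x <->
  F x != 0 /\ exists phi T, [/\ 0 < T, forall t, sol F phi t, phi 0 = x &
    forall t, phi (t + T) = phi t].
Proof.
move=> hF; split.
  move=> [phi [T [h T0 hT [t nt]]]].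
  have /ode_solutionP[_ _ _ p0 hs] := h.1.
  split; last by exists phi, T; split => // s; exact: hs.
  apply: contra_neq nt => Fx.
  apply: (@ode_agree F x setT setT phi (fun=> x) t hF h.1) => //.
  by apply/ode_solutionP; split => //; [exact: openT|move=> s _; exact: sol_cst].
move=> [Fx [phi [T [T0 hs p0 hT]]]]; exists phi, T; split => //.
  exact: global_maximal.
apply: contrapT => /forallNP k.
have pc t : phi t = x by apply/eqP/negP => /negP; exact: k.
have : F x = 0; last by apply/eqP.
rewrite -p0; apply: (vder_unique (hs 0)).
by apply: (@vder_ext R (fun=> x) phi 0 0 1 ltr01 _ (vder_cst x 0)) => s _; rewrite pc.
Qed.

End Solutions.

(** * Bounded orbits are global *)

Section Escape.
Variable R : realType.
Local Notation C := (cplane R).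
Local Notation re z := (complex.Re (z : R[i])).
Local Notation im z := (complex.Im (z : R[i])).
Implicit Types (x z w c p q : C) (F : C -> C) (phi psi : R -> C) (I J : set R).

Lemma speed_bound F phi (s t B : R) :
  (forall u, Num.min s t <= u <= Num.max s t -> sol F phi u) ->
  (forall u, Num.min s t <= u <= Num.max s t -> md (F (phi u)) <= B) ->
  md (phi t - phi s) <= 2 * B * `|t - s|.
Proof.
move=> h1 h2; have := @curve_MVT R phi (fun u => F (phi u)) s t B 0 h1.
rewrite mulr0 subr0; apply => u /h2; by rewrite subr0.
Qed.

(** The values at the times [beta - beta / 2 ^+ n] converge geometrically. *)
Lemma end_point F phi (beta B : R) : 0 < beta -> 0 <= B ->
  (forall u, 0 <= u < beta -> sol F phi u) ->
  (forall u, 0 <= u < beta -> md (F (phi u)) <= B) ->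
  exists l, forall t, 0 <= t < beta -> md (l - phi t) <= 2 * B * (beta - t).
Proof.
move=> b0 B0 h1 h2.
have lip s t : 0 <= s < beta -> 0 <= t < beta -> md (phi t - phi s) <= 2 * B * `|t - s|.
  move=> /andP[? ?] /andP[? ?]; apply: (@speed_bound F) => u;
    case: (leP s t) => ? /andP[? ?]; (apply: h1 || apply: h2); apply/andP; split; lra.
pose t n := beta - beta / 2 ^+ n.
have p0 n : 0 < beta / 2 ^+ n by rewrite divr_gt0 // exprn_gt0.
have pS n : beta / 2 ^+ n = 2 * (beta / 2 ^+ n.+1).
  by rewrite exprS; field; rewrite expf_neq0.
have p1 n : beta / 2 ^+ n <= beta.
  by rewrite ler_pdivrMr ?exprn_gt0 // ler_peMr ?(ltW b0) // exprn_ege1 // ler1n.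
have tin n : 0 <= t n < beta.
  by rewrite /t subr_ge0 p1 /= ltrBlDr ltrDl.
have st n : md (phi (t n.+1) - phi (t n)) <= 2 * B * beta / 2 ^+ n.
  rewrite (le_trans (lip _ _ (tin n) (tin n.+1))) // /t.
  have -> : beta - beta / 2 ^+ n.+1 - (beta - beta / 2 ^+ n) = beta / 2 ^+ n.+1.
    by rewrite (pS n); ring.
  rewrite gtr0_norm // -[leRHS]mulrA (pS n) ler_wpM2l ?mulr_ge0 //.
  by have := p0 n.+1; lra.
have [|l1 hl1] := @geometric_limit R (fun n => re (phi (t n))) (2 * B * beta).
  by move=> n; rewrite (le_trans _ (st n)) // (le_trans _ (re_le _)) // !(reD, reN).
have [|l2 hl2] := @geometric_limit R (fun n => im (phi (t n))) (2 * B * beta).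
  by move=> n; rewrite (le_trans _ (st n)) // (le_trans _ (im_le _)) // !(imD, imN).
exists (mk l1 l2) => s sb; apply/ler_addgt0Pr => e e0.
have [n hn] := @half_pow_lt R (10 * B * beta) e e0.
have d1 : md (mk l1 l2 - phi (t n)) <= 8 * B * beta / 2 ^+ n.
  rewrite (le_trans (md_le _)) // !(reD, reN, imD, imN) (le_trans (lerD (hl1 n) (hl2 n))) //.
  by rewrite le_eqVlt; apply/orP; left; apply/eqP; ring.
have d2 := lip _ _ sb (tin n).
have d3 := mdB_le (mk l1 l2) (phi (t n)) (phi s).
have d4 : `|t n - s| <= beta - s + beta / 2 ^+ n.
  move: sb => /andP[s0 sb]; have := p0 n.
  by rewrite /t ler_norml => ?; apply/andP; split; lra.
have d5 : 2 * B * `|t n - s| <= 2 * B * (beta - s + beta / 2 ^+ n).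
  by rewrite ler_wpM2l // mulr_ge0.
move: hn d1; rewrite -[10 * B * beta / _]mulrA -[8 * B * beta / _]mulrA; lra.
Qed.

(** [phi] has a limit [l] at the end of its domain, and it is continued by a solution
    that starts from [l].  The glued curve is differentiable at the junction because
    the velocity of [phi] tends to [F l] there; this covers the case where [l] is an
    equilibrium. *)
Lemma extend_right F x I phi (M t1 : R) : holomorphic F -> ode_solution F x I phi ->
  (forall t, I t -> md (phi t) <= M) -> 0 <= t1 -> ~ I t1 ->
  exists J psi t, [/\ ode_solution F x J psi, J t & ~ I t].
Proof.
move=> hF /[dup] hphi /ode_solutionP[ oI iI I0 p0 hs] hM t10 nI.
pose beta := sup I.
have ub t : I t -> t < t1.
  move=> It; rewrite ltNge; apply/negP => tt.
  by apply: nI; apply: interval_seg iI I0 It _; rewrite t10.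
have hub : has_ubound I by exists t1 => t /ub/ltW.
have hsup : has_sup I by split=> //; exists 0.
have ltb t : I t -> t < beta.
  move=> It; have [r r0 k] := Rball_open oI It.
  have : I (t + r / 2) by apply: k; rewrite addrAC subrr add0r gtr0_norm ?divr_gt0 //; lra.
  move=> /(ub_le_sup hub); rewrite -/beta; lra.
have b0 : 0 < beta := ltb 0 I0.
have inI t : 0 <= t < beta -> I t.
  move=> /andP[t0 tb]; have [|u Iu] := @sup_adherent R I (beta - t) _ hsup.
    by rewrite subr_gt0.
  rewrite -/beta => tu; apply: interval_seg iI I0 Iu _; rewrite t0 /=; lra.
have nb : ~ I beta by move=> /ltb; rewrite ltxx.
have [B0 hB0] := holomorphic_bounded M hF.
pose B := Num.max 0 B0.
have B00 : 0 <= B by rewrite le_max lexx.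
have hB t : I t -> md (F (phi t)) <= B.
  by move=> It; rewrite le_max hB0 ?orbT //; exact: hM.
have [l hl] := @end_point F phi beta B b0 B00 (fun u hu => hs u (inI u hu)) (fun u hu => hB u (inI u hu)).
have [J [psi /ode_solutionP[ oJ iJ J0 q0 hJ]]] := ode_exists l hF.
have [r r0 kr] := Rball_open oJ J0.
pose chi t := if t < beta then phi t else psi (t - beta).
pose K : set R := [set t | I t \/ beta <= t < beta + r].
exists K, chi, beta; split; last by []; last by right; rewrite lexx ltrDl.
apply/ode_solutionP; split.
- apply: open_Rball => t [It|/andP[bt tr]].
    by have [q q0' k] := Rball_open oI It; exists q => // s /k; left.
  exists (Num.min beta (beta + r - t)); first by rewrite lt_min b0 subr_gt0.
  move=> s; rewrite lt_min !ltr_norml => /andP[/andP[? ?] /andP[? ?]].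
  have [sb|sb] := ltP s beta; [left; apply: inI|right]; apply/andP; split; lra.
- move=> a b Ka Kb c /andP[ac cb].
  have [bc|cb'] := leP beta c.
    right; rewrite bc /=; case: Kb => [/ltb|/andP[_]]; lra.
  left; have [c0|c0] := leP 0 c; first by apply: inI; rewrite c0.
  case: Ka => [Ia|/andP[ba _]]; last by have := le_trans ba ac; rewrite leNgt cb'.
  by apply: interval_seg iI Ia I0 _; rewrite ac ltW.
- by left.
- by rewrite /chi b0.
- move=> t; have [tb|tb|tb] := ltrgtP t beta.
  + case=> [It|]; last by rewrite leNgt tb.
    have d0 : 0 < beta - t by rewrite subr_gt0.
    rewrite /sol {2}/chi tb; apply: vder_ext d0 _ (hs t It) => s.
    by rewrite ltr_norml /chi => /andP[_ ?]; rewrite ifT //; lra.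
  + case=> [/ltb|/andP[_ tr]]; first by rewrite ltNge ltW.
    have d0 : 0 < t - beta by rewrite subr_gt0.
    have Jt : J (t - beta) by apply: kr; rewrite subr0 gtr0_norm //; lra.
    rewrite /sol {2}/chi ltNge (ltW tb) /=.
    apply: vder_ext d0 _ (vder_shift (hJ _ Jt)) => s.
    by rewrite ltr_norml /chi => /andP[? _]; rewrite ifF //; apply/negbTE; rewrite -leNgt; lra.
  + move=> _; rewrite tb /sol {2}/chi ltxx subrr q0 => e e0.
    have [r1 r10 h1] := hJ 0 J0 e e0; rewrite q0 in h1.
    have [d /cdiff_cont Fc] := hF l.
    have [|r2 r20 h2] := Fc (e / 2); first by rewrite divr_gt0.
    pose r3 := Num.min beta (r2 / (2 * B + 1)).
    have B1 : 0 < 2 * B + 1 by rewrite ltr_wpDl // mulr_ge0.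
    have r30 : 0 < r3 by rewrite lt_min b0 divr_gt0.
    exists (Num.min r1 r3); first by rewrite lt_min r10.
    have cb : chi beta = l by rewrite /chi ltxx subrr q0.
    move=> s; rewrite lt_min cb => /andP[sr1 sr3].
    have [bs|sb] := leP beta s.
      have -> : chi s = psi (s - beta) by rewrite /chi ltNge bs.
      have := h1 (s - beta); rewrite subr0; exact.
    have -> : chi s = phi s by rewrite /chi sb.
    have [s0 sr2] : 0 < s /\ beta - s < r2 / (2 * B + 1).
      by move: sr3; rewrite lt_min !ltr_norml => /andP[/andP[? ?] /andP[? ?]]; split; lra.
    have close u : s <= u < beta -> md (F (phi u) - F l) <= e / 2.
      move=> /andP[su ub']; apply/ltW/h2; rewrite mdC.
      have /hl k : 0 <= u < beta by apply/andP; split; lra.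
      rewrite (le_lt_trans k) //; move: sr2; rewrite ltr_pdivlMr // => sr2.
      have : 2 * B * (beta - u) <= 2 * B * (beta - s).
        by rewrite ler_wpM2l ?mulr_ge0 // lerD2l lerN2.
      lra.
    (* [phi] is only defined before [beta]: the estimate is proved up to [u] and [u]
       tends to [beta] *)
    have main u : s <= u < beta -> md (phi u - phi s - rc (u - s) * F l) <= e * (u - s).
      move=> /andP[su ub'].
      have := @curve_MVT R phi (fun v => F (phi v)) s u (e / 2) (F l).
      rewrite (min_idPl su) (max_idPr su) ger0_norm ?subr_ge0 //.
      have -> : 2 * (e / 2) = e by field.
      apply => v /andP[sv vu]; first by apply: hs; apply: inI; apply/andP; split; lra.
      by apply: close; rewrite sv; lra.
    have -> : phi s - l - rc (s - beta) * F l = - (l - phi s - rc (beta - s) * F l).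
      by rewrite -(opprB beta s) rcN; ring.
    rewrite mdN ltr0_norm ?subr_lt0 // opprB.
    apply/ler_addgt0Pr => e' e'0.
    pose kk := 2 * B + md (F l) + 1.
    have k0 : 0 < kk by rewrite ltr_wpDl // addr_ge0 ?md_ge0 // mulr_ge0.
    pose u := Num.max s (beta - e' / kk).
    have eu : 0 < e' / kk by rewrite divr_gt0.
    have us : s <= u by rewrite le_max lexx.
    have ub' : u < beta by rewrite gt_max sb /=; lra.
    have bu : beta - u <= e' / kk.
      by have : beta - e' / kk <= u by [rewrite le_max lexx orbT]; lra.
    have m1 : s <= u < beta by rewrite us.
    have {}main := main u m1.
    have m2 : md (l - phi u) <= 2 * B * (beta - u).
      by apply: hl; apply/andP; split; lra.
    have E : l - phi s - rc (beta - s) * F l = (phi u - phi s - rc (u - s) * F l) +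
       ((l - phi u) + (- rc (beta - u)) * F l) by rewrite !rcB; ring.
    rewrite E (le_trans (mdD _ _)) //.
    have m3 : md (l - phi u + - rc (beta - u) * F l) <= e'.
      rewrite (le_trans (mdD _ _)) // mdM mdN md_rc gtr0_norm ?subr_gt0 //.
      have := ler_wpM2r (ltW k0) bu; rewrite mulfVK ?gt_eqF // /kk.
      have := md_ge0 (F l); lra.
    have m4 : e * (u - s) <= e * (beta - s) by rewrite ler_wpM2l ?(ltW e0) // lerD2r ltW.
    lra.
Qed.

Lemma ode_solution_opp F x I phi : ode_solution F x I phi ->
  ode_solution (fun z => -1 * F z) x [set t | I (- t)] (fun t => phi (- t)).
Proof.
move=> /ode_solutionP[ oI iI I0 p0 hs]; apply/ode_solutionP; split.
- apply: open_Rball => t /= It; have [r r0 k] := Rball_open oI It; exists r => // s st.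
  by apply: k; rewrite opprK addrC distrC.
- move=> a b /= Ia Ib c /andP[ac cb] /=; apply: interval_seg iI Ib Ia _.
  by rewrite !lerN2 cb.
- by rewrite /= oppr0.
- by rewrite oppr0.
- by move=> t /= It; apply: sol_opp; exact: hs.
Qed.

Lemma ode_solution_oppK F x I phi : ode_solution (fun z => -1 * F z) x I phi ->
  ode_solution F x [set t | I (- t)] (fun t => phi (- t)).
Proof.
move=> h; have := ode_solution_opp h.
by have -> : (fun z => -1 * (-1 * F z)) = F by apply/funext => z; rewrite !mulN1r opprK.
Qed.

Lemma bounded_global F x I phi (M : R) : holomorphic F -> maximal_solution F x I phi ->
  (forall t, I t -> md (phi t) <= M) -> forall t, I t.
Proof.
move=> hF hmax hM t; apply: contrapT => nI.
have dom := maximal_domain hF hmax.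
have [t0|/ltW t0] := leP 0 t.
  have [J [psi [s [h Js nIs]]]] := extend_right hF hmax.1 hM t0 nI.
  by apply: nIs; exact: (dom _ _ h).
have h' := ode_solution_opp hmax.1.
have t0' : 0 <= - t by rewrite oppr_ge0.
have nI' : ~ [set u | I (- u)] (- t) by rewrite /= opprK.
have hM' u : [set u | I (- u)] u -> md (phi (- u)) <= M by exact: hM.
have [J [psi [s [h Js nIs]]]] := extend_right (holomorphic_mul (-1) hF) h' hM' t0' nI'.
apply: nIs => /=; apply: (dom _ _ (ode_solution_oppK h)).
by rewrite /= opprK.
Qed.

End Escape.

(** * Components of the complement of a curve *)

Section Components.
Variable R : realType.
Local Notation C := (cplane R).
Local Notation re z := (complex.Re (z : R[i])).
Local Notation im z := (complex.Im (z : R[i])).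
Implicit Types (z w p q a : C) (A W : set C).

Lemma path_component A (gamma : R -> C) :
  (forall t, 0 <= t <= 1 -> vcont gamma t) ->
  (forall t, 0 <= t <= 1 -> A (gamma t)) ->
  connected_component A (gamma 0) (gamma 1).
Proof.
move=> gc gA.
apply: (@connected_component_max _ A (gamma @` [set` `[0, 1]])).
- by exists 0 => //=; rewrite in_itv /= lexx ler01.
- by move=> _ [t /= t01 <-]; apply: gA; move: t01; rewrite in_itv.
- apply: connected_continuous_connected; first exact: segment_connected.
  apply: continuous_in_subspaceT => t; rewrite inE /= in_itv /= => t01.
  move=> B /cnbhsP[e e0 hB]; have [r r0 k] := gc t t01 e e0.
  apply/nbhs_ballP; exists r => // s; rewrite /ball /= distrC => /k; exact: hB.
- by exists 1 => //=; rewrite in_itv /= lexx ler01.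
Qed.

Lemma line_vcont z w (t : R) : vcont (fun s => z + rc s * w) t.
Proof. exact: vder_cont (vder_line z w t). Qed.

Lemma segment_component A z w :
  (forall s : R, 0 <= s <= 1 -> A (z + rc s * (w - z))) ->
  connected_component A z w.
Proof.
move=> h; have := @path_component A (fun s => z + rc s * (w - z)) _ h.
rewrite rc0 mul0r addr0 rc1 mul1r (_ : z + (w - z) = w); last by ring.
apply => t _.
exact: line_vcont.
Qed.

Lemma segment_ball z w (e s : R) : 0 <= s <= 1 -> md (w - z) < e ->
  md (z + rc s * (w - z) - z) < e.
Proof.
move=> /andP[s0 s1] h; rewrite addrC addKr mdM md_rc ger0_norm //.
by rewrite (le_lt_trans _ h) // ler_piMl ?md_ge0.
Qed.

Lemma ball_component A z w (e : R) : (forall q, md (q - z) < e -> A q) ->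
  md (w - z) < e -> connected_component A z w.
Proof.
move=> h wz; apply: segment_component => s s01; apply: h.
exact: segment_ball.
Qed.

Lemma component_open A a : open A -> open (connected_component A a).
Proof.
move=> /copenP oA; apply/copenP => z hz.
have Az : A z by exact: connected_component_sub hz.
have [e e0 k] := oA z Az; exists e => // w wz.
by apply: connected_component_trans hz _; exact: ball_component k wz.
Qed.

Lemma component_closure A a z : open A -> A z ->
  closure (connected_component A a) z -> connected_component A a z.
Proof.
move=> /copenP oA Az /cclosureP hz; have [e e0 k] := oA z Az.
have [w hw wz] := hz e e0.
apply: connected_component_trans hw _; apply: connected_component_sym.
exact: ball_component k wz.
Qed.

Lemma connected_stays (K W : set C) a : connected K -> open W -> K a -> W a ->
  (forall z, closure W z -> K z -> W z) -> K `<=` W.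
Proof.
move=> cK oW Ka Wa h.
have E : K `&` W = K.
  apply: cK; first by exists a.
    by exists W.
  exists (closure W); first exact: closed_closure.
  apply/seteqP; split => z [Kz hz]; split=> //; first exact: subset_closure.
  exact: h.
by move=> z; rewrite -{1}E => -[].
Qed.

(** Let [W] be the bounded component of [a] in the complement of the image [G0] of
    the real line.  The image [L] of the strip just below the real line is connected
    and avoids [G0], so it lies inside [W] or outside.  If inside, add to [W] the
    image of the strip up to height [sigma]; if outside, remove the image of the
    closed strip.  In both cases the result is open and bounded, contains [a], and
    its boundary lies in the image [G1] of the line at height [sigma]. *)
Lemma parallel_surround (Z : C -> C) a (T eta sigma : R) :
  0 < T -> 0 < eta -> 0 < sigma ->
  let U z := - eta < im z < sigma + eta in
  (forall z, U z -> ccont Z z) ->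
  (forall z, U z -> forall e : R, 0 < e -> exists2 rho : R, 0 < rho &
    forall q, md (q - Z z) < rho -> exists2 w, md (w - z) < e & Z w = q) ->
  (forall z, U z -> Z (z + rc T) = Z z) ->
  (forall z, U z -> Z z != a) ->
  (forall z w, im w = 0 -> - eta < im z < 0 -> Z z != Z w) ->
  jordan_int (Z @` [set z | im z = 0]) a ->
  jordan_int (Z @` [set z | im z = sigma]) a.
Proof.
move=> T0 eta0 sig0 U Zc Zo ZT Za Zsep [na Wb].
set G0 := Z @` [set z | im z = 0] in na Wb.
set G1 := Z @` [set z | im z = sigma].
pose W := connected_component (~` G0) a.
have mkT x y : mk x y + rc T = mk (x + T) y by rewrite /rc mkD addr0.
have Umk (c d x y : R) : - eta < c -> d < sigma + eta -> c <= y <= d -> U (mk x y).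
  by move=> c1 d1 /andP[cy yd]; rewrite /U /=; apply/andP; split; lra.
have far (c d : R) p : - eta < c -> d < sigma + eta ->
    (forall z, c <= im z <= d -> Z z != p) ->
    exists2 e : R, 0 < e & forall z, c <= im z <= d -> e <= md (Z z - p).
  move=> c1 d1 hp; have Uy x y := Umk c d x y c1 d1.
  have [|r r0 h] := @ccont_far R Z p 0 T c d.
    by move=> x y _ ycd; split; [apply/Zc/Uy|exact: hp].
  exists r => // z zcd; rewrite -(mkE z).
  have : forall x, forall y, c <= y <= d -> r <= md (Z (mk x y) - p); last exact.
  apply: (periodic_ind T0) => [x hx y ycd|x hx y ycd|x x0 y]; last exact: h.
    by rewrite -mkT ZT; [exact: hx|exact: Uy].
  by rewrite -ZT ?mkT ?subrK; [exact: hx|exact: Uy].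
have bnd (d : R) : d < sigma + eta ->
    exists M : R, forall z, 0 <= im z <= d -> md (Z z) <= M.
  move=> d1; have n0 : - eta < 0 by rewrite oppr_lt0.
  have Uy x y := Umk 0 d x y n0 d1.
  have [|M h] := @ccont_bounded R Z 0 T 0 d.
    by move=> x y _ ycd; apply/Zc/Uy.
  exists M => z zcd; rewrite -(mkE z).
  have : forall x, forall y, 0 <= y <= d -> md (Z (mk x y)) <= M; last exact.
  apply: (periodic_ind T0) => [x hx y ycd|x hx y ycd|x x0 y]; last exact: h.
    by rewrite -mkT ZT; [exact: hx|exact: Uy].
  by rewrite -ZT ?mkT ?subrK; [exact: hx|exact: Uy].
have oG0 : open (~` G0).
  apply/copenP => p np.
  have [|||e e0 k] := far 0 0 p; rewrite ?oppr_lt0 ?addr_gt0 //.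
    by move=> z /le_anti z0; apply/eqP => E; apply: np; exists z.
  exists e => // q qp [z /= z0 Ez].
  by have := k z; rewrite z0 lexx Ez leNgt qp => /(_ isT).
have oW : open W by exact: component_open.
have clW p : closure W p -> ~ G0 p -> W p by move=> h np; exact: component_closure.
have Wa : W a by exact: connected_component_refl.
(* a bounded open set around [a] with boundary in [G1] contains the component *)
have key (V : set C) : open V -> V a -> bounded_set V ->
    (forall p, closure V p -> ~ G1 p -> V p) -> jordan_int G1 a.
  move=> oV Va /cboundedP[M hM] hV.
  have nG1 : ~ G1 a.
    move=> [z /= z1 E]; have := Za z; rewrite E eqxx /U z1.
    by rewrite ltrDl eta0 andbT (lt_trans _ sig0) ?oppr_lt0 // => /(_ isT).
  split => //; apply/cboundedP; exists M => z Kz; apply: hM.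
  apply: (@connected_stays (connected_component (~` G1) a) V a) Kz => //.
  - exact: component_connected.
  - exact: connected_component_refl.
  - by move=> p clp /connected_component_sub; exact: hV.
have [M hM] := (cboundedP W).1 Wb.
(* the image of the lower strip lies in a single component *)
have Lconn z w : - eta < im z < 0 -> - eta < im w < 0 -> W (Z z) -> W (Z w).
  move=> /andP[z1 z2] /andP[w1 w2] Wz; apply: connected_component_trans Wz _.
  have := @path_component (~` G0) (fun s => Z (z + rc s * (w - z))).
  rewrite rc0 mul0r addr0 rc1 mul1r.
  have -> : z + (w - z) = w by ring.
  have seg (s : R) : 0 <= s <= 1 -> - eta < im (z + rc s * (w - z)) < 0.
    move=> /andP[s0 s1]; rewrite imD im_rcM imD imN.
    have -> : im z + s * (im w - im z) = (1 - s) * im z + s * im w by ring.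
    have s1' : 0 <= 1 - s by rewrite subr_ge0.
    pose m := Num.max (im z) (im w); pose m' := Num.min (im z) (im w).
    have m0 : m < 0 by rewrite gt_max z2.
    have m'0 : - eta < m' by rewrite lt_min z1.
    have a1 : im z <= m by rewrite le_max lexx.
    have a2 : im w <= m by rewrite le_max lexx orbT.
    have a3 : m' <= im z by rewrite ge_min lexx.
    have a4 : m' <= im w by rewrite ge_min lexx orbT.
    have := ler_wpM2l s1' a1; have := ler_wpM2l s0 a2.
    have := ler_wpM2l s1' a3; have := ler_wpM2l s0 a4.
    by move=> *; apply/andP; split; lra.
  apply => t /seg /andP[t1 t2].
    move=> e e0; have [|r r0 k] := Zc (z + rc t * (w - z)) _ e e0.
      by rewrite /U; apply/andP; split; lra.
    have [r' r'0 k'] := line_vcont z (w - z) t r0.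
    by exists r' => // s /k' /k.
  move=> [u /= u0 E]; have := Zsep (z + rc t * (w - z)) u u0.
  by rewrite E eqxx t1 t2 => /(_ isT).
have clearS p : ~ G1 p -> (forall z, 0 <= im z < sigma -> Z z != p) ->
    exists2 e : R, 0 < e & forall z, 0 <= im z <= sigma -> e <= md (Z z - p).
  move=> np h; apply: far; rewrite ?oppr_lt0 ?ltrDl //.
  move=> z /andP[z0]; rewrite le_eqVlt => /orP[/eqP zs|zs]; last by apply: h; rewrite z0.
  by apply/eqP => E; apply: np; exists z.
have [[z0 [z0n Wz0]]|nL] := pselect (exists z, - eta < im z < 0 /\ W (Z z)).
  have LW z : - eta < im z < 0 -> W (Z z) by move=> zn; exact: Lconn Wz0.
  apply: (key (W `|` Z @` [set z | - eta < im z < sigma])).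
  - apply: openU => //; apply/copenP => _ [z /= /andP[z1 z2] <-].
    pose e := Num.min (im z + eta) (sigma - im z).
    have e0 : 0 < e by rewrite lt_min; apply/andP; split; lra.
    have [|rho rho0 k] := Zo z _ e e0; first by rewrite /U; apply/andP; split; lra.
    exists rho => // q /k[w wz <-]; exists w => //=.
    have := im_le (w - z); rewrite imD imN => k2.
    have : `|im w - im z| < e by rewrite (le_lt_trans k2).
    by rewrite lt_min !ltr_norml => /andP[/andP[? ?] /andP[? ?]]; apply/andP; split; lra.
  - by left.
  - have [|M' hM'] := bnd sigma; first by rewrite ltrDl.
    apply/cboundedP; exists (Num.max M M') => q [/hM|[z /= /andP[z1 z2] <-]].
      by rewrite le_max => ->.
    rewrite le_max; have [zn|zn] := ltP (im z) 0; first by rewrite hM //; apply: LW; rewrite z1.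
    by rewrite hM' ?orbT // zn ltW.
  - move=> p /cclosureP clp np; apply: contrapT => nV.
    have [|e2 e20 k2] := clearS p np.
      move=> z /andP[zz zs]; apply/eqP => E; apply: nV; right; exists z => //=.
      by rewrite zs andbT (lt_le_trans _ zz) ?oppr_lt0.
    have ncl : ~ closure W p.
      move=> /clW h; apply: nV; left; apply: h => -[z /= z0' E].
      have := k2 z; rewrite z0' lexx ltW //= E subrr md0 => /(_ isT).
      by rewrite leNgt e20.
    have [e1 e10 k1] : exists2 e : R, 0 < e & forall q, W q -> e <= md (q - p).
      apply: contrapT => h; apply: ncl; apply/cclosureP => e e0.
      apply: contrapT => h2; apply: h; exists e => // q Wq; rewrite leNgt; apply/negP => qp.
      by apply: h2; exists q.
    have [|q Vq] := clp (Num.min e1 e2); first by rewrite lt_min e10.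
    rewrite lt_min => /andP[q1 q2].
    have nWq : ~ W q by move=> /k1; rewrite leNgt q1.
    case: Vq => // -[z /= /andP[z1 z2] E].
    have [zn|zn] := ltP (im z) 0; first by apply: nWq; rewrite -E; apply: LW; rewrite z1.
    by have := k2 z; rewrite zn ltW //= E leNgt q2 => /(_ isT).
(* here the lower strip is outside [W], so points of [W] near [G0] are images of
   points above the real line *)
pose S := Z @` [set z | 0 <= im z <= sigma].
have US z : 0 <= im z <= sigma -> U z.
  by move=> /andP[? ?]; rewrite /U; apply/andP; split; lra.
apply: (key (W `\` S)).
- apply/copenP => p [Wp nS].
  have [e1 e10 k1] := (copenP W).1 oW p Wp.
  have [|||e2 e20 k2] := far 0 sigma p; rewrite ?oppr_lt0 ?ltrDl //.
    by move=> z zs; apply/eqP => E; apply: nS; exists z.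
  exists (Num.min e1 e2); first by rewrite lt_min e10.
  move=> q; rewrite lt_min => /andP[/k1 Wq q2]; split => // -[z /= zs E].
  by have := k2 z zs; rewrite E leNgt q2.
- by split => // -[z /= /US /Za h E]; move: h; rewrite E eqxx.
- by apply/cboundedP; exists M => z [/hM].
- move=> p /[dup] clp /cclosureP clp' np; apply: contrapT => nV.
  have clWp : closure W p.
    by apply/cclosureP => e /clp'[q [Wq _] qp]; exists q.
  have [z /= /andP[z0 zs] E] : S p.
    apply: contrapT => nS; apply: nV; split => //; apply: clW => // -[z /= z0 E].
    by apply: nS; exists z; rewrite //= z0 lexx ltW.
  have zs' : im z < sigma.
    rewrite lt_neqAle zs andbT; apply/eqP => zE; apply: np.
    by exists z.
  pose e := Num.min eta (sigma - im z).
  have e0 : 0 < e by rewrite lt_min eta0 subr_gt0.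
  have [|rho rho0 k] := Zo z _ e e0; first by apply: US; rewrite z0.
  have [q [Wq nSq]] := clp' rho rho0; rewrite -E => /k[w wz Ew].
  have := im_le (w - z); rewrite imD imN => k2.
  have : `|im w - im z| < e by rewrite (le_lt_trans k2).
  rewrite lt_min !ltr_norml => /andP[/andP[w1 w2] /andP[w3 w4]].
  have [wn|wn] := ltP (im w) 0.
    by apply: nL; exists w; rewrite Ew; split => //; apply/andP; split; lra.
  by apply: nSq; exists w => //=; rewrite wn /=; lra.
Qed.

Lemma no_bounded_clopen (W : set C) x : open W -> closure W `<=` W -> W x ->
  ~ bounded_set W.
Proof.
move=> oW cW Wx /cboundedP[M hM].
have : md (rc (`|M| + 1) : C) <= M.
  apply: hM; apply: (@connected_stays (connected_component setT x) W x) => //.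
  - exact: component_connected.
  - exact: connected_component_refl.
  - by move=> z /cW.
  - exact: segment_component.
rewrite md_rc ger0_norm ?addr_ge0 //; have := ler_norm M; lra.
Qed.

End Components.

(** * Points of a given period *)

Section Basin.
Variable R : realType.
Local Notation C := (cplane R).
Local Notation re z := (complex.Re (z : R[i])).
Local Notation im z := (complex.Im (z : R[i])).
Implicit Types (x y z w p q a b : C) (F : C -> C) (phi psi : R -> C).

(** [T] need not be the minimal period: a common [T] for all orbits is what makes
    limits of periodic orbits periodic. *)
Definition has_period F (T : R) x := exists phi, [/\ forall t, sol F phi t, phi 0 = x &
  forall t, phi (t + T) = phi t].

Lemma sol_shift F phi (s t : R) : sol F phi (t + s) -> sol F (fun u => phi (u + s)) t.
Proof. exact: vder_shift. Qed.

Lemma global_uniq F phi psi (s : R) : holomorphic F -> (forall t, sol F phi t) ->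
  (forall t, sol F psi t) -> phi s = psi s -> forall t, phi t = psi t.
Proof.
move=> hF h1 h2 E t.
apply: (@sol_unique R F phi psi (Num.min s t) (Num.max s t) s) => //.
  by rewrite ge_min le_max lexx.
by rewrite ge_min le_max lexx !orbT.
Qed.

Lemma period_everywhere F phi (s T : R) : holomorphic F -> (forall t, sol F phi t) ->
  phi (s + T) = phi s -> forall t, phi (t + T) = phi t.
Proof.
move=> hF hs E; apply: (@global_uniq F (fun t => phi (t + T)) phi s hF) => // t.
exact: sol_shift.
Qed.

Lemma has_periodP F phi (s T : R) : holomorphic F -> (forall t, sol F phi t) ->
  has_period F T (phi s) -> forall t, phi (t + T) = phi t.
Proof.
move=> hF hs [psi [h1 p0 pT]].
have E : forall t, psi t = phi (t + s).
  by apply: (@global_uniq F psi (fun t => phi (t + s)) 0 hF h1) => [t|]; [exact: sol_shift|rewrite add0r].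
apply: (@period_everywhere F phi s T hF hs).
by rewrite -[s in RHS]add0r -E -pT add0r E addrC.
Qed.

Lemma global_orbit F phi (s : R) : holomorphic F -> (forall t, sol F phi t) ->
  ode_orbit F (phi s) = range phi.
Proof.
move=> hF hs.
have hmax : maximal_solution F (phi s) setT (fun t => phi (t + s)).
  by apply: global_maximal => [t|]; [exact: sol_shift|rewrite add0r].
rewrite (orbitE hF hmax); apply/seteqP; split => _ [t _ <-]; first by exists (t + s).
by exists (t - s) => //; rewrite subrK.
Qed.

Lemma global_regular F phi (s t : R) : holomorphic F -> (forall t, sol F phi t) ->
  F (phi s) != 0 -> F (phi t) != 0.
Proof.
move=> hF hs Fs.
apply: (@sol_regular R F phi (Num.min s t) (Num.max s t) s) => //.
  by rewrite ge_min le_max lexx.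
by rewrite ge_min le_max lexx !orbT.
Qed.

(** The complex-time solution [Z] along [phi] covers a neighbourhood of [phi 0].  At
    a nearby point [Z w] of period [T], the solutions [Z (. + T)] and [Z] agree at
    [w], hence also at [0]: real-time and imaginary-time flows commute. *)
Lemma period_closed F phi (T : R) : holomorphic F -> 0 < T -> (forall t, sol F phi t) ->
  F (phi 0) != 0 ->
  (forall e : R, 0 < e -> exists2 y, has_period F T y & md (y - phi 0) < e) ->
  forall t, phi (t + T) = phi t.
Proof.
move=> hF T0 hs F0 near.
have [Z [d d0 [Z1 Z2]]] := @strip_window R F phi 0 T 1 hF (ltW T0) ltr01 (fun t _ => hs t) F0.
have Z0 : Z 0 = phi 0 by rewrite -(Z1 0) ?lexx ?ltW.
have imz (w z : C) : md (w - z) < d -> im z = 0 -> `|im w| < d.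
  by move=> h zi; have := im_le (w - z); rewrite imD imN zi subr0 => k; exact: le_lt_trans k h.
have rez (w z : C) : md (w - z) < d -> 0 <= re z <= T -> - d < re w < T + d.
  move=> h /andP[z0 zT]; have := le_lt_trans (re_le (w - z)) h.
  by rewrite reD reN ltr_norml => /andP[? ?]; apply/andP; split; lra.
have cs (w z : C) : md (w - z) < d -> 0 <= re z <= T -> im z = 0 -> csol F Z w.
  move=> h1 h2 h3; apply: Z2; last exact: imz h1 h3.
  by rewrite sub0r; exact: rez h1 h2.
have Fz : F (Z 0) != 0 by rewrite Z0.
have cs0 w : md (w - 0) < d -> csol F Z w.
  by move=> h; apply: cs h _ _ => //=; rewrite lexx ltW.
have [rho rho0 k] := csol_open hF d0 cs0 Fz d0.
have [y [psi [p1 p0 pT]]] := near rho rho0; rewrite -Z0 => /k[w wd Ew].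
rewrite subr0 in wd.
have ct (t : R) : 0 <= t <= T -> csol F Z (rc t + w).
  by move=> tT; apply: (@cs _ (rc t)) => //=; rewrite addrC addKr.
have E1 : psi T = Z (rc T + w).
  apply: (@sol_unique R F psi (fun s => Z (rc s + w)) 0 T 0 hF) => //.
  - by move=> t tT; apply: csol_sol; exact: ct.
  - by rewrite lexx ltW.
  - by rewrite add0r Ew.
  - by rewrite lexx ltW.
have E2 : Z (rc T + w) = Z w by rewrite -E1 -[T]add0r pT p0.
have T0' : 0 <= T by exact: ltW.
have mw (s : R) : 0 <= s <= 1 -> md (w + rc s * - w) < d.
  move=> /andP[s0 s1].
  have -> : w + rc s * - w = rc (1 - s) * w by rewrite rcB rc1; ring.
  by rewrite mdM md_rc ger0_norm ?subr_ge0 // (le_lt_trans _ wd) // ler_piMl ?md_ge0 // lerBlDr lerDl.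
have := @complex_uniq R F (fun u => Z (u + rc T)) Z w (- w) hF.
rewrite subrr add0r => E3.
have {}E3 : Z (rc T) = Z 0.
  apply: E3.
  - move=> s s01; apply: csol_shift; apply: (@cs _ (rc T)) => //=; last by rewrite T0' lexx.
    by rewrite addrK; exact: mw.
  - by move=> s s01; apply: cs0; rewrite subr0; exact: mw.
  - by rewrite addrC.
apply: (@period_everywhere F phi 0 T hF hs).
by rewrite add0r -(Z1 T) ?lexx ?T0' // E3 Z0.
Qed.

(** By Gronwall's lemma, an orbit of period [T] that starts close enough to [b]
    remains in a disc around [b] that misses [a].  The ray from [a] away from [b] then
    lies in the complement of the orbit, so [a] is in an unbounded component. *)
Lemma equilibrium_excluded F a b (T : R) : holomorphic F -> 0 < T -> F b = 0 -> b != a ->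
  exists2 e : R, 0 < e & forall y, md (y - b) < e -> has_period F T y ->
    ~ jordan_int (ode_orbit F y) a.
Proof.
move=> hF T0 Fb ba.
have ab0 : 0 < md (a - b) by rewrite md_gt0 subr_eq0 eq_sym.
have [d hd] := hF b; have [r r0 lip] := cdiff_lip hd.
pose L := 1 + md d; pose rho := Num.min r (md (a - b)).
have L0 : 0 <= L by rewrite addr_ge0 ?md_ge0.
have rho0 : 0 < rho by rewrite lt_min r0.
pose E := expR (2 * L * T).
have E1 : 1 <= E by rewrite -expR0 ler_expR !mulr_ge0 // ltW.
have E0 : 0 < E by exact: expR_gt0.
(* squared distances grow by a factor [E] at most during a period *)
exists (rho / (2 * E)); first by rewrite divr_gt0 // mulr_gt0.
move=> y yb [phi [hs p0 pT]] [na /cboundedP[M hM]].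
have step s : 0 <= s <= T -> (forall u, 0 <= u <= s -> md (phi u - b) < rho) ->
    md (phi s - b) <= rho / 2.
  move=> /andP[s0 sT] h.
  have [||g _] := @exponential_growth R phi (fun u => F (phi u)) b L 0 s s0.
  - by move=> u _; exact: hs.
  - move=> u /h; rewrite lt_min => /andP[/lip + _]; rewrite Fb subr0; exact.
  rewrite -(ler_pXn2r (n := 2)) ?nnegrE ?md_ge0 ?divr_ge0 ?(ltW rho0) //.
  rewrite (le_trans g) // p0 subr0.
  have h1 : expR (2 * L * s) <= E by rewrite ler_expR ler_wpM2l // mulr_ge0.
  have h2 : md (y - b) ^+ 2 <= (rho / (2 * E)) ^+ 2.
    by rewrite ler_pXn2r ?nnegrE ?md_ge0 ?divr_ge0 ?mulr_ge0 ?(ltW rho0) ?(ltW E0) // ltW.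
  rewrite (le_trans (ler_pM (expR_ge0 _) (sqr_ge0 _) h1 h2)) //.
  have -> : E * (rho / (2 * E)) ^+ 2 = (rho / 2) ^+ 2 / E by field; rewrite gt_eqF.
  by rewrite ler_pdivrMr // ler_peMr ?sqr_ge0.
have half : rho / 2 < rho by rewrite ltr_pdivrMr // mulr_natr mulr2n ltrDl.
(* the linear bound on the field only holds in the disc of radius [rho], hence the
   continuation argument *)
have ball : forall t, 0 <= t <= T -> md (phi t - b) <= rho / 2.
  apply: real_ind.
  - rewrite p0 ltW // (lt_le_trans yb) // ler_pdivrMr ?mulr_gt0 //.
    have -> : rho / 2 * (2 * E) = rho * E by field.
    by rewrite ler_peMr // ltW.
  - move=> t /andP[t0 tT] h.
    have [|q q0 k] := vder_cont (hs t) (e := rho / 2); first by rewrite divr_gt0.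
    exists q => // s /andP[ts stq] sT; apply: step; first by rewrite sT (le_trans t0) // ltW.
    move=> u /andP[u0 us]; have [ut|tu] := leP u t.
      by rewrite (le_lt_trans _ half) // h // u0.
    have := k u; rewrite gtr0_norm ?subr_gt0 // ltrBlDl (le_lt_trans us stq) => /(_ isT) k1.
    have := h t; rewrite t0 lexx => /(_ isT) k2.
    have := mdB_le (phi u) (phi t) b; lra.
  - move=> t /andP[t0 tT] h; apply: step; first by rewrite tT ltW.
    move=> u /andP[u0 ut]; have [u_t|tu] := ltP u t.
      by rewrite (le_lt_trans _ half) // h // u0.
    have -> : u = t by apply/le_anti; rewrite ut.
    have [|q q0 k] := vder_cont (hs t) (e := rho / 2); first by rewrite divr_gt0.
    pose m := Num.max 0 (t - q / 2).
    have m0 : 0 <= m by rewrite le_max lexx.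
    have mt : m < t by rewrite gt_max t0 /=; lra.
    have mq : t - q / 2 <= m by rewrite le_max lexx orbT.
    have := k m; rewrite ltr0_norm ?subr_lt0 // opprB => k1.
    have {}k1 := k1 _; have k2 := h m; rewrite m0 mt in k2.
    have := mdB_le (phi t) (phi m) b; rewrite mdC.
    have k3 : t - m < q by lra.
    have := k1 k3; rewrite mdC; have := k2 isT; lra.
have all : forall t, md (phi t - b) <= rho / 2.
  apply: (periodic_ind T0 _ _ ball).
    by move=> t; rewrite pT.
  by move=> t; rewrite -{1}(subrK T t) pT.
have orb : ode_orbit F y = range phi by rewrite -p0; exact: global_orbit.
have rhoab : rho <= md (a - b) by rewrite ge_min lexx orbT.
pose s := (M + md a + 1) / md (a - b).
have Ma : md a <= M by apply: hM; exact: connected_component_refl.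
have s0 : 0 <= s by rewrite divr_ge0 ?md_ge0 // addr_ge0 // addr_ge0 ?md_ge0 // (le_trans _ Ma) // md_ge0.
have ray : connected_component (~` ode_orbit F y) a (a + rc s * (a - b)).
  apply: segment_component => u /andP[u0 u1]; rewrite orb => -[t _ Et].
  have := all t; rewrite Et.
  have -> : a + rc u * (a + rc s * (a - b) - a) - b = rc (1 + u * s) * (a - b).
    by rewrite rcD rcM rc1; ring.
  have us : 0 <= u * s by rewrite mulr_ge0.
  rewrite mdM md_rc ger0_norm ?addr_ge0 // => h.
  have : md (a - b) <= (1 + u * s) * md (a - b) by rewrite ler_peMl ?lerDl // ltW.
  lra.
have := hM _ ray.
have : s * md (a - b) <= md (a + rc s * (a - b)) + md a.
  rewrite -[s in X in X <= _]ger0_norm // -md_rc -mdM.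
  have := mdD (a + rc s * (a - b)) (- a).
  by rewrite mdN addrAC subrr add0r.
rewrite mulfVK ?gt_eqF //; lra.
Qed.

End Basin.

(** * The basin of a center *)

Section CenterBasin.
Variable R : realType.
Local Notation C := (cplane R).
Local Notation re z := (complex.Re (z : R[i])).
Local Notation im z := (complex.Im (z : R[i])).
Variables (F : C -> C) (a : C).
Hypothesis hF : holomorphic F.
Hypothesis Fa : F a = 0.
Implicit Types (x y z w p q b : C) (phi psi : R -> C).

Local Notation surrounds x := (jordan_int (ode_orbit F x) a).

Section Tube.
Variables (Z : C -> C) (delta T : R).
Hypothesis T0 : 0 < T.
Hypothesis Zc : forall z, `|im z| < delta -> csol F Z z.
Hypothesis Zr : forall z, `|im z| < delta -> F (Z z) != 0.
Hypothesis ZT : forall z, `|im z| < delta -> Z (z + rc T) = Z z.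

Lemma tube_sol z : `|im z| < delta -> forall t, sol F (fun s => Z (rc s + z)) t.
Proof. by move=> zd t; apply: csol_sol; apply: Zc; rewrite imD /= add0r. Qed.

Lemma tube_period z : `|im z| < delta -> has_period F T (Z z).
Proof.
move=> zd; exists (fun s => Z (rc s + z)); split; first exact: tube_sol.
  by rewrite add0r.
move=> t; rewrite rcD addrAC ZT // imD /= add0r //.
Qed.

Lemma tube_orbit z : `|im z| < delta ->
  ode_orbit F (Z z) = Z @` [set w | im w = im z].
Proof.
move=> zd; have := @global_orbit R F _ 0 hF (tube_sol zd).
rewrite add0r => ->; apply/seteqP; split => [_ [t _ <-]|_ [w /= wz <-]].
  by exists (rc t + z) => //=; rewrite imD /= add0r.
exists (re w - re z) => //; congr Z.
by apply: cplane_ext; rewrite ?(reD, imD) /= ?subrK ?add0r.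
Qed.

Lemma tube_open z : `|im z| < delta -> forall e : R, 0 < e ->
  exists2 rho : R, 0 < rho &
    forall q, md (q - Z z) < rho -> exists2 w, md (w - z) < e & Z w = q.
Proof.
move=> zd; have r0 : 0 < delta - `|im z| by rewrite subr_gt0.
apply: (csol_open hF r0) (Zr zd) => w wz; apply: Zc.
have := im_le (w - z); rewrite imD imN => k.
have -> : im w = (im w - im z) + im z by rewrite subrK.
by rewrite (le_lt_trans (ler_normD _ _)) //; lra.
Qed.

Variable e : R.
Hypothesis e0 : 0 < e.
Hypothesis Zsep : forall z w, `|im z| < delta -> `|im w| < delta ->
  0 < `|im z - im w| < e -> Z z != Z w.

(* for [eps = -1] the strip is turned upside down by [u |-> - u], which preserves
   periodicity *)
Lemma tube_surrounds_side z w (eps sigma : R) : eps = 1 \/ eps = -1 -> 0 < sigma ->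
  `|im z| < delta -> `|im w| < delta -> im w = im z + eps * sigma ->
  surrounds (Z z) -> surrounds (Z w).
Proof.
move=> heps s0 zd wd wE.
rewrite (tube_orbit zd) (tube_orbit wd).
pose y0 := im z.
pose Y u := Z (rc eps * u + mk 0 y0).
have ne : `|eps| = 1 by case: heps => ->; rewrite ?normrN normr1.
have ee : eps * eps = 1 by case: heps => ->; rewrite ?mulrNN mul1r.
have imY u : im (rc eps * u + mk 0 y0) = eps * im u + y0.
  by rewrite imD im_rcM.
have lineY (y : R) : Z @` [set u : C | im u = y0 + eps * y] = Y @` [set u : C | im u = y].
  apply/seteqP; split => _ [u /= uy <-].
    exists (rc eps * (u - mk 0 y0)) => /=.
      by rewrite im_rcM imD imN uy /= addrAC subrr add0r mulrA ee mul1r.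
    by rewrite /Y mulrA -rcM ee rc1 mul1r subrK.
  by exists (rc eps * u + mk 0 y0) => //=; rewrite imY uy addrC.
have -> : [set u : C | im u = im z] = [set u : C | im u = y0 + eps * 0].
  by rewrite mulr0 addr0.
rewrite wE !lineY.
pose eta := Num.min e (Num.min (delta - `|im z|) (delta - `|im w|)).
have eta0 : 0 < eta by rewrite !lt_min e0 !subr_gt0 zd.
have eta_e : eta <= e by rewrite ge_min lexx.
have eta_z : eta <= delta - `|im z| by rewrite !ge_min lexx orbT.
have eta_w : eta <= delta - `|im w| by rewrite !ge_min lexx !orbT.
have inU u : - eta < im u < sigma + eta -> `|im (rc eps * u + mk 0 y0)| < delta.
  move=> /andP[u1 u2]; rewrite imY.
  have k1 := ler_norm (im z); have k2 := ler_norm (- im z).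
  have k3 := ler_norm (im w); have k4 := ler_norm (- im w).
  rewrite normrN in k2; rewrite normrN in k4.
  rewrite ltr_norml /y0; move: wE k3 k4.
  by case: heps => -> wE k3 k4; apply/andP; split; lra.
have iso u v : md ((rc eps * u + mk 0 y0) - (rc eps * v + mk 0 y0)) = md (u - v).
  rewrite [X in md X](_ : _ = rc eps * (u - v)); last by ring.
  by rewrite mdM md_rc ne mul1r.
apply: (@parallel_surround R Y a T eta sigma T0 eta0 s0).
- move=> u /inU ud e' e'0; have [r r0 k] := cdiff_cont (Zc ud) e'0.
  by exists r => // v vu; apply: k; rewrite iso.
- move=> u /inU ud e' e'0; have [rho rho0 k] := tube_open ud e'0.
  exists rho => // q /k[v vu Ev]; exists (rc eps * (v - mk 0 y0)).
    rewrite -iso mulrA -rcM ee rc1 mul1r subrK //.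
  by rewrite /Y mulrA -rcM ee rc1 mul1r subrK.
- move=> u /inU ud; rewrite /Y mulrDr.
  case: heps => hE.
    by rewrite {2}hE rc1 mul1r addrAC ZT.
  rewrite {2}hE rcN rc1 mulN1r -[in RHS](subrK (rc T) (rc eps * u + mk 0 y0)) ZT.
    by congr Z; ring.
  by rewrite imD imN /= subr0.
- move=> u /inU ud; apply/eqP => E; have := Zr ud.
  by rewrite -/(Y u) E Fa eqxx.
- move=> u v v0 /andP[u1 u2].
  have ud : `|im (rc eps * u + mk 0 y0)| < delta by apply: inU; rewrite u1; lra.
  have vd : `|im (rc eps * v + mk 0 y0)| < delta.
    by apply: inU; rewrite v0 oppr_lt0 eta0 addr_gt0.
  apply: Zsep => //.
  have -> : im (rc eps * u + mk 0 y0) - im (rc eps * v + mk 0 y0) = eps * im u.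
    by rewrite !imY v0; ring.
  rewrite normrM ne mul1r ltr0_norm //; apply/andP; split; lra.
Qed.

Lemma tube_surrounds z w : `|im z| < delta -> `|im w| < delta ->
  surrounds (Z z) -> surrounds (Z w).
Proof.
move=> zd wd; have [h|h|h] := ltrgtP (im z) (im w).
- apply: (@tube_surrounds_side z w 1 (im w - im z)) => //; first by left.
    by rewrite subr_gt0.
  by rewrite mul1r; ring.
- apply: (@tube_surrounds_side z w (-1) (im z - im w)) => //; first by right.
    by rewrite subr_gt0.
  by rewrite mulN1r; ring.
- by rewrite (tube_orbit zd) (tube_orbit wd) h.
Qed.

End Tube.

(** The period and the property of surrounding [a] are constant along the tube of
    [x], the latter by [parallel_surround]. *)
Lemma tube_neighbourhood x (T : R) : 0 < T -> F x != 0 -> has_period F T x ->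
  exists2 rho : R, 0 < rho & forall y, md (y - x) < rho ->
    [/\ F y != 0, has_period F T y & surrounds x <-> surrounds y].
Proof.
move=> T0 Fx [phi [hs p0 pT]]; have F0 : F (phi 0) != 0 by rewrite p0.
have [Z [delta d0 [Z1 Zc Zr ZT [e e0 Zsep]]]] := periodic_strip hF T0 hs pT F0.
have im0d : `|im 0| < delta by rewrite /= normr0.
have Z0 : Z 0 = x by rewrite -rc0 Z1.
have [rho rho0 k] := tube_open Zc Zr im0d d0.
exists rho => // y; rewrite -Z0 => /k[w]; rewrite subr0 => wd <-.
have iwd : `|im w| < delta by rewrite (le_lt_trans (im_le w)).
split; first exact: Zr.
  exact: tube_period Zc ZT w iwd.
by split; apply: (tube_surrounds T0 Zc Zr ZT e0 Zsep).
Qed.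

Lemma surrounding_orbitP x : surrounding_periodic_orbit F a x <->
  [/\ F x != 0, exists2 T : R, 0 < T & has_period F T x & surrounds x].
Proof.
rewrite /surrounding_periodic_orbit (periodic_orbitP x hF); split.
  by move=> [[Fx [phi [T [T0 hs p0 pT]]]] sx]; split => //; exists T => //; exists phi.
by move=> [Fx [T T0 [phi [hs p0 pT]]] sx]; split=> //; split => //; exists phi, T.
Qed.

(** The basin restricted to the orbits of period [T].  It turns out to be the whole
    basin when [T] is the common period near [a]; the restriction makes the set
    closed under limits of points with bounded orbits. *)
Definition T_basin (T : R) : set C :=
  [set a] `|` [set x | [/\ F x != 0, has_period F T x & surrounds x]].

Variable T : R.
Hypothesis T0 : 0 < T.

Lemma T_basin_sub : T_basin T `<=` center_basin F a.
Proof.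
move=> x [->|[Fx hx sx]]; first by left.
by right; apply/surrounding_orbitP; split => //; exists T.
Qed.

(** Equilibria are excluded by [equilibrium_excluded].  Otherwise the bounded orbit
    is global, it has period [T] by [period_closed], and it surrounds [a] because the
    orbits of its tube near it do. *)
Lemma T_basin_closed b : closure (T_basin T) b -> bounded_set (ode_orbit F b) ->
  T_basin T b.
Proof.
move=> clb bb; have [->|ba] := eqVneq b a; first by left.
have ab0 : 0 < md (a - b) by rewrite md_gt0 subr_eq0 eq_sym.
have near (e : R) : 0 < e -> exists y,
    [/\ md (y - b) < e, F y != 0, has_period F T y & surrounds y].
  move=> e0; have [|y Vy] := (cclosureP _ _).1 clb (Num.min e (md (a - b))).
    by rewrite lt_min e0.
  rewrite lt_min => /andP[ye yb].
  case: Vy => [ya|[Fy hy sy]]; last by exists y.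
  by move: yb; rewrite ya ltxx.
have [Fb|Fb] := eqVneq (F b) 0.
  have [e e0 k] := equilibrium_excluded hF T0 Fb ba.
  by have [y [yb _ hy sy]] := near e e0; case: (k y yb hy).
have [I [phi hmax]] := maximal_exists b hF.
have orb := orbitE hF hmax.
have /cboundedP[M hM] := bb.
have It : forall t, I t.
  by apply: (bounded_global hF hmax (M := M)) => t tI; apply: hM; rewrite orb; exists t.
have /ode_solutionP[_ _ _ p0 hs'] := hmax.1.
have hs t : sol F phi t by exact: hs'.
have pT : forall t, phi (t + T) = phi t.
  apply: (period_closed hF T0 hs); first by rewrite p0.
  by move=> e /near[y [yb _ hy _]]; exists y => //; rewrite p0.
have hb : has_period F T b by exists phi.
have [rho rho0 k] := tube_neighbourhood T0 Fb hb.
have [y [yb _ _ sy]] := near rho rho0.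
by right; split => //; have [_ _ h] := k y yb; apply/h.
Qed.

Hypothesis T_near : exists2 e : R, 0 < e & forall x, md (x - a) < e -> T_basin T x.

Lemma T_basin_open : open (T_basin T).
Proof.
apply/copenP => x [->|[Fx hx sx]]; first exact: T_near.
have [rho rho0 k] := tube_neighbourhood T0 Fx hx; exists rho => // y /k[Fy hy h].
by right; split => //; apply/h.
Qed.

(** Distinct orbits are disjoint, and an orbit is connected. *)
Lemma orbit_in_component chi (S : R) z I phi : 0 < S -> (forall t, sol F chi t) ->
  maximal_solution F z I phi -> ~ range chi z ->
  forall t, I t -> connected_component (~` range chi) z (phi t).
Proof.
move=> S0 hc hmax nz t It.
have /ode_solutionP[_ iI I0 p0 hs] := hmax.1.
have seg (u : R) : 0 <= u <= 1 -> I (u * t).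
  move=> /andP[u0 u1]; have [t0|t0] := leP 0 t.
    by apply: (interval_seg iI I0 It); rewrite mulr_ge0 //= ler_piMl.
  apply: (interval_seg iI It I0); apply/andP; split; nra.
have := @path_component R (~` range chi) (fun u => phi (u * t)).
rewrite mul0r mul1r p0; apply=> u /seg Iu.
  by apply: vcont_scale; exact: vder_cont (hs _ Iu).
move=> [s _ E]; apply: nz; exists (s - u * t) => //.
(* the translate of [chi] that passes through the common point at the time [u * t] *)
pose xi v := chi (v + (s - u * t)).
have xs v : sol F xi v by exact: sol_shift.
have hxi : ode_solution F (chi (s - u * t)) setT xi.
  by apply/ode_solutionP; split; rewrite ?/xi ?add0r //; exact: openT.
have : forall v, Num.min 0 (u * t) <= v <= Num.max 0 (u * t) -> xi v = phi v.
  apply: (@sol_unique R F xi phi _ _ (u * t)) => //.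
  - move=> v hv; apply: hs; move: hv.
    case: (leP 0 (u * t)) => _; first exact: interval_seg.
    exact: interval_seg.
  - by rewrite ge_min le_max !lexx !orbT.
  - by rewrite /xi addrC subrK.
move=> /(_ 0); rewrite ge_min le_max !lexx => /(_ isT).
by rewrite /xi add0r p0.
Qed.

(** Let [W] be the component of [a] inside an orbit that surrounds [a].  The orbits
    of the points of [W] stay in [W], so they are bounded and [T_basin] is closed in
    the connected set [W]; as it is open, it contains [W].  Some point of the given
    orbit is in the closure of [W], and its orbit is bounded, so [T_basin_closed]
    applies once more. *)
Lemma center_basin_eq : center_basin F a = T_basin T.
Proof.
apply/seteqP; split => [x|]; last exact: T_basin_sub.
case=> [->|/surrounding_orbitP[Fx [S S0 [chi [hc c0 cS]]] sx]]; first by left.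
have orb : ode_orbit F x = range chi by rewrite -c0; exact: global_orbit.
have cc t : vcont chi t by exact: vder_cont (hc t).
have oG : open (~` range chi) by exact: (closed_range S0).
move: (sx); rewrite orb => -[na bW].
set W := connected_component _ a in bW.
have oW : open W by exact: component_open.
have Wa : W a by exact: connected_component_refl.
have /cboundedP[M hM] := bW.
have WV : W `<=` T_basin T.
  apply: (@connected_stays R W (T_basin T) a).
  - exact: component_connected.
  - exact: T_basin_open.
  - by [].
  - by left.
  - move=> z clz Wz; apply: T_basin_closed => //.
    have [I [phi hmax]] := maximal_exists z hF.
    rewrite (orbitE hF hmax); apply/cboundedP; exists M => _ [t It <-]; apply: hM.
    apply: (connected_component_trans Wz).
    apply: (orbit_in_component S0 hc hmax) => //.
    exact: connected_component_sub Wz.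
(* otherwise [W] would be closed, as its boundary lies in the orbit *)
have [q [Gq clq]] : exists q, range chi q /\ closure W q.
  apply: contrapT => h; apply: (@no_bounded_clopen R W a) => // q clq.
  have [Gq|nGq] := pselect (range chi q); first by case: h; exists q.
  exact: component_closure.
have : T_basin T q.
  apply: T_basin_closed.
    by apply: closureS WV _ clq.
  case: Gq => s _ <-; rewrite global_orbit //; exact: (bounded_range S0).
case: Gq => s _ <- [sa|[_ hq _]]; first by case: na; exists s.
right; split => //; exists chi; split => //.
exact: has_periodP hF hc hq.
Qed.

Lemma T_basin_invariant phi t : (forall s, sol F phi s) -> phi 0 != a ->
  T_basin T (phi 0) -> T_basin T (phi t).
Proof.
move=> hs na [ea|[F0 h0 s0]]; first by rewrite ea eqxx in na.
have pT := has_periodP hF hs h0.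
right; split; first exact: (@global_regular R F phi 0 t hF hs F0).
  exists (fun s => phi (s + t)); split; first by move=> s; exact: sol_shift.
    by rewrite add0r.
  by move=> s; rewrite addrAC pT.
by move: s0; rewrite !global_orbit.
Qed.

(** Along a finite piece of the orbit of [x], complex time carries nearby points of
    the basin to points of the basin near [phi t]. *)
Lemma closure_T_basin_invariant x I phi t : closure (T_basin T) x -> x != a ->
  maximal_solution F x I phi -> I t -> closure (T_basin T) (phi t).
Proof.
move=> clx xa hmax It.
have /ode_solutionP[ oI iI I0 p0 hs] := hmax.1.
have [Fx|Fx] := eqVneq (F x) 0.
  have -> : phi t = x; last by [].
  apply: (@ode_agree R F x I setT phi (fun=> x) t hF hmax.1) => //.
  by apply/ode_solutionP; split => //; [exact: openT|move=> s _; exact: sol_cst].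
pose lo := Num.min 0 t; pose hi := Num.max 0 t.
have lohi : lo <= hi by rewrite /lo /hi; case: (leP 0 t) => [//|/ltW].
have [Il Ih] : I lo /\ I hi by rewrite /lo /hi; case: (leP 0 t).
have [r1 r10 k1] := Rball_open oI Il; have [r2 r20 k2] := Rball_open oI Ih.
pose eta := Num.min r1 r2 / 2.
have m0 : 0 < Num.min r1 r2 by rewrite lt_min r10.
have eta0 : 0 < eta by rewrite divr_gt0.
have er1 : eta < r1.
  by have : Num.min r1 r2 <= r1 by [rewrite ge_min lexx]; rewrite /eta; lra.
have er2 : eta < r2.
  by have : Num.min r1 r2 <= r2 by [rewrite ge_min lexx orbT]; rewrite /eta; lra.
have Iin s : lo - eta <= s <= hi + eta -> I s.
  apply: interval_seg iI _ _.
    by apply: k1; rewrite addrAC subrr add0r normrN gtr0_norm.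
  by apply: k2; rewrite addrAC subrr add0r gtr0_norm.
have hs' s : lo - eta <= s <= hi + eta -> sol F phi s by move=> /Iin; exact: hs.
have lo0 : lo <= 0 by rewrite ge_min lexx.
have hi0 : 0 <= hi by rewrite le_max lexx.
have lot : lo <= t by rewrite ge_min lexx orbT.
have hit : t <= hi by rewrite le_max lexx orbT.
have Flo : F (phi lo) != 0.
  apply: (@sol_regular R F phi (lo - eta) (hi + eta) 0) => //.
  - by apply/andP; split; lra.
  - by rewrite p0.
  - by apply/andP; split; lra.
have [Z [d d0 [Z1 Z2]]] := strip_window hF lohi eta0 hs' Flo.
have cs (s : R) w : lo <= s <= hi -> md (w - rc s) < d -> csol F Z w.
  move=> /andP[s1 s2] ws; apply: Z2.
    have := le_lt_trans (re_le _) ws; rewrite reD reN /= ltr_norml => /andP[? ?].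
    by apply/andP; split; lra.
  by have := le_lt_trans (im_le _) ws; rewrite imD imN /= subr0.
have Z0 : Z 0 = x by rewrite -rc0 Z1 ?p0 // lo0.
have Zt : Z (rc t) = phi t by rewrite Z1 // lot.
have FZ0 : F (Z 0) != 0 by rewrite Z0.
have cs0 w : md (w - 0) < d -> csol F Z w by apply: cs; rewrite lo0.
apply/cclosureP => e e0.
have ct : csol F Z (rc t) by apply: (@cs t); rewrite ?lot // subrr md0.
have [r r0 kr] := cdiff_cont ct e0.
pose m := Num.min r d; have mm0 : 0 < m by rewrite lt_min r0.
have [rho rho0 k] := csol_open hF d0 cs0 FZ0 mm0.
have ax : 0 < md (a - x) by rewrite md_gt0 subr_eq0 eq_sym.
have [|y Vy] := (cclosureP _ _).1 clx (Num.min rho (md (a - x))).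
  by rewrite lt_min rho0.
rewrite lt_min => /andP[yx yax].
have ya : y != a by apply: contraTneq yax => ->; rewrite ltxx.
case: (Vy) => [//|[Fy [psi [ps q0 pT]] sy]]; first by move=> E; rewrite E eqxx in ya.
move: yx; rewrite -{1}Z0 => /k[w]; rewrite subr0 lt_min => /andP[wr wd] Ew.
have E : psi t = Z (rc t + w).
  apply: (@sol_unique R F psi (fun s => Z (rc s + w)) lo hi 0) => //.
  - by move=> s hs0; apply: csol_sol; apply: (@cs s) => //; rewrite addrC addKr.
  - by rewrite lo0.
  - by rewrite rc0 add0r Ew.
  - by rewrite lot.
exists (psi t); last by rewrite E -Zt; apply: kr; rewrite addrC addKr.
by apply: T_basin_invariant => //; rewrite q0.
Qed.

End CenterBasin.

(** * The common period near a center *)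

Section CommonPeriod.
Variable R : realType.
Local Notation C := (cplane R).
Local Notation re z := (complex.Re (z : R[i])).
Local Notation im z := (complex.Im (z : R[i])).
Implicit Types (x y z w p q a b : C) (F : C -> C).

Definition punctured_ball a (e : R) : set C := [set z | md (z - a) < e /\ z != a].

Lemma punctured_segment a p q (e : R) : md p < e -> md q < e ->
  (forall s : R, 0 <= s <= 1 -> p + rc s * (q - p) != 0) ->
  connected_component (punctured_ball a e) (a + p) (a + q).
Proof.
move=> pe qe h; apply: segment_component => s s01.
have -> : a + p + rc s * (a + q - (a + p)) = a + (p + rc s * (q - p)) by ring.
split; last by rewrite -subr_eq0 addrC addKr; exact: h.
rewrite addrC addKr; have /andP[s0 s1] := s01.
have -> : p + rc s * (q - p) = rc (1 - s) * p + rc s * q by rewrite rcB rc1; ring.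
have s1' : 0 <= 1 - s by rewrite subr_ge0.
rewrite (le_lt_trans (mdD _ _)) // !mdM !md_rc !ger0_norm //.
pose m := Num.max (md p) (md q); have me : m < e by rewrite gt_max pe.
have a1 : md p <= m by rewrite le_max lexx.
have a2 : md q <= m by rewrite le_max lexx orbT.
have := ler_wpM2l s1' a1; have := ler_wpM2l s0 a2; lra.
Qed.

(** A segment from [a + h] works unless [w] is on the opposite side of [a]; then a
    detour through [a + i h] does. *)
Lemma punctured_connected a (e h : R) w : 0 < h -> h < e -> punctured_ball a e w ->
  connected_component (punctured_ball a e) (a + rc h) w.
Proof.
move=> h0 he [we wa].
have -> : w = a + (w - a) by ring.
set u := w - a in we *.
have u0 : u != 0 by rewrite subr_eq0.
have hmd : md (rc h) < e by rewrite md_rc gtr0_norm.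
have himd : md (mk 0 h) < e by rewrite md_mk0i gtr0_norm.
have direct : im u != 0 \/ 0 < re u ->
    connected_component (punctured_ball a e) (a + rc h) (a + u).
  move=> hu; apply: punctured_segment => // s /andP[s0 s1]; apply/eqP => E.
  have Er := congr1 (fun z : C => re z) E; have Ei := congr1 (fun z : C => im z) E.
  move: Er Ei; rewrite reD imD re_rcM im_rcM reD imD reN imN /= subr0 add0r => Er Ei.
  case: hu => [iu|ru].
    have s00 : s = 0 by move/eqP: Ei; rewrite mulf_eq0 (negbTE iu) orbF => /eqP.
    by move: Er; rewrite s00 mul0r addr0; lra.
  have [s00|sn] := eqVneq s 0; first by move: Er; rewrite s00 mul0r addr0; lra.
  have sp : 0 < s by rewrite lt_def sn.
  have : 0 < s * re u by rewrite mulr_gt0.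
  have : 0 <= (1 - s) * h by rewrite mulr_ge0 ?subr_ge0 // ltW.
  lra.
have [iu|iu] := eqVneq (im u) 0; last by apply: direct; left.
have [ru|ru] := ltP 0 (re u); first by apply: direct; right.
have rn : re u < 0.
  rewrite lt_neqAle ru andbT; apply: contra_neq u0 => r0; exact: cplane_ext.
apply: (@connected_component_trans _ _ (a + mk 0 h)).
  apply: punctured_segment => // s /andP[s0 s1]; apply/eqP => E.
  have Er := congr1 (fun z : C => re z) E; have Ei := congr1 (fun z : C => im z) E.
  move: Er Ei; rewrite reD imD re_rcM im_rcM reD imD reN imN /= !subr0 !add0r => Er Ei.
  have s00 : s = 0 by move/eqP: Ei; rewrite mulf_eq0 (gt_eqF h0) orbF => /eqP.
  by move: Er; rewrite s00 mul0r addr0; lra.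
apply: punctured_segment => // s /andP[s0 s1]; apply/eqP => E.
have Er := congr1 (fun z : C => re z) E; have Ei := congr1 (fun z : C => im z) E.
move: Er Ei; rewrite reD imD re_rcM im_rcM reD imD reN imN /= iu subr0 !add0r => Er Ei.
have s00 : s = 0.
  by move/eqP: Er; rewrite mulf_eq0 (lt_eqF rn) orbF => /eqP.
by move: Ei; rewrite s00 mul0r addr0; lra.
Qed.

(** The points of a given period form an open and closed subset of a punctured
    disc, by [tube_neighbourhood] and [period_closed]. *)
Lemma common_period F a : holomorphic F -> F a = 0 ->
  (\forall x \near a^', surrounding_periodic_orbit F a x) ->
  exists2 T : R, 0 < T & exists2 e : R, 0 < e &
    forall x, md (x - a) < e -> T_basin F a T x.
Proof.
move=> hF Fa /cdnbhsP[e e0 h].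
have h' x : punctured_ball a e x -> [/\ F x != 0,
    exists2 T : R, 0 < T & has_period F T x & jordan_int (ode_orbit F x) a].
  by move=> [xe xa]; apply/(surrounding_orbitP a hF); exact: h.
pose x0 := a + rc (e / 2).
have e2 : 0 < e / 2 by rewrite divr_gt0.
have e2e : e / 2 < e by rewrite ltr_pdivrMr // mulr_natr mulr2n ltrDl.
have x0b : punctured_ball a e x0.
  split; first by rewrite addrC addKr md_rc gtr0_norm.
  by rewrite -subr_eq0 addrC addKr -md_gt0 md_rc gtr0_norm.
have [Fx0 [T T0 hx0] _] := h' x0 x0b.
exists T => //; exists e => // x xe.
have [->|xa] := eqVneq x a; first by left.
have xb : punctured_ball a e x by [].
have [Fx _ sx] := h' x xb; right; split => //.
pose V : set C := [set z | F z != 0 /\ has_period F T z].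
suff : V x by case.
apply: (@connected_stays R (connected_component (punctured_ball a e) x0) V x0).
- exact: component_connected.
- apply/copenP => z [Fz hz].
  have [rho rho0 k] := tube_neighbourhood hF Fa T0 Fz hz.
  by exists rho => // y /k[].
- exact: connected_component_refl.
- by [].
- move=> z /cclosureP clz /connected_component_sub /h'[Fz [S S0 [phi [hs p0 _]]] _].
  split => //; exists phi; split => //.
  apply: (period_closed hF T0 hs); first by rewrite p0.
  by move=> e' /clz[y [_ hy] yz]; exists y => //; rewrite p0.
- exact: punctured_connected.
Qed.

End CommonPeriod.

Theorem theorem2p4 (R : realType) (F : cplane R -> cplane R) (a : cplane R)
    (F_entire : entire F) (F_neq0 : exists z : cplane R, F z != 0)
    (a_center : is_center F a) :
  [/\ open (center_basin F a),
      unbounded (center_basin F a) &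
      forall x : cplane R, boundary (center_basin F a) x ->
        unbounded (ode_orbit F x)].
Proof.
have hF : holomorphic F by move=> z; exact/derivable_cdiff/F_entire.
have Fa : F a = 0 := a_center.1.1.
have [T T0 near] := common_period hF Fa a_center.2.
rewrite (center_basin_eq hF Fa T0 near).
have oV := T_basin_open hF Fa T0 near.
have bdry x : boundary (T_basin F a T) x -> unbounded (ode_orbit F x).
  move=> [clx nx] bx; apply: nx; apply: open_nbhs_nbhs; split => //.
  exact: (T_basin_closed hF Fa T0 clx bx).
split => // bV.
have Va : T_basin F a T a by left.
apply: (no_bounded_clopen oV _ Va bV) => x clx; apply: contrapT => nx.
have xa : x != a by apply/eqP => E; apply: nx; rewrite E.
apply: (bdry x); first by split => // /interior_subset.
have [I [phi hmax]] := maximal_exists x hF.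
rewrite (orbitE hF hmax).
have /cboundedP[M hM] := bV; apply/cboundedP; exists (M + 1) => _ [t It <-].
have /cclosureP/(_ 1 ltr01)[y Vy yp] := closure_T_basin_invariant hF clx xa hmax It.
have := hM y Vy; have := mdB_le (phi t) y 0.
rewrite !subr0 (mdC (phi t) y); lra.
Qed.
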